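(* Let $n\ge2$, $k\ge 2$ and $1\le\ell\le\lfloor n/2\rfloor$, and consider the maximal dominant weight $k\Lambda_0-\gamma_\ell\in\max(k\Lambda_0)\cap P^+$ of the $\widehat{sl}(n)$-module $V(k\Lambda_0)$, where $$\gamma_\ell=\ell\alpha_0+\sum_{i=1}^{\ell-1}(\ell-i)(\alpha_i+\alpha_{n-i}).$$ The multiplicity of $k\Lambda_0-\gamma_\ell$ in $V(k\Lambda_0)$ is equal to $|\mathcal T_\ell^k|$, where $\mathcal T_\ell^k$ is the set of admissible sequences of $k-1$ lattice paths in an $\ell\times\ell$ square (defined in the context).
   Context: $\widehat{sl}(n)$ is the affine Kac-Moody algebra of type $A^{(1)}_{n-1}$, with simple roots $\alpha_0,\dots,\alpha_{n-1}$, fundamental weights $\Lambda_i$, null root $\delta=\alpha_0+\dots+\alpha_{n-1}$ and set $P^+$ of dominant integral weights; $V(\Lambda)$ is the integrable highest weight module; $\max(\Lambda)$ is the set of weights $\mu$ of $V(\Lambda)$ with $\mu+\delta$ not a weight. The multiplicity of $\mu$ is the dimension of its weight space. **Colored square.** Consider the square with corners $(0,0)$ and $(\ell,\ell)$ divided into unit boxes. The box with lower left corner $(c,h)$, $0\le c,h\le\ell-1$, has color $j=c+h-(\ell-1)\in\{1-\ell,\dots,\ell-1\}$ (so the top left and bottom right boxes have color $0$, the bottom left box has color $1-\ell$, the top right box color $\ell-1$, and there are $\ell-|j|$ boxes of color $j$; color $-j$ stands for color $n-j$). **Admissible sequences.** Consider sequences $p_1,\dots,p_{k-1}$ of lattice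 paths from $(0,0)$ to $(\ell,\ell)$, each using unit steps up and to the right, such that for each color and each $i\ge2$ the number of boxes of that color below $p_i$ is at least the number of boxes of that color below $p_{i-1}$. Let $t_2^j$ be the number of boxes of color $j$ below $p_1$, and for $3\le i\le k$ let $t_i^j$ be the number of boxes of color $j$ between $p_{i-1}$ and $p_{i-2}$ (number below $p_{i-1}$ minus number below $p_{i-2}$). The sequence is admissible if: 1. $p_1$ does not cross the diagonal $y=x$ (it stays weakly below it; touching is allowed); 2. for each $i$ with $3\le i\le k$: (a) $t_i^j\le\min\left\{t_{i-1}^j,\ \ell-|j|-t_2^j-\sum_{a=2}^{i-1}t_a^j\right\}$ for every color $j$; (b) for $j>0$, $t_i^j\le t_i^{j-1}\le\dots\le t_i^1\le t_i^0$, and for $j<0$, $t_i^j\le t_i^{j+1}\le\dots\le t_i^{-1}\le t_i^0$. $\mathcal T_\ell^k$ is the set of admissible sequences of $k-1$ paths in the $\ell\times\ell$ square. *)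

(* Defs.v *)
From mathcomp Require Import all_boot all_order all_algebra.
From mathcomp Require Import reals complex.

Set Implicit Arguments.
Unset Strict Implicit.
Unset Printing Implicit Defensive.

Import Order.TTheory GRing.Theory Num.Theory.
Local Open Scope ring_scope.

Section LinearAlgebra.
Variables (K : fieldType) (V : lmodType K).

Definition in_span (I : finType) (b : I -> V) (v : V) : Prop :=
  exists c : I -> K, v = \sum_i c i *: b i.

Definition lin_indep (I : finType) (b : I -> V) : Prop :=
  forall c : I -> K, \sum_i c i *: b i = 0 -> forall i, c i = 0.

Definition is_subspace (U : V -> Prop) : Prop :=
  U 0 /\ forall (a : K) u v, U u -> U v -> U (a *: u + v).

(* V itself need not be finite-dimensional. *)
Definition has_dim (U : V -> Prop) (N : nat) : Prop :=
  exists b : 'I_N -> V,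
    [/\ forall i, U (b i), lin_indep b & forall v, U v -> in_span b v].

End LinearAlgebra.

Record lieAlgebra (K : fieldType) := LieAlgebra {
  lie_car :> lmodType K;
  lie_br : lie_car -> lie_car -> lie_car;
  lie_brDl : forall (a : K) x y z,
    lie_br (a *: x + y) z = a *: lie_br x z + lie_br y z;
  lie_brDr : forall (a : K) x y z,
    lie_br z (a *: x + y) = a *: lie_br z x + lie_br z y;
  lie_brxx : forall x, lie_br x x = 0;
  lie_jacobi : forall x y z,
    lie_br x (lie_br y z) + lie_br y (lie_br z x) + lie_br z (lie_br x y) = 0
}.

Section LieTheory.
Variables (K : fieldType) (g : lieAlgebra K).

Definition is_subalgebra (U : g -> Prop) : Prop :=
  is_subspace U /\ forall x y, U x -> U y -> U (lie_br x y).

Definition is_ideal (U : g -> Prop) : Prop :=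
  is_subspace U /\ forall x y, U y -> U (lie_br x y).

Record lieModule := LieModule {
  mod_car :> lmodType K;
  act : g -> mod_car -> mod_car;
  act_Dl : forall (a : K) x y v, act (a *: x + y) v = a *: act x v + act y v;
  act_Dr : forall (a : K) x u v, act x (a *: u + v) = a *: act x u + act x v;
  act_br : forall x y v,
    act (lie_br x y) v = act x (act y v) - act y (act x v)
}.

Definition is_submodule (V : lieModule) (U : V -> Prop) : Prop :=
  is_subspace U /\ forall x v, U v -> U (act x v).

End LieTheory.

Section AffineSl.
Variables (K : fieldType) (n : nat).

(* Generalized Cartan matrix of type A^(1)_(n-1), with vertices 0, ..., n-1
   taken cyclically. For n = 2 both neighbour terms contribute, so that the
   off-diagonal entries are -2, as required. Only meaningful for n >= 2. *)
Definition cartan (i j : nat) : int :=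
  ((i == j) * 2)%N%:Z - (i.+1 %% n == j)%N%:Z - (j.+1 %% n == i)%N%:Z.

(* The Cartan subalgebra h has dimension n + 1, with basis the simple coroots
   (indices Some i) and the scaling element d (index None). An element of h^*
   is given by its values on this basis. *)
Definition weight := {ffun option 'I_n -> K}.

Definition alpha (j : nat) : weight :=
  [ffun a : option 'I_n =>
     if a is Some i return K then (cartan i j)%:~R else (j == 0)%N%:R].

Definition Lambda (j : nat) : weight :=
  [ffun a : option 'I_n => if a is Some i return K then (i == j :> nat)%:R else 0].

Definition delta : weight := \sum_(j < n) alpha j.

Definition gamma (l : nat) : weight :=
  alpha 0 *+ l + \sum_(1 <= i < l) (alpha i + alpha (n - i)) *+ (l - i).

Definition dominant_integral (mu : weight) : Prop :=
  forall i : 'I_n, exists m : nat, mu (Some i) = m%:R.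

(* Kac's characterization of the Kac-Moody algebra attached to the above Cartan
   matrix and its realization (Infinite Dimensional Lie Algebras, Ch. 1). *)
Record affineSl := AffineSl {
  asl :> lieAlgebra K;
  ee : 'I_n -> asl;
  ff : 'I_n -> asl;
  hh : option 'I_n -> asl;
  hh_indep : lin_indep hh;
  br_hh : forall a b, lie_br (hh a) (hh b) = 0;
  br_he : forall a j, lie_br (hh a) (ee j) = alpha j a *: ee j;
  br_hf : forall a j, lie_br (hh a) (ff j) = - (alpha j a *: ff j);
  br_ef : forall i j, lie_br (ee i) (ff j) = if i == j then hh (Some i) else 0;
  asl_gen : forall U : asl -> Prop, is_subalgebra U ->
    (forall i, U (ee i)) -> (forall i, U (ff i)) -> (forall a, U (hh a)) ->
    forall x, U x;
  asl_ideal : forall U : asl -> Prop, is_ideal U ->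
    (forall x, U x -> in_span hh x -> x = 0) -> forall x, U x -> x = 0
}.

Section Modules.
Variables (g : affineSl) (V : lieModule g).

Definition weight_space (mu : weight) (v : V) : Prop :=
  forall a, act (hh g a) v = mu a *: v.

Definition is_weight (mu : weight) : Prop :=
  exists2 v, weight_space mu v & v != 0.

Definition is_maximal_weight (mu : weight) : Prop :=
  is_weight mu /\ ~ is_weight (mu + delta).

Definition multiplicity_is (mu : weight) (N : nat) : Prop :=
  has_dim (weight_space mu) N.

Definition highest_weight_module (La : weight) : Prop :=
  exists v : V,
    [/\ v != 0, weight_space La v, forall i, act (ee g i) v = 0
      & forall U : V -> Prop, is_submodule U -> U v -> forall w, U w].

Definition locally_nilpotent (x : g) : Prop :=
  forall v : V, exists m : nat, iter m (act x) v = 0.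

Definition integrable : Prop :=
  [/\ forall v : V, exists2 s : seq V,
        forall x, x \in s -> exists mu, weight_space mu x
        & v = \sum_(x <- s) x,
      forall i, locally_nilpotent (ee g i)
    & forall i, locally_nilpotent (ff g i)].

End Modules.
End AffineSl.

Section AdmissibleSequences.
Variable l : nat.

(* A lattice path from (0,0) to (l,l) is its word of steps: true is a unit
   step to the right, false a unit step up. *)
Definition word := (l.*2).-tuple bool.

Definition xpos (p : word) (m : nat) : nat := count id (take m p).
Definition ypos (p : word) (m : nat) : nat := count negb (take m p).

Definition is_path (p : word) : bool := count id p == l.

(* Box (c, h) has lower left corner (c, h). It is below p when the step of p
   from x = c to x = c + 1 is at height > h. *)
Definition below (p : word) (b : 'I_l * 'I_l) : bool :=
  [exists m : 'I_(l.*2),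
     [&& tnth p m, xpos p m == b.1 :> nat & (b.2 < ypos p m)%N]].

Definition color (b : 'I_l * 'I_l) : int :=
  (b.1 : nat)%:Z + (b.2 : nat)%:Z - (l%:Z - 1).

Definition colors : seq int :=
  [seq s%:Z - (l%:Z - 1) | s <- iota 0 (l.*2).-1].

Definition nbelow (p : word) (j : int) : nat :=
  #|[set b | below p b && (color b == j)]|.

Definition weakly_below_diagonal (p : word) : bool :=
  [forall m : 'I_(l.*2).+1, (ypos p m <= xpos p m)%N].

Section Sequence.
Variables (k : nat) (ps : (k.-1).-tuple word).

(* The i-th path p_i, for 1 <= i <= k - 1. *)
Definition pth (i : nat) : word := nth [tuple of nseq l.*2 true] ps i.-1.

(* t_i^j, for 2 <= i <= k. *)
Definition tcount (i : nat) (j : int) : int :=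
  if i == 2 then (nbelow (pth 1) j)%:Z
  else (nbelow (pth i.-1) j)%:Z - (nbelow (pth i.-2) j)%:Z.

Definition nested : bool :=
  all (fun i => all (fun j =>
    (nbelow (pth i.-1) j <= nbelow (pth i) j)%N) colors) (iota 2 (k - 2)).

(* The subtraction of t_2^j in addition to the sum over 2 <= a < i, which
   already contains t_2^j, is intended. *)
Definition cond_2a (i : nat) : bool :=
  all (fun j => tcount i j <=
    Num.min (tcount i.-1 j)
            (l%:Z - `|j| - tcount 2 j - \sum_(2 <= a < i) tcount a j)) colors.

(* The chains of inequalities, for all j, split into consecutive steps. *)
Definition cond_2b (i : nat) : bool :=
  all (fun j : int =>
    ((0 < j) ==> (tcount i j <= tcount i (j - 1))) &&
    ((j < 0) ==> (tcount i j <= tcount i (j + 1)))) colors.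

Definition admissible : bool :=
  [&& all is_path ps, nested, weakly_below_diagonal (pth 1)
    & all (fun i => cond_2a i && cond_2b i) (iota 3 (k - 2))].

End Sequence.

Definition admissible_sequences (k : nat) : {set (k.-1).-tuple word} :=
  [set ps | admissible ps].

End AdmissibleSequences.

(* Main.v *)
(** Since [2l <= n], [gamma_l] is supported on a chain of type [A_(2l-1)] centred
    at the vertex [0], and the multiplicity is computed inside [gl_(2l)].  The
    root vectors [F_(ab)] ([0 <= a, b < l]) of the abelian radical of the middle
    parabolic commute, and the weight space is spanned by the [l!] vectors
    [F_s v = prod_a F_(a, s a) v], [s] a permutation.  Polarising
    [f_0^(k+1) v = 0] gives, for every set [P] of [k+1] rows,
    [sum_(w in Sym P) F_(s w) v = 0]; a permutation with an increasing subsequence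
    of length [k+1] can therefore be replaced by lexicographically larger ones, so
    the permutations without such a subsequence span.

    They are independent: [f]-words applied to [v] satisfy no more relations than
    in the [k]-th tensor power of the [l]-th exterior power of the natural module,
    because that space carries a positive definite form for which [e_i] and [f_i]
    are adjoint.  There the matrix coefficient of [F_s] given by colouring each row
    with the length of the longest increasing subsequence ending before it is
    triangular.

    Finally, admissible sequences encode pairs of standard tableaux of the same
    shape with [l] boxes and at most [k] columns (the [t_i] being the column
    lengths along the colours), and Fomin's growth diagrams match such pairs with
    the permutations above, the first row of the growth diagram being the length
    of the longest increasing subsequence. *)

(* The algebra is given only by generators, weights and the absence of nonzero ideals meeting the
   Cartan subalgebra trivially, and the module only by its highest weight vector. The Serre
   relations are therefore derived from the ideal axiom. No homomorphism between the module and the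
   tensor power is available, so the two are compared through the relation [Rel], which pairs equal
   combinations of [f]-words.

   On the combinatorial side an admissible sequence records [t_2, ..., t_k] only. The missing first
   column is [t_1^j = l - |j| - t_2^j - ... - t_k^j], the boxes above the last path. The doubled
   [t_2^j] of condition 2(a), taken at [i = k], says [t_2^j <= t_1^j]; for [k = 2] the diagonal
   condition says it. Condition 2(b) makes [(t_1, ..., t_k)], read along increasing colors, gain one
   box per step up to color [0] and lose one per step afterwards. *)
Require Import Defs.
From HB Require Import structures.
From mathcomp Require Import all_boot all_order fingroup perm all_algebra.
From mathcomp Require Import zify ring.

Set Implicit Arguments.
Unset Strict Implicit.
Unset Printing Implicit Defensive.

Import Order.TTheory GRing.Theory Num.Theory.
Local Open Scope ring_scope.

(** * Subspaces, Lie algebras and their modules *)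

Section Span.
Variables (K : fieldType) (V : lmodType K).

Lemma subspace0 (U : V -> Prop) : is_subspace U -> U 0.
Proof. by case. Qed.

Lemma subspaceZ (U : V -> Prop) a u : is_subspace U -> U u -> U (a *: u).
Proof. by move=> [U0 UL] Uu; rewrite -[a *: u]addr0; apply: UL. Qed.

Lemma subspaceD (U : V -> Prop) u v : is_subspace U -> U u -> U v -> U (u + v).
Proof. by move=> [U0 UL] Uu Uv; rewrite -[u]scale1r; apply: UL. Qed.

Lemma subspaceN (U : V -> Prop) u : is_subspace U -> U u -> U (- u).
Proof. by move=> sU Uu; rewrite -scaleN1r; apply: subspaceZ. Qed.

Lemma subspaceB (U : V -> Prop) u v : is_subspace U -> U u -> U v -> U (u - v).
Proof. by move=> sU Uu Uv; apply: subspaceD => //; apply: subspaceN. Qed.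

Lemma subspace_sum (U : V -> Prop) (I : Type) (r : seq I) (P : pred I) F :
  is_subspace U -> (forall i, P i -> U (F i)) -> U (\sum_(i <- r | P i) F i).
Proof.
move=> sU UF; apply: big_ind => //; first exact: subspace0.
by move=> x y; apply: subspaceD.
Qed.

(** Combinations are lists, so that [T] may be infinite (words, monomials); [in_span] needs a finite
    index type. *)
Definition spans (T : Type) (b : T -> V) (v : V) : Prop :=
  exists s : seq (K * T), v = \sum_(x <- s) x.1 *: b x.2.

Variables (T : Type) (b : T -> V).

Lemma spans_gen t : spans b (b t).
Proof. by exists [:: (1, t)]; rewrite big_seq1 scale1r. Qed.

Lemma spans_subspace : is_subspace (spans b).
Proof.
split; first by exists [::]; rewrite big_nil.
move=> a _ _ [s ->] [s' ->]; exists ([seq (a * x.1, x.2) | x <- s] ++ s').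
rewrite big_cat big_map scaler_sumr; congr (_ + _).
by apply: eq_bigr => x _; rewrite scalerA.
Qed.

Lemma spans_min (U : V -> Prop) v :
  is_subspace U -> (forall t, U (b t)) -> spans b v -> U v.
Proof.
move=> sU Ub [s ->]; apply: subspace_sum => // x _.
exact: subspaceZ.
Qed.

End Span.

HB.instance Definition _ (K : fieldType) (g : lieAlgebra K) (M : lieModule g)
  (x : g) := GRing.isLinear.Build K M M _ (act x)
    (fun a u v => act_Dr a x u v).

HB.instance Definition _ (K : fieldType) (g : lieAlgebra K) (x : g) :=
  GRing.isLinear.Build K g g _ (lie_br x) (fun a u v => lie_brDr a u v x).

Section Lie.
Variables (K : fieldType) (g : lieAlgebra K).
Implicit Types x y z : g.

Lemma act0l (M : lieModule g) (v : M) : act (0 : g) v = 0.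
Proof. by have := act_Dl (-1) 0 0 v; rewrite scaler0 addr0 scaleN1r addNr. Qed.

Lemma actZl (M : lieModule g) a x (v : M) : act (a *: x) v = a *: act x v.
Proof. by have := act_Dl a x 0 v; rewrite act0l !addr0. Qed.

Lemma actNl (M : lieModule g) x (v : M) : act (- x) v = - act x v.
Proof. by rewrite -scaleN1r actZl scaleN1r. Qed.

Lemma act_comm (M : lieModule g) x y (v : M) :
  act x (act y v) = act y (act x v) + act (lie_br x y) v.
Proof. by rewrite act_br addrCA subrr addr0. Qed.

Lemma lieC x y : lie_br x y = - lie_br y x.
Proof.
have brl u v w : lie_br (u + v) w = lie_br u w + lie_br v w.
  by have := lie_brDl 1 u v w; rewrite !scale1r.
apply/eqP; rewrite -addr_eq0.
have := lie_brxx (x + y); rewrite brl !linearD /= !lie_brxx add0r addr0.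
by move=> ->.
Qed.

Lemma lie_jac x y z : lie_br x (lie_br y z) =
  lie_br (lie_br x y) z + lie_br y (lie_br x z).
Proof.
have := lie_jacobi x y z; rewrite [lie_br z x]lieC [lie_br z (lie_br _ _)]lieC linearN /=.
by move/eqP; rewrite subr_eq0 subr_eq => /eqP.
Qed.

Lemma lie0l x : lie_br 0 x = 0.
Proof. by rewrite lieC linear0 oppr0. Qed.

Lemma lieZl a x y : lie_br (a *: x) y = a *: lie_br x y.
Proof. by rewrite lieC linearZ /= [in RHS]lieC scalerN. Qed.

Lemma lieNl x y : lie_br (- x) y = - lie_br x y.
Proof. by rewrite lieC linearN /= [in RHS]lieC. Qed.

Lemma adj_br x y v :
  lie_br (lie_br x y) v = lie_br x (lie_br y v) - lie_br y (lie_br x v).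
Proof. by rewrite (lie_jac x y) addrK. Qed.

Definition adjoint : lieModule g :=
  @LieModule K g g (@lie_br K g) (fun a x y z => lie_brDl a x y z)
    (fun a x u v => lie_brDr a u v x) adj_br.

(** With [asl_gen], invariance under the whole algebra reduces to invariance under the
    generators. *)
Lemma stabilizer_subalgebra (M : lieModule g) (U : M -> Prop) :
  is_subspace U -> is_subalgebra (fun x => forall v, U v -> U (act x v)).
Proof.
move=> sU; split.
  split=> [v _|a x y Ux Uy v Uv]; first by rewrite act0l; apply: subspace0.
  rewrite act_Dl; apply: subspaceD => //; last exact: Uy.
  by apply: subspaceZ => //; apply: Ux.
move=> x y Ux Uy v Uv; rewrite act_br; apply: subspaceB => //.
  by apply: Ux; apply: Uy.
by apply: Uy; apply: Ux.
Qed.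

End Lie.

(** * Linear independence of the simple roots *)

Section AlphaIndep.
Variables (K : numFieldType) (n : nat).
Hypothesis n_gt1 : (1 < n)%N.

(** The affine Cartan matrix is the discrete Laplacian of the [n]-cycle; [(a + n.-1) %% n] is the
    predecessor of [a]. For [n = 2] the single neighbour is counted twice. *)
Lemma cartan_sum (c : nat -> K) (a : 'I_n) :
  \sum_(i < n) (cartan n a i)%:~R * c i =
  c a *+ 2 - c (a.+1 %% n)%N - c ((a + n.-1) %% n)%N.
Proof.
have n_gt0 : (0 < n)%N by lia.
have pick (b : 'I_n) (P : nat -> bool) : (forall i : 'I_n, P i = (i == b)) ->
    \sum_(i < n) (P i)%:Z%:~R * c i = c b.
  move=> PE; rewrite (bigD1 b) //= PE eqxx mul1r big1 ?addr0 // => i /negPf ib.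
  by rewrite PE ib mul0r.
pose b1 : 'I_n := Ordinal (ltn_pmod a.+1 n_gt0).
pose b2 : 'I_n := Ordinal (ltn_pmod (a + n.-1) n_gt0).
transitivity (c a *+ 2 - c b1 - c b2) => //.
rewrite -(pick a (fun i => a == i :> nat)%N); last first.
  by move=> i; rewrite eq_sym.
rewrite -(pick b1 (fun i => a.+1 %% n == i)%N); last first.
  by move=> i; rewrite eq_sym.
rewrite -(pick b2 (fun i => i.+1 %% n == a)%N); last first.
  move=> i; rewrite -val_eqE /=.
  have [<-|ne] := eqVneq (i.+1 %% n)%N (a : nat).
    rewrite modnDml.
    have -> : (i.+1 + n.-1 = i + n)%N by lia.
    by rewrite modnDr modn_small ?ltn_ord // eqxx.
  symmetry; apply/negbTE; apply: contraNN ne => /eqP ->.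
  rewrite -addn1 modnDml; have -> : (a + n.-1 + 1 = a + n)%N by lia.
  by rewrite modnDr modn_small // ltn_ord.
rewrite -mulr_natl mulr_sumr -!sumrB; apply: eq_bigr => i _.
rewrite /cartan !rmorphB /= PoszM rmorphM /= !mulrBl; congr (_ - _ - _).
by rewrite mulrCA mulrA mulrAC -!mulrA.
Qed.

(** The coordinate at [d] kills the difference of the coefficients of [alpha_0]. The coroot
    coordinates make the differences harmonic on the cycle, hence an arithmetic progression, and
    closing the cycle forces its step to be [0]. *)
Lemma alpha_indep (m m' : 'I_n -> nat) :
  \sum_(i < n) alpha K n i *+ m i = \sum_(i < n) alpha K n i *+ m' i -> m =1 m'.
Proof.
move=> eqmm'; have n_gt0 : (0 < n)%N by lia.
pose c (x : nat) : K :=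
  if insub x is Some i then (m i)%:R - (m' i)%:R else 0.
have cE (i : 'I_n) : c i = (m i)%:R - (m' i)%:R by rewrite /c valK.
have eqa a : \sum_(i < n) alpha K n i a * c i = 0.
  move/ffunP/(_ a)/eqP: eqmm'; rewrite !sum_ffunE -subr_eq0 -sumrB => /eqP e; rewrite -[RHS]e.
  apply: eq_bigr => i _; rewrite cE mulrBr !mulr_natr.
  by rewrite -!ffunMnE.
have c0 : c 0%N = 0.
  have := eqa None; rewrite (bigD1 (Ordinal n_gt0)) //= ffunE mul1r big1 ?addr0 //.
  by move=> i; rewrite -val_eqE /= ffunE => /negPf ->; rewrite mul0r.
have rec a : (a < n)%N -> c a *+ 2 = c (a.+1 %% n)%N + c ((a + n.-1) %% n)%N.
  move=> an; apply/eqP; rewrite -subr_eq0 opprD addrA.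
  rewrite -(cartan_sum c (Ordinal an)); apply/eqP.
  rewrite -[RHS](eqa (Some (Ordinal an))); apply: eq_bigr => i _.
  by rewrite ffunE.
have clin j : (j.+1 < n)%N -> c j = c 1%N *+ j /\ c j.+1 = c 1%N *+ j.+1.
  elim: j => [|j IHj] jn; first by rewrite c0.
  have [|cj cj1] := IHj; first exact: ltnW.
  split=> //; have := rec _ (ltnW jn); rewrite modn_small // cj1.
  have -> : ((j.+1 + n.-1) %% n = j)%N.
    have -> : (j.+1 + n.-1 = j + n)%N by lia.
    by rewrite modnDr modn_small //; lia.
  rewrite cj => e; have -> : c j.+2 = c 1%N *+ j.+1 *+ 2 - c 1%N *+ j by rewrite e addrK.
  by rewrite -mulrnA -mulrnBr; [congr (_ *+ _)|]; lia.
have c1 : c 1%N = 0.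
  have [|e1 e2] := clin n.-2; first by lia.
  have e3 : (n.-2.+1 = n.-1)%N by lia.
  rewrite e3 in e2; have := rec n.-1; rewrite prednK // modnn c0 add0r.
  have -> : ((n.-1 + n.-1) %% n = n.-2)%N.
    have -> : (n.-1 + n.-1 = n.-2 + n)%N by lia.
    by rewrite modnDr modn_small //; lia.
  rewrite e1 e2 => /(_ (leqnn _)) e.
  have : c 1%N *+ n = 0.
    transitivity (c 1%N *+ n.-1 *+ 2 - c 1%N *+ n.-2).
      by rewrite -mulrnA -mulrnBr; [congr (_ *+ _)|]; lia.
    by rewrite e subrr.
  by move/eqP; rewrite mulrn_eq0 => /orP[/eqP|/eqP //]; lia.
move=> i; apply/eqP; rewrite -(eqr_nat K) -subr_eq0 -cE.
have [->|i0] := posnP (i : nat); first by rewrite c0.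
have [|_] := clin i.-1; first by rewrite prednK.
by rewrite prednK // => ->; rewrite c1 mul0rn.
Qed.

End AlphaIndep.

(** * Weights, words in the [f_i] and Serre relations *)

Section HighestWeight.
Variables (K : numFieldType) (n : nat).
Hypothesis n_gt1 : (1 < n)%N.
Variables (g : affineSl K n).
Implicit Types (la mu nu : weight K n).

Lemma weightN mu a : (- mu) a = - mu a. Proof. by rewrite ffunE. Qed.

Lemma weightD mu nu a : (mu + nu) a = mu a + nu a. Proof. by rewrite ffunE. Qed.

Section WeightSpaces.
Variable M : lieModule g.

Lemma weight_spaceZ mu a (v : M) :
  weight_space mu v -> weight_space mu (a *: v).
Proof. by move=> wv b; rewrite linearZ /= wv !scalerA mulrC. Qed.

Lemma weight_space_subspace mu : is_subspace (@weight_space K n g M mu).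
Proof.
split=> [a|a u v wu wv b]; first by rewrite linear0 scaler0.
by rewrite linearP /= wu wv scalerDr !scalerA mulrC.
Qed.

Lemma weight_space_act mu nu (x : g) (v : M) :
  (forall a, lie_br (hh g a) x = nu a *: x) ->
  weight_space mu v -> weight_space (mu + nu) (act x v).
Proof.
move=> wx wv a; rewrite act_comm wv wx linearZ actZl /= -scalerDl.
by rewrite ffunE.
Qed.

(* If [nu t a != mu a] for the head [t] of the family, then [h_a - nu t a]
   kills that vector and rescales the sum by a nonzero factor. *)
Lemma weight_indep (T : Type) (nu : T -> weight K n) (x : T -> M)
    (r : seq (K * T)) mu :
    (forall t, weight_space (nu t) (x t)) ->
    all (fun ct => nu ct.2 != mu) r ->
    weight_space mu (\sum_(ct <- r) ct.1 *: x ct.2) ->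
  \sum_(ct <- r) ct.1 *: x ct.2 = 0.
Proof.
move=> wx; have [m] := ubnP (size r); elim: m r => // m IHm [|[c t] r] /=.
  by rewrite big_nil.
rewrite ltnS => sr /andP[tmu rmu]; set v := \sum_(_ <- _) _ => wv.
have [a na] : exists a, nu t a != mu a.
  apply/existsP; apply: contraNT tmu; rewrite negb_exists => /forallP e.
  by apply/eqP/ffunP => a; apply/eqP; have := e a; rewrite negbK.
pose r' := [seq (ct.1 * (nu ct.2 a - nu t a), ct.2) | ct <- r].
have e : \sum_(ct <- r') ct.1 *: x ct.2 = (mu a - nu t a) *: v.
  rewrite scalerBl -(wv a) /v linear_sum scaler_sumr -sumrB big_cons big_map /=.
  rewrite linearZ /= wx !scalerA [c * _]mulrC subrr add0r.
  apply: eq_bigr => ct _; rewrite linearZ /= wx !scalerA -scalerBl.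
  by rewrite mulrBr [nu t a * _]mulrC.
have /eqP : (mu a - nu t a) *: v = 0.
  rewrite -e; apply: IHm; rewrite ?size_map ?all_map //.
  by rewrite e; apply: weight_spaceZ.
by rewrite scaler_eq0 subr_eq0 eq_sym (negPf na) => /eqP.
Qed.

(** The terms of weight other than [mu] sum to a vector that again has weight [mu], so
    [weight_indep] kills them. *)
Lemma weight_proj (T : Type) (nu : T -> weight K n) (x : T -> M)
    (r : seq (K * T)) mu :
    (forall t, weight_space (nu t) (x t)) ->
    weight_space mu (\sum_(ct <- r) ct.1 *: x ct.2) ->
  \sum_(ct <- r) ct.1 *: x ct.2 =
  \sum_(ct <- r | nu ct.2 == mu) ct.1 *: x ct.2.
Proof.
move=> wx wv; rewrite (bigID (fun ct => nu ct.2 == mu)) /=.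
rewrite -[X in _ + X]big_filter (@weight_indep _ nu x _ mu wx) ?addr0 //.
  exact/filter_all.
rewrite big_filter; set s := \sum_(_ <- _ | _) _.
have -> : s = \sum_(ct <- r) ct.1 *: x ct.2 -
   \sum_(ct <- r | nu ct.2 == mu) ct.1 *: x ct.2.
  rewrite (bigID (fun ct => nu ct.2 == mu)) /=.
  by rewrite addrAC subrr add0r.
have sS := @weight_space_subspace mu.
apply: (subspaceB sS) => //; apply: (subspace_sum _ sS) => ct /eqP <-.
exact: weight_spaceZ.
Qed.

End WeightSpaces.

Section Words.
Variables (M : lieModule g) (la : weight K n) (v : M).
Hypotheses (v_la : weight_space la v) (ee_v : forall i, act (ee g i) v = 0).

Definition fword (u : seq 'I_n) : M := foldr (fun i w => act (ff g i) w) v u.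

Definition wdeg (u : seq 'I_n) : weight K n :=
  \sum_(i < n) alpha K n i *+ count_mem i u.

Lemma wdeg_cons i u : wdeg (i :: u) = alpha K n i + wdeg u.
Proof.
rewrite /wdeg (bigD1 i) //= [in RHS](bigD1 i) //= addrA; congr (_ + _).
  by rewrite eqxx mulrnDr.
by apply: eq_bigr => j; rewrite eq_sym => /negPf ->.
Qed.

Lemma fword_weight u : weight_space (la - wdeg u) (fword u).
Proof.
elim: u => [|i u IHu] /=.
  by rewrite /wdeg big1 ?subr0 // => i _; rewrite mulr0n.
rewrite wdeg_cons opprD addrCA addrC; apply: weight_space_act => // a.
by rewrite br_hf weightN scaleNr.
Qed.

Lemma spans_fword_ff i w : spans fword w -> spans fword (act (ff g i) w).
Proof.
have sS := spans_subspace fword.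
move=> [s ->]; rewrite linear_sum; apply: (subspace_sum _ sS) => x _.
rewrite linearZ; apply: (subspaceZ _ sS).
exact: (spans_gen fword (i :: x.2)).
Qed.

Lemma spans_fword_ee i w : spans fword w -> spans fword (act (ee g i) w).
Proof.
have sS := spans_subspace fword.
move=> [s ->]; rewrite linear_sum; apply: (subspace_sum _ sS) => // -[c u] _ /=.
rewrite linearZ; apply: (subspaceZ _ sS) => //=.
elim: u => [|j u IHu] /=; first by rewrite ee_v; apply: (subspace0 sS).
rewrite act_comm br_ef; apply: (subspaceD sS) => //; first exact: spans_fword_ff.
case: eqP => _; last by rewrite act0l; apply: (subspace0 sS).
rewrite fword_weight; apply: (subspaceZ _ sS) => //; exact: spans_gen.
Qed.

Lemma spans_fword_hh a w : spans fword w -> spans fword (act (hh g a) w).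
Proof.
have sS := spans_subspace fword.
move=> [s ->]; rewrite linear_sum; apply: (subspace_sum _ sS) => // -[c u] _ /=.
rewrite linearZ /= fword_weight; do 2!apply: (subspaceZ _ sS) => //.
exact: spans_gen.
Qed.

(** The [e_i] and [h_a] can be commuted to the right, down to the highest weight vector, so words in
    the [f_i] alone suffice. *)
Lemma spans_fword_submodule : is_submodule (spans fword).
Proof.
have sS := spans_subspace fword.
split=> // x; apply: (asl_gen (stabilizer_subalgebra sS)) => i w.
- exact: spans_fword_ee.
- exact: spans_fword_ff.
- exact: spans_fword_hh.
Qed.

End Words.

(* The span of the [ad f]-words on [x] is an ideal whose weights avoid [0], so
   it meets the Cartan subalgebra trivially. *)
Lemma ff_singular_eq0 (x : g) la :
    (forall a, lie_br (hh g a) x = la a *: x) ->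
    (forall i, lie_br (ee g i) x = 0) ->
    (forall m : 'I_n -> nat, la != \sum_(i < n) alpha K n i *+ m i) ->
  x = 0.
Proof.
move=> wx ex nla; pose M := adjoint g.
have wx' : weight_space (V := M) la x by [].
have ex' i : act (ee g i) (x : M) = 0 by exact: ex.
have sub := spans_fword_submodule wx' ex'.
apply: (@asl_ideal K n g (spans (fword (x : M)))); last 1 first.
- exact: (spans_gen _ [::]).
- by case: sub => sU aU; split=> // y z; apply: aU.
move=> y [s ye] [c yh].
have w0 : weight_space (V := M) 0 y.
  move=> a; rewrite /= ffunE scale0r yh linear_sum big1 // => b _.
  by rewrite linearZ /= br_hh scaler0.
rewrite ye; rewrite ye in w0.
rewrite (weight_proj (fword_weight wx') w0) big1 // => ct.
by rewrite subr_eq0 (negPf (nla _)).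
Qed.

Lemma cartan_diag (i : 'I_n) : cartan n i i = 2.
Proof.
rewrite /cartan eqxx; suff /negPf -> : (i.+1 %% n)%N != i by [].
have := ltn_ord i; rewrite leq_eqVlt => /orP[/eqP e|lt].
  by rewrite e modnn; lia.
by rewrite modn_small; lia.
Qed.

Lemma alphaS (i j : 'I_n) : alpha K n j (Some i) = (cartan n i j)%:~R.
Proof. by rewrite ffunE. Qed.

(** Supplies the weight hypothesis of [ff_singular_eq0] for brackets of the [f_i]. *)
Lemma nonempty_root_neq (P : 'I_n -> nat) i : (0 < P i)%N ->
  forall m : 'I_n -> nat,
    - (\sum_(i < n) alpha K n i *+ P i) != \sum_(i < n) alpha K n i *+ m i.
Proof.
move=> Pi m; apply/eqP => /eqP; rewrite eq_sym -addr_eq0 -big_split /= => /eqP e.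
have := @alpha_indep K n n_gt1 (fun i => m i + P i)%N (fun=> 0%N).
rewrite (eq_bigr (fun i : 'I_n => alpha K n i *+ m i + alpha K n i *+ P i)); last first.
  by move=> j _; rewrite mulrnDr.
rewrite e [RHS]big1 => // /(_ erefl i) /eqP; rewrite addn_eq0 => /andP[_].
by rewrite eqn0Ngt Pi.
Qed.

Lemma alpha_deg (i : 'I_n) :
  alpha K n i = \sum_(j < n) alpha K n j *+ (j == i).
Proof.
by rewrite (bigD1 i) //= eqxx big1 ?addr0 // => j /negPf ->.
Qed.

Lemma br_hf_scale a (j : 'I_n) :
  lie_br (hh g a) (ff g j) = (- alpha K n j a) *: ff g j.
Proof. by rewrite br_hf scaleNr. Qed.

Lemma br_eigen (h x y : g) (a b : K) : lie_br h x = a *: x ->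
  lie_br h y = b *: y -> lie_br h (lie_br x y) = (a + b) *: lie_br x y.
Proof. by move=> hx hy; rewrite lie_jac hx hy lieZl linearZ -scalerDl. Qed.

(** The bracket is a vector of negative weight killed by every [ad e_p]. *)
Lemma serre0 (i j : 'I_n) : cartan n i j = 0 -> cartan n j i = 0 -> i != j ->
  lie_br (ff g i) (ff g j) = 0.
Proof.
move=> cij cji ij; apply: (@ff_singular_eq0 _ (- (alpha K n i + alpha K n j))).
- move=> a; rewrite (br_eigen (br_hf_scale a i) (br_hf_scale a j)).
  by rewrite weightN weightD opprD.
- move=> p; rewrite lie_jac !br_ef.
  case: (eqVneq p i) => [->|pi]; last case: (eqVneq p j) => [->|pj].
  + by rewrite (negPf ij) linear0 addr0 br_hf alphaS cij scale0r oppr0.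
  + by rewrite lie0l add0r lieC br_hf alphaS cji scale0r !oppr0.
  by rewrite lie0l linear0 addr0.
- rewrite !alpha_deg -big_split /=.
  under eq_bigr do rewrite -mulrnDr.
  by apply: (@nonempty_root_neq _ i); rewrite eqxx.
Qed.

(** Again a singular vector: for [p = i] the contributions [[h_i, [f_i, f_j]]] and [[f_i,
    [h_i, f_j]]] are opposite, and for [p = j] a multiple of [[f_i, f_i]] is left. *)
Lemma serre1 (i j : 'I_n) : cartan n i j = -1 -> cartan n j i = -1 -> i != j ->
  lie_br (ff g i) (lie_br (ff g i) (ff g j)) = 0.
Proof.
move=> cij cji ij.
have wij a : lie_br (hh g a) (lie_br (ff g i) (ff g j)) =
     - (alpha K n i + alpha K n j) a *: lie_br (ff g i) (ff g j).
  by rewrite (br_eigen (br_hf_scale a i) (br_hf_scale a j)) weightD opprD.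
apply: (@ff_singular_eq0 _ (- (alpha K n i *+ 2 + alpha K n j))).
- move=> a; rewrite (br_eigen (br_hf_scale a i) (wij a)).
  by congr (_ *: _); rewrite weightN [alpha K n i *+ 2]mulr2n !weightD; ring.
- move=> p; rewrite lie_jac [lie_br (ee g p) (lie_br _ _)]lie_jac !br_ef.
  case: (eqVneq p i) => [->|pi]; last case: (eqVneq p j) => [->|pj].
  + rewrite (negPf ij) linear0 addr0 wij br_hf !alphaS cij linearN linearZ /=.
    rewrite weightD !alphaS cartan_diag cij -scaleNr -scalerDl.
    by rewrite (_ : _ + _ = 0) ?scale0r //; ring.
  + rewrite !lie0l !add0r [lie_br _ (hh _ _)]lieC br_hf alphaS cji linearN.
    by rewrite /= linearN linearZ /= lie_brxx scaler0 !oppr0.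
  by rewrite !lie0l linear0 addr0 add0r linear0.
- rewrite !alpha_deg -sumrMnl -big_split /=.
  under eq_bigr do rewrite -mulrnA -mulrnDr.
  by apply: (@nonempty_root_neq _ i); rewrite eqxx.
Qed.

(* sl2-theory: [e f^m v = m (c - m + 1) f^(m-1) v]. *)
Lemma ff_pow_eq0 (M : lieModule g) (v : M) la (i : 'I_n) (c : nat) :
    weight_space la v -> (forall j, act (ee g j) v = 0) ->
    la (Some i) = c%:R -> locally_nilpotent M (ff g i) ->
  iter c.+1 (act (ff g i)) v = 0.
Proof.
move=> wv ev lc nilp.
have itw m : act (hh g (Some i)) (iter m (act (ff g i)) v) =
    (c%:R - m%:R *+ 2) *: iter m (act (ff g i)) v.
  elim: m => [|m IHm]; first by rewrite wv lc mulr0n mul0rn subr0.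
  rewrite iterS act_comm IHm linearZ /= br_hf actNl actZl -scaleNr -scalerDl.
  congr (_ *: _); rewrite alphaS.
  rewrite cartan_diag.
  by rewrite -[in RHS]natr1; ring.
have ite m : act (ee g i) (iter m.+1 (act (ff g i)) v) =
    (m.+1%:R * (c%:R - m%:R)) *: iter m (act (ff g i)) v.
  elim: m => [|m IHm].
    by rewrite /= act_comm ev linear0 add0r br_ef eqxx wv lc subr0 mul1r.
  rewrite iterS act_comm IHm br_ef eqxx itw linearZ /= -iterS -scalerDl.
  by congr (_ *: _); rewrite -![_.+1%:R]natr1; ring.
(* Descent from some vanishing power: if [f^(m+1) v = 0] and [m] differs from [c], the scalar in
   [ite] is nonzero and [f^m v = 0]. *)
have [m] := nilp v; elim: m => [v0|m IHm fm].
  by have -> : v = 0 by []; elim: (c.+1) => //= m ->; rewrite linear0.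
have [mc|mc] := eqVneq m c; first by rewrite -mc.
apply: IHm; have := ite m; rewrite fm linear0 => /esym/eqP.
by rewrite scaler_eq0 mulf_eq0 pnatr_eq0 subr_eq0 eqr_nat [c == m]eq_sym (negPf mc) => /eqP.
Qed.

End HighestWeight.

(** * Root vectors of a chain *)

Section RootVectors.
Variables (K : numFieldType) (g : lieAlgebra K) (f : nat -> g) (N : nat).
Hypothesis serre_far : forall i j, (i.+1 < j <= N)%N -> lie_br (f i) (f j) = 0.
Hypothesis serre_up :
  forall i, (i < N)%N -> lie_br (f i) (lie_br (f i) (f i.+1)) = 0.
Hypothesis serre_dn :
  forall i, (i < N)%N -> lie_br (f i.+1) (lie_br (f i.+1) (f i)) = 0.

(* [rootv p d] is the matrix unit [E_(p+d+1, p)] when [f i = E_(i+1, i)]. *)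
Fixpoint rootv (p d : nat) : g :=
  if d is d'.+1 then lie_br (f (p + d)) (rootv p d') else f p.

Lemma lie0_br (x y z : g) :
  lie_br x y = 0 -> lie_br x z = 0 -> lie_br x (lie_br y z) = 0.
Proof. by move=> xy xz; rewrite lie_jac xy xz lie0l linear0 addr0. Qed.

Lemma lieNr (x y : g) : lie_br x (- y) = - lie_br x y.
Proof. by rewrite linearN. Qed.

(** Two Jacobi expansions give [[[w, u], [w, z]]] with opposite signs, and the characteristic is not
    [2]. *)
Lemma lie0_three (u w z : g) :
  lie_br u z = 0 -> lie_br w (lie_br w z) = 0 -> lie_br w (lie_br w u) = 0 ->
  lie_br w (lie_br u (lie_br w z)) = 0.
Proof.
move=> uz wwz wwu; set A := LHS.
have A1 : A = lie_br (lie_br w u) (lie_br w z).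
  by rewrite /A lie_jac wwz linear0 addr0.
have A2 : A = - lie_br (lie_br w u) (lie_br w z).
  rewrite /A (lie_jac u) uz linear0 addr0 lie_jac [lie_br u w]lieC linearN /=.
  by rewrite wwu oppr0 lie0l add0r lieNl.
have : A *+ 2 = 0 by rewrite mulr2n {1}A2 -A1 addNr.
by rewrite -scaler_nat => /eqP; rewrite scaler_eq0 pnatr_eq0 => /eqP.
Qed.

Lemma f_far i j : (i <= N)%N -> (j <= N)%N -> (i.+1 < j)%N || (j.+1 < i)%N ->
  lie_br (f i) (f j) = 0.
Proof.
move=> iN jN /orP[ij|ij]; first by rewrite serre_far // ij.
by rewrite lieC serre_far ?oppr0 // ij.
Qed.

Lemma rootv_far i p d : (i <= N)%N -> (p + d <= N)%N ->
  (i.+1 < p)%N || (p + d.+1 < i)%N -> lie_br (f i) (rootv p d) = 0.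
Proof.
move=> iN; elim: d => [|d IHd] dN far /=; first by apply: f_far => //; lia.
by apply: lie0_br; [apply: f_far|apply: IHd]; lia.
Qed.

Lemma rootv_top p d : (p + d <= N)%N -> lie_br (f (p + d)) (rootv p d) = 0.
Proof.
case: d => [|d] dN /=; first by rewrite addn0 lie_brxx.
case: d dN => [|d] dN /=; first by rewrite addn1 serre_dn //; lia.
set t := f _; set s := f _; set y := rootv p d.
have ty : lie_br t y = 0 by apply: rootv_far; lia.
rewrite (lie_jac t s) ty linear0 addr0; apply: lie0_br => //.
rewrite /t /s [in f (p + d.+2)]addnS; apply: serre_dn; lia.
Qed.

(** Adding [alpha_i] to an interval containing [i] gives a coefficient [2], which no root of type
    [A] has. The delicate position is the second from the top, where [lie0_three] is needed. *)
Lemma rootv_mid i p d : (p <= i <= p + d)%N -> (p + d <= N)%N ->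
  lie_br (f i) (rootv p d) = 0.
Proof.
move=> /andP[pi]; rewrite leq_eqVlt => /orP[/eqP ->|]; first exact: rootv_top.
elim: d => [|d IHd] id dN; first by lia.
have [e|ne] := eqVneq i (p + d)%N; last first.
  apply: lie0_br; last by apply: IHd; lia.
  by apply: f_far; lia.
rewrite /= addnS -e; case: d e {id IHd} dN => [|d] e dN.
  rewrite /= e addn0 [lie_br (f p.+1) _]lieC linearN /= serre_up ?oppr0 //; lia.
rewrite /= -e; apply: lie0_three.
- by apply: rootv_far; lia.
- by rewrite e; apply: (@rootv_top p d.+1); lia.
- by apply: serre_up; lia.
Qed.

(** [rootv] is built by extension at the upper end; extension at the lower end costs a sign. *)
Lemma rootv_left p d : (p + d.+1 <= N)%N ->
  lie_br (f p) (rootv p.+1 d) = - rootv p d.+1.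
Proof.
elim: d => [|d IHd] dN; first by rewrite /= addn1 lieC.
have /= -> : rootv p.+1 d.+1 = lie_br (f (p + d.+2)) (rootv p.+1 d).
  by rewrite /= addSnnS.
rewrite lie_jac f_far ?lie0l ?add0r ?IHd ?linearN //; lia.
Qed.

Lemma f_rootv i p d : (p + d <= N)%N -> (i <= N)%N ->
  lie_br (f i) (rootv p d) =
  if i == (p + d.+1)%N then rootv p d.+1
  else if p == i.+1 then - rootv i d.+1 else 0.
Proof.
move=> dN iN; case: eqP => [->//|ne]; case: eqP => [e|ne'].
  by rewrite e rootv_left //; lia.
have [ip|pi] := boolP ((i.+1 < p)%N || (p + d.+1 < i)%N); first exact: rootv_far.
by apply: rootv_mid; lia.
Qed.

Variable c : nat.

(** The sum of the two roots would have coefficient [2] at [c]. Generators are peeled off the first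
    interval, from the top while the rest still contains [c], then from the bottom once [c] is its
    top end. *)
Lemma rootv_comm p d p' d' :
  (p <= c <= p + d)%N -> (p + d <= N)%N ->
  (p' <= c <= p' + d')%N -> (p' + d' <= N)%N ->
  lie_br (rootv p d) (rootv p' d') = 0.
Proof.
elim: d p' d' => [|d IHd] p' d' cpd dN cpd' dN'.
  by apply: rootv_mid => //; lia.
have [cd|cd] := leqP c (p + d); last first.
  move: IHd => _; have e : c = (p + d.+1)%N by lia.
  move: dN' cpd'; elim: d.+1 p dN e p' d' {cd cpd} => [|m IHm] p dN e p' d' dN' cpd'.
    by apply: rootv_mid => //; lia.
  rewrite -[rootv p _]opprK -rootv_left // lieNl; apply/eqP; rewrite oppr_eq0.
  apply/eqP; have IH := IHm p.+1.
  rewrite adj_br IH // ?linear0 ?sub0r; [|lia..].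
  have iN : (p <= N)%N by lia.
  rewrite f_rootv //; case: eqP => [e1|_]; first by lia.
  by case: eqP => e2; rewrite ?lieNr ?IH ?linear0 ?oppr0 //; lia.
rewrite [rootv p _]/= adj_br IHd // ?linear0 ?sub0r; [|lia..].
rewrite f_rootv //; case: eqP => e2; first by rewrite IHd ?oppr0 //; lia.
by case: eqP => [e1|_]; [lia|rewrite linear0 oppr0].
Qed.

End RootVectors.

(** * The chain of vertices supporting [gamma] *)

Lemma modnS_small (n m : nat) : (m < n)%N ->
  (m.+1 %% n = if m.+1 == n then 0 else m.+1)%N.
Proof.
by move=> mn; case: eqP => [->|ne]; [rewrite modnn|rewrite modn_small //; lia].
Qed.

Section Chain.
Variables (K : numFieldType) (n l : nat).
Hypotheses (n_gt1 : (1 < n)%N) (l_gt0 : (0 < l)%N) (l_le : (l.*2 <= n)%N).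

Lemma n_gt0 : (0 < n)%N. Proof. by lia. Qed.

(* Chain position [i <= 2l-2] of the subdiagram on which [gamma] is supported;
   position [l-1] is the affine vertex [0]. *)
Definition node (i : nat) : 'I_n := Ordinal (ltn_pmod (i + (n - l.-1)) n_gt0).

Arguments node : simpl never.

Lemma nodeE i : (i <= l.*2.-2)%N ->
  node i = (if (i < l.-1)%N then i + (n - l.-1) else i - l.-1)%N :> nat.
Proof.
move=> iN; rewrite /node /=; case: ltnP => il; first by rewrite modn_small //; lia.
have -> : (i + (n - l.-1) = i - l.-1 + n)%N by lia.
by rewrite modnDr modn_small //; lia.
Qed.

Lemma node_inj i j : (i <= l.*2.-2)%N -> (j <= l.*2.-2)%N ->
  node i = node j -> i = j.
Proof.
move=> iN jN /(congr1 (@nat_of_ord n)); rewrite !nodeE //.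
by case: ifP => ?; case: ifP => ?; lia.
Qed.

(** The chain misses the vertices from [l] to [n - l], of which there is at least one, so its two
    ends are not joined around the cycle. *)
Lemma node_succ i j : (i <= l.*2.-2)%N -> (j <= l.*2.-2)%N ->
  ((node i).+1 %% n == node j)%N = (i.+1 == j).
Proof.
move=> iN jN; rewrite modnS_small ?ltn_ord // !nodeE //.
case: (ltnP i l.-1) => ?; case: (ltnP j l.-1) => ?; case: ifP => /eqP ?;
  by apply/eqP/eqP; lia.
Qed.

Lemma cartan_node i j : (i <= l.*2.-2)%N -> (j <= l.*2.-2)%N ->
  cartan n (node i) (node j) =
  ((i == j) * 2)%N%:Z - (i.+1 == j)%N%:Z - (j.+1 == i)%N%:Z.
Proof.
move=> iN jN; rewrite /cartan !node_succ //; congr (((nat_of_bool _) * 2)%N%:Z - _ - _).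
apply/eqP/eqP => [/val_inj|->//]; exact: node_inj.
Qed.

Definition chain_coef (m : nat -> nat) (j : 'I_n) : nat :=
  \sum_(i < l.*2.-1) (node i == j) * m i.

Lemma chain_coef_node m i : (i <= l.*2.-2)%N -> chain_coef m (node i) = m i.
Proof.
move=> iN; have iN' : (i < l.*2.-1)%N by lia.
rewrite /chain_coef (bigD1 (Ordinal iN')) //= eqxx mul1n big1 ?addn0 // => j.
rewrite -val_eqE /= => /negPf ji; case: eqP => [/node_inj e|_]; last by rewrite mul0n.
by move: ji; rewrite e ?eqxx //; have := ltn_ord j; lia.
Qed.

Lemma chain_coefE (m : nat -> nat) :
  \sum_(i < l.*2.-1) alpha K n (node i) *+ m i =
  \sum_(j < n) alpha K n j *+ chain_coef m j.
Proof.
rewrite /chain_coef; under [RHS]eq_bigr => j _ do rewrite -sumrMnr.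
rewrite exchange_big /=; apply: eq_bigr => i _.
rewrite (bigD1 (node i)) //= eqxx mul1n big1 ?addr0 // => j ji.
by rewrite eq_sym (negPf ji) mul0n.
Qed.

Lemma chain_indep (m m' : nat -> nat) :
  \sum_(i < l.*2.-1) alpha K n (node i) *+ m i =
    \sum_(i < l.*2.-1) alpha K n (node i) *+ m' i ->
  forall i, (i <= l.*2.-2)%N -> m i = m' i.
Proof.
rewrite !chain_coefE => /(alpha_indep n_gt1) e i iN.
by have := e (node i); rewrite !chain_coef_node.
Qed.

(** This is [l - |i - (l - 1)|]: one of the two truncated differences is always [0]. *)
Definition gcoef (i : nat) : nat := (l - (i - l.-1) - (l.-1 - i))%N.

Lemma gammaE :
  gamma K n l = \sum_(i < l.*2.-1) alpha K n (node i) *+ gcoef i.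
Proof.
have nE i : (i <= l.*2.-2)%N -> alpha K n (node i) =
   alpha K n (if (i < l.-1)%N then i + (n - l.-1) else i - l.-1)%N.
  by move=> iN; rewrite -nodeE.
rewrite -(big_mkord xpredT (fun i => alpha K n (node i) *+ gcoef i)).
rewrite (big_cat_nat (n := l.-1)) /=; [|lia..].
rewrite (big_cat_nat (m := l.-1) (n := l)) /=; [|lia..].
rewrite -[X in index_iota l.-1 X](prednK l_gt0) big_nat1.
rewrite nE; last by lia.
rewrite ltnn subnn {2}/gcoef subnn !subn0 addrCA /gamma; congr (_ + _).
under [LHS]eq_bigr do rewrite mulrnDl.
rewrite big_split /= addrC; congr (_ + _).
  rewrite big_add1 big_nat_rev /= add0n; apply: eq_big_nat => i il.
  rewrite nE; last by lia.
  case: ifP => [_|]; last by lia.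
  by congr (alpha K n _ *+ _); rewrite /gcoef; lia.
have := big_addn 0 (l.*2.-1) l xpredT (fun i => alpha K n (node i) *+ gcoef i).
rewrite add0n big_add1 => ->.
have -> : (l.*2.-1 - l = l.-1)%N by lia.
apply: eq_big_nat => i il; rewrite nE; last by lia.
case: ifP => [|_]; first by lia.
by congr (alpha K n _ *+ _); rewrite /gcoef; lia.
Qed.
End Chain.

(** * Monomials in the commuting root vectors *)

Section Monomials.
Variables (K : numFieldType) (n l : nat).
Hypotheses (n_gt1 : (1 < n)%N) (l_gt0 : (0 < l)%N) (l_le : (l.*2 <= n)%N).
Variables (g : affineSl K n).
Local Notation nd := (node n_gt1 l_gt0 l_le).

Definition fch (i : nat) : g := ff g (nd i).

Lemma node_neq i j : (i <= l.*2.-2)%N -> (j <= l.*2.-2)%N -> i != j ->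
  nd i != nd j.
Proof. by move=> iN jN; apply: contraNneq => /node_inj ->. Qed.

Lemma fch_far i j : (i.+1 < j <= l.*2.-2)%N -> lie_br (fch i) (fch j) = 0.
Proof.
move=> ij; apply: serre0 => //; rewrite ?cartan_node; try lia.
by apply: node_neq; lia.
Qed.

Lemma fch_up i : (i < l.*2.-2)%N ->
  lie_br (fch i) (lie_br (fch i) (fch i.+1)) = 0.
Proof.
move=> ij; apply: serre1 => //; rewrite ?cartan_node; try lia.
by apply: node_neq; lia.
Qed.

Lemma fch_dn i : (i < l.*2.-2)%N ->
  lie_br (fch i.+1) (lie_br (fch i.+1) (fch i)) = 0.
Proof.
move=> ij; apply: serre1 => //; rewrite ?cartan_node; try lia.
by apply: node_neq; lia.
Qed.

Definition cdeg (m : nat -> nat) : weight K n :=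
  \sum_(i < l.*2.-1) alpha K n (nd i) *+ m i.

Lemma eq_cdeg m m' : (forall i, (i <= l.*2.-2)%N -> m i = m' i) ->
  cdeg m = cdeg m'.
Proof. by move=> e; apply: eq_bigr => i _; rewrite e //; have := ltn_ord i; lia. Qed.

Lemma cdegD m m' : cdeg (fun i => m i + m' i)%N = cdeg m + cdeg m'.
Proof. by rewrite -big_split; apply: eq_bigr => i _; rewrite mulrnDr. Qed.

Lemma cdeg_delta t : (t <= l.*2.-2)%N -> cdeg (fun i => i == t) = alpha K n (nd t).
Proof.
move=> tN; have tN' : (t < l.*2.-1)%N by lia.
rewrite /cdeg (bigD1 (Ordinal tN')) //= eqxx big1 ?addr0 // => i.
by rewrite -val_eqE /= => /negPf ->.
Qed.

Lemma rootv_weight p d a : (p + d <= l.*2.-2)%N ->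
  lie_br (hh g a) (rootv fch p d) =
  (- cdeg (fun i => p <= i <= p + d)%N) a *: rootv fch p d.
Proof.
elim: d => [|d IHd] dN.
  rewrite /= br_hf_scale addn0 -weightN -cdeg_delta; last by lia.
  congr ((- (_ : weight K n)) _ *: _); apply: eq_cdeg => i _; congr (nat_of_bool _).
  by lia.
rewrite (br_eigen (br_hf_scale _ _ _) (IHd _)); last by lia.
congr (_ *: _); rewrite -weightN -weightD -opprD -cdeg_delta // -cdegD.
by congr ((- (_ : weight K n)) _); apply: eq_cdeg => i _; lia.
Qed.

(** The matrix unit [E_(l+b, l-1-a)]: rows are numbered downwards and columns upwards from the
    middle of the chain, so that every interval contains [l - 1]. *)
Definition Fab (a b : 'I_l) : g := rootv fch (l.-1 - a) (a + b).

Lemma Fab_comm a b a' b' : lie_br (Fab a b) (Fab a' b') = 0.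
Proof.
have := (ltn_ord a, ltn_ord b, ltn_ord a', ltn_ord b') => -[[[? ?] ?] ?].
by apply: (rootv_comm fch_far fch_up fch_dn (c := l.-1)); lia.
Qed.

Lemma Fab00 (a b : 'I_l) : a = 0%N :> nat -> b = 0%N :> nat ->
  Fab a b = fch l.-1.
Proof. by rewrite /Fab => -> ->; rewrite subn0. Qed.

(** Increasing a row index extends the interval at its lower end, hence the sign of [rootv_left]. *)
Lemma fch_row (a0 a1 a b : 'I_l) : a1 = a0.+1 :> nat ->
  lie_br (fch (l.-1 - a1)) (Fab a b) = if a == a0 then - Fab a1 b else 0.
Proof.
have := (ltn_ord a, ltn_ord b, ltn_ord a1) => -[[? ?] ?] e.
rewrite /Fab (f_rootv fch_far fch_up fch_dn); [|lia..].
case: eqP => [e1|_]; first by lia.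
rewrite -[a == a0]/(a == a0 :> nat); case: eqP => ea; case: eqP => ne //; try lia.
by congr (- _); congr (rootv _ _ _); lia.
Qed.

Lemma fch_col (b0 b1 a b : 'I_l) : b1 = b0.+1 :> nat ->
  lie_br (fch (l.-1 + b1)) (Fab a b) = if b == b0 then Fab a b1 else 0.
Proof.
have := (ltn_ord a, ltn_ord b, ltn_ord b1) => -[[? ?] ?] e.
rewrite /Fab (f_rootv fch_far fch_up fch_dn); [|lia..].
rewrite -[b == b0]/(b == b0 :> nat); case: eqP => ea; case: eqP => ne //; try lia.
  by congr (rootv _ _ _); lia.
by case: eqP => //; lia.
Qed.

Lemma chain_cases i : (i <= l.*2.-2)%N ->
  [\/ i = l.-1, exists a0 a1 : 'I_l, a1 = a0.+1 :> nat /\ i = (l.-1 - a1)%N |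
      exists b0 b1 : 'I_l, b1 = b0.+1 :> nat /\ i = (l.-1 + b1)%N].
Proof.
move=> iN; case: (ltngtP i l.-1) => [lt|gt|e]; [|constructor 3|by constructor 1].
  have h0 : (l.-1 - i.+1 < l)%N by lia.
  have h1 : (l.-1 - i < l)%N by lia.
  by constructor 2; exists (Ordinal h0), (Ordinal h1); split=> /=; lia.
have h0 : (i.-1 - l.-1 < l)%N by lia.
have h1 : (i - l.-1 < l)%N by lia.
by exists (Ordinal h0), (Ordinal h1); split=> /=; lia.
Qed.

Section InModule.
Variables (V : lieModule g) (v0 : V).

Definition Mon (s : seq ('I_l * 'I_l)) : V :=
  foldr (fun ab w => act (Fab ab.1 ab.2) w) v0 s.

Lemma Mon_perm s s' : perm_eq s s' -> Mon s = Mon s'.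
Proof.
have Mon_swap x t1 t2 : Mon (t1 ++ x :: t2) = act (Fab x.1 x.2) (Mon (t1 ++ t2)).
  elim: t1 => //= y t1 ->.
  by rewrite act_comm Fab_comm act0l addr0.
elim: s s' => [|x s IHs] s'; first by rewrite perm_sym => /perm_nilP ->.
move=> ps; have xs' : x \in s' by rewrite -(perm_mem ps) mem_head.
case/splitPr: xs' ps => t1 t2; rewrite -[x :: t2]cat1s perm_sym perm_catCA perm_cons.
by rewrite perm_sym => ps; rewrite Mon_swap /= (IHs _ ps).
Qed.

Variable la : weight K n.
Hypotheses (v_la : weight_space la v0) (ee_v : forall i, act (ee g i) v0 = 0).
Hypothesis ff_v : forall i : 'I_n, (i != 0%N :> nat) -> act (ff g i) v0 = 0.

Definition Mdeg (s : seq ('I_l * 'I_l)) (i : nat) : nat :=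
  count (fun ab : 'I_l * 'I_l => l.-1 - ab.1 <= i <= l.-1 + ab.2)%N s.

Lemma Mon_weight s : weight_space (la - cdeg (Mdeg s)) (Mon s).
Proof.
elim: s => [|[a b] s IHs] /=.
  by rewrite /cdeg big1 ?subr0 // => i _; rewrite mulr0n.
rewrite (@eq_cdeg _ (fun i => (l.-1 - a <= i <= l.-1 + b)%N + Mdeg s i)%N) //.
rewrite cdegD opprD addrCA addrC; apply: weight_space_act => // h.
have := (ltn_ord a, ltn_ord b) => -[? ?].
rewrite rootv_weight; last by lia.
by congr ((- (_ : weight K n)) _ *: _); apply: eq_cdeg => i _; lia.
Qed.

Lemma fch_v i : (i <= l.*2.-2)%N -> i != l.-1 -> act (fch i) v0 = 0.
Proof.
by move=> iN ine; apply: ff_v; rewrite nodeE //; case: ifP => ?; lia.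
Qed.

Lemma spans_Mon_F a b w : spans Mon w -> spans Mon (act (Fab a b) w).
Proof.
have sS := spans_subspace Mon.
move=> [s ->]; rewrite linear_sum; apply: (subspace_sum _ sS) => x _.
rewrite linearZ; apply: (subspaceZ _ sS).
exact: (spans_gen Mon ((a, b) :: x.2)).
Qed.

(** The generator at the affine vertex is itself the factor [Fab 0 0]. The other chain generators
    kill [v0] and act on monomials as derivations shifting one row or column index. *)
Lemma spans_Mon_fch i w : (i <= l.*2.-2)%N ->
  spans Mon w -> spans Mon (act (fch i) w).
Proof.
have sS := spans_subspace Mon; move=> iN.
move=> [r ->]; rewrite linear_sum; apply: (subspace_sum _ sS) => -[cf s] _ /=.
rewrite linearZ; apply: (subspaceZ _ sS) => /= {r cf}.
case: (chain_cases iN) => [->|[a0 [a1 [e ->]]]|[b0 [b1 [e ->]]]].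
- rewrite -(@Fab00 (Ordinal l_gt0) (Ordinal l_gt0)) //.
  by apply: spans_Mon_F; apply: spans_gen.
- elim: s => [|[a b] s IHs] /=.
    by rewrite fch_v; [exact: (subspace0 sS)|have := ltn_ord a1; lia..].
  rewrite act_comm (fch_row _ _ e); apply: (subspaceD sS); first exact: spans_Mon_F.
  case: ifP => _; last by rewrite act0l; exact: (subspace0 sS).
  by rewrite actNl; apply: (subspaceN sS); apply: spans_Mon_F; apply: spans_gen.
- elim: s => [|[a b] s IHs] /=.
    by rewrite fch_v; [exact: (subspace0 sS)|have := ltn_ord b1; lia..].
  rewrite act_comm (fch_col _ _ e); apply: (subspaceD sS); first exact: spans_Mon_F.
  case: ifP => _; last by rewrite act0l; exact: (subspace0 sS).
  by apply: spans_Mon_F; apply: spans_gen.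
Qed.

(** By independence of the simple roots such a word has letters in the chain only. *)
Lemma spans_Mon_fword u : wdeg K u = gamma K n l -> spans Mon (fword v0 u).
Proof.
rewrite (gammaE K n_gt1 l_gt0 l_le) chain_coefE /wdeg => /(alpha_indep n_gt1) cu.
have {cu} : all (fun j => [exists i : 'I_(l.*2.-1), nd i == j]) u.
  apply/allP => j ju; have : (0 < count_mem j u)%N by rewrite -has_count has_pred1.
  rewrite cu lt0n /chain_coef sum_nat_eq0 negb_forall => /existsP[i].
  rewrite implyTb muln_eq0 negb_or => /andP[ij _]; apply/existsP; exists i.
  by move: ij; rewrite eqb0 negbK.
elim: u => [_|j u IHu /= /andP[/existsP[i /eqP <-] /IHu]]; first exact: (spans_gen Mon [::]).
by apply: spans_Mon_fch; have := ltn_ord i; lia.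
Qed.

Definition Fperm (s : {perm 'I_l}) : V := Mon [seq (a, s a) | a <- enum 'I_l].

(** At distance [t] below the middle, the degree counts the factors with row at least [t], and
    [gamma] has coefficient [l - t] there; subtracting consecutive counts, each row occurs once.
    Columns are treated above the middle. *)
Lemma Mon_Fperm s : cdeg (Mdeg s) = gamma K n l -> exists p, Mon s = Fperm p.
Proof.
rewrite (gammaE K n_gt1 l_gt0 l_le) => /chain_indep cs.
have ca t : (t <= l)%N -> count (fun ab : 'I_l * 'I_l => t <= ab.1)%N s = (l - t)%N.
  rewrite leq_eqVlt => /orP[/eqP ->|tl].
    rewrite subnn; apply/eqP; rewrite -leqn0 leqNgt -has_count -all_predC.
    by apply/allP => -[a b] _ /=; rewrite -ltnNge.
  have := cs (l.-1 - t)%N; rewrite /gcoef => e.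
  transitivity (Mdeg s (l.-1 - t)); last by rewrite e; lia.
  by apply: eq_count => -[a b] /=; have := (ltn_ord a, ltn_ord b) => -[? ?]; lia.
have cb t : (t <= l)%N -> count (fun ab : 'I_l * 'I_l => t <= ab.2)%N s = (l - t)%N.
  rewrite leq_eqVlt => /orP[/eqP ->|tl].
    rewrite subnn; apply/eqP; rewrite -leqn0 leqNgt -has_count -all_predC.
    by apply/allP => -[a b] _ /=; rewrite -ltnNge.
  have := cs (l.-1 + t)%N; rewrite /gcoef => e.
  transitivity (Mdeg s (l.-1 + t)); last by rewrite e; lia.
  by apply: eq_count => -[a b] /=; have := (ltn_ord a, ltn_ord b) => -[? ?]; lia.
have cm (h : 'I_l * 'I_l -> 'I_l) :
    (forall t, (t <= l)%N -> count (fun ab => t <= h ab)%N s = (l - t)%N) ->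
    perm_eq [seq h ab | ab <- s] (enum 'I_l).
  move=> ch; apply/allP => x _ /=; rewrite count_map.
  rewrite [in X in _ == X](count_uniq_mem _ (enum_uniq _)) mem_enum.
  have := ch _ (ltn_ord x); have := ch _ (ltnW (ltn_ord x)).
  have -> : count (fun ab => x <= h ab)%N s =
      (count (fun ab => x < h ab)%N s + count (preim h (pred1 x)) s)%N.
    elim: (s) => //= ab r ->; rewrite leq_eqVlt eq_sym -[h ab == x]/(h ab == x :> nat).
    by case: eqP => [->|_]; rewrite ?ltnn /=; lia.
  move=> e1 e2; rewrite inE; apply/eqP.
  change (count (preim h (pred1 x)) s = 1%N).
  by have xl := ltn_ord x; lia.
have pf := cm fst ca; have ps := cm snd cb.
have uf : uniq (map fst s) by rewrite (perm_uniq pf) enum_uniq.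
(* The column paired with row [a]; rows being distinct, the lookup is unambiguous, and the default
   is never reached. *)
pose h a := (nth (a, a) s (index a (map fst s))).2.
have hE : s = [seq (a, h a) | a <- map fst s].
  rewrite -map_comp -[LHS]map_id; apply/eq_in_map => ab /=.
  case/(nthP ab) => i si <-; set y := nth ab s i.
  have -> : y = (y.1, y.2) by case: y.
  congr (_, _); rewrite /h /=.
  have -> : index y.1 (map fst s) = i.
    by rewrite /y -(nth_map _ y.1) // index_uniq ?size_map.
  by rewrite /y (set_nth_default ab).
have h_inj : injective h.
  apply/injectiveP; rewrite /injectiveb /dinjectiveb.
  have := enum_uniq 'I_l; rewrite -(perm_uniq ps) => us.
  rewrite -(perm_uniq (perm_map h pf)).
  have -> : map h (map fst s) = map snd s by rewrite [in RHS]hE -[in RHS]map_comp.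
  by [].
exists (perm h_inj); apply: Mon_perm; rewrite {1}hE.
have := perm_map (fun a => (a, h a)) pf; rewrite -map_comp.
rewrite [X in perm_eq _ X](_ : _ = [seq (a, perm h_inj a) | a <- enum 'I_l]).
  by rewrite map_comp.
by apply: eq_map => a; rewrite permE.
Qed.

Lemma weight_spans_Fperm v :
  spans (fword v0) v -> weight_space (la - gamma K n l) v -> spans Fperm v.
Proof.
move=> [r ->] wv; have e0 := weight_proj (fword_weight v_la) wv.
rewrite {}e0 in wv *.
have [s e] : spans Mon (\sum_(ct <- r | la - wdeg K ct.2 == la - gamma K n l)
     ct.1 *: fword v0 ct.2).
  have sS := spans_subspace Mon; apply: (subspace_sum _ sS) => ct /eqP e.
  apply: (subspaceZ _ sS); apply: spans_Mon_fword.
  by apply: oppr_inj; apply: (addrI la).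
rewrite e in wv *; rewrite (weight_proj Mon_weight wv).
have sS := spans_subspace Fperm; apply: (subspace_sum _ sS) => ct /eqP /addrI /oppr_inj.
by case/Mon_Fperm => p ->; apply: (subspaceZ _ sS); apply: spans_gen.
Qed.

End InModule.
End Monomials.

(** * Increasing subsequences of permutations *)

Section Lis.
Variables (X : nat -> nat -> bool).
Local Open Scope nat_scope.

(* Length of the longest increasing chain of cells of [X] in [0,a) x [0,b). *)
Fixpoint lis (a : nat) : nat -> nat :=
  if a is a'.+1 then
    fix row b := if b is b'.+1
      then maxn (maxn (lis a' b) (row b')) (if X a' b' then (lis a' b').+1 else 0)
      else 0
  else fun=> 0.

Lemma lisSS a b : lis a.+1 b.+1 =
  maxn (maxn (lis a b.+1) (lis a.+1 b)) (if X a b then (lis a b).+1 else 0).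
Proof. by []. Qed.

Lemma lis0r a : lis a 0 = 0. Proof. by case: a. Qed.

Lemma lis_monol a a' b : a <= a' -> lis a b <= lis a' b.
Proof.
move/subnK <-; elim: (a' - a) => // d IHd; apply: leq_trans IHd _.
case: b => [|b]; first by rewrite !lis0r.
by rewrite addSn lisSS !leq_max leqnn.
Qed.

Lemma lis_mono a a' b b' : a <= a' -> b <= b' -> lis a b <= lis a' b'.
Proof.
move=> aa' bb'; apply: leq_trans (lis_monol _ aa') _.
move/subnK: bb' <-; elim: (b' - b) => // d IHd; apply: leq_trans IHd _.
case: {aa'} a' => // a'.
by rewrite addSn lisSS !leq_max leqnn orbT.
Qed.

Lemma lis_step a b : X a b -> lis a b < lis a.+1 b.+1.
Proof. by move=> Xab; rewrite lisSS Xab !leq_max leqnn !orbT. Qed.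

End Lis.

Section PermLis.
Variables (l : nat).
Implicit Types s t : {perm 'I_l}.

Definition pcell s (a b : nat) : bool :=
  [exists i : 'I_l, (i == a :> nat) && (s i == b :> nat)].

Lemma pcellP s a b :
  reflect (exists i : 'I_l, i = a :> nat /\ s i = b :> nat) (pcell s a b).
Proof.
apply: (iffP existsP) => [[i /andP[/eqP ia /eqP ib]]|[i [ia ib]]]; exists i => //.
by rewrite ia ib !eqxx.
Qed.

(** Provides the rows to which the polarised relation is applied when [s] is not in [Av l k]. *)
Lemma lis_chain s a b : exists P : {set 'I_l},
  [/\ #|P| = lis (pcell s) a b, forall i, i \in P -> (i < a)%N && (s i < b)%N
    & forall i j, i \in P -> j \in P -> (i < j)%N -> (s i < s j)%N].
Proof.
elim: a b => [|a IHa] b.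
  by exists set0; rewrite cards0; split=> // i; rewrite inE.
elim: b => [|b IHb].
  by exists set0; rewrite cards0; split=> // i; rewrite inE.
rewrite lisSS; set m := maxn (lis _ _ _) _.
have [P [cP bP iP]] : exists P : {set 'I_l},
  [/\ #|P| = m, forall i, i \in P -> (i < a.+1)%N && (s i < b.+1)%N
    & forall i j, i \in P -> j \in P -> (i < j)%N -> (s i < s j)%N].
  have [le|/ltnW le] := leqP (lis (pcell s) a b.+1) (lis (pcell s) a.+1 b); last first.
    rewrite /m (maxn_idPl le).
    have [P [cP bP iP]] := IHa b.+1; exists P; split=> // i /bP /andP[ia ib].
    by rewrite ib ltnW.
  rewrite /m (maxn_idPr le).
  have [P [cP bP iP]] := IHb; exists P; split=> // i /bP /andP[ia ib].
  by rewrite ia ltnW.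
case: pcellP => [[x [xa xb]]|_]; last by exists P; rewrite maxn0.
have [le|/ltnW le] := leqP m (lis (pcell s) a b).+1; last first.
  by exists P.
have [Q [cQ bQ iQ]] := IHa b; exists (x |: Q); split.
- by rewrite cardsU1 cQ; case: (boolP (x \in Q)) => [/bQ|//]; rewrite xa ltnn.
- by move=> i; rewrite !inE => /orP[/eqP ->|/bQ]; lia.
move=> i j; rewrite !inE => /orP[/eqP ->|iQ'] /orP[/eqP ->|jQ'] //.
- by rewrite ltnn.
- by have := bQ _ jQ'; lia.
- by have := bQ _ iQ'; lia.
exact: iQ.
Qed.

Definition permlex s : l.-tuplelexi 'I_l := [tuple s i | i < l].

Lemma permlex_lt s t (a : 'I_l) :
  (forall b : 'I_l, (b < a)%N -> s b = t b) -> (s a < t a)%N ->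
  (permlex s < permlex t)%O.
Proof.
move=> eq_st lt_st; apply/ltxi_tuplePlt; exists a.
  by move=> b ba; rewrite !tnth_mktuple; apply: eq_st.
by rewrite !tnth_mktuple.
Qed.

(** All smaller points being fixed, injectivity sends the first moved point upwards. *)
Lemma permlex_first (w : {perm 'I_l}) : w != 1%g ->
  exists2 a : 'I_l, (a < w a)%N & forall b : 'I_l, (b < a)%N -> w b = b.
Proof.
move=> w1; have [x wx] : exists x, w x != x.
  apply/existsP; apply: contraNT w1; rewrite negb_exists => /forallP e.
  by apply/eqP/permP => x; rewrite perm1; apply/eqP; have := e x; rewrite negbK.
case: (@arg_minnP _ x (fun y => w y != y) (fun y => y : nat) wx) => a wa amin.
have fix_lt (b : 'I_l) : (b < a)%N -> w b = b.
  by move=> ba; apply/eqP/negPn/negP => /amin; rewrite leqNgt ba.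
exists a => //; rewrite ltn_neqAle eq_sym wa leqNgt; apply/negP => lt.
by have /perm_inj e := fix_lt _ lt; rewrite e eqxx in wa.
Qed.

Definition Av (k : nat) : {set {perm 'I_l}} := [set s | lis (pcell s) l l <= k]%N.

End PermLis.

(** * Polarisation *)

Section Polarisation.
Variables (K : numFieldType) (V : lmodType K) (l : nat) (P : {set 'I_l}).

Definition upd (b : 'I_l -> 'I_l) (r v : 'I_l) : 'I_l -> 'I_l :=
  fun x => if x == r then v else b x.

Variable Q : ('I_l -> 'I_l) -> V.
Hypothesis Q_ext : forall b b', {in P, b =1 b'} -> Q b = Q b'.

Definition symQ (b : 'I_l -> 'I_l) : V := \sum_(w | perm_on P w) Q (b \o w).

Lemma symQ_perm b (t : {perm 'I_l}) : perm_on P t -> symQ (b \o t) = symQ b.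
Proof.
move=> Pt; rewrite /symQ [RHS](reindex_inj (mulIg t)) /=.
apply: eq_big => [w|w _]; last by apply: Q_ext => x _; rewrite /= permM.
apply/idP/idP => [Pw|Pwt]; first exact: perm_onM.
by rewrite -[w](mulgK t); apply: perm_onM => //; apply: perm_onV.
Qed.

Variables (D : {linear V -> V}) (e : K) (b0 b1 : 'I_l).
Hypothesis e_neq0 : e != 0.
Hypothesis DQ : forall b,
  D (Q b) = e *: \sum_(r in P | b r == b0) Q (upd b r b1).

Lemma D_symQ b : D (symQ b) = e *: \sum_(r in P | b r == b0) symQ (upd b r b1).
Proof.
rewrite linear_sum (eq_bigr _ (fun w _ => DQ _)) -scaler_sumr; congr (_ *: _).
rewrite /symQ [RHS]exchange_big /=; apply: eq_bigr => w Pw.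
rewrite [RHS](reindex_inj (@perm_inj _ w)) /=.
apply: eq_big => [r|r _]; first by rewrite (perm_closed _ Pw).
by apply: Q_ext => x _; rewrite /upd /= (inj_eq perm_inj).
Qed.

(** Applying [D] to a vanishing symmetrisation gives a sum over the positions with value [b0]. A
    transposition of two such positions identifies their terms, so a positive multiple of one term
    vanishes. *)
Lemma symQ_step b r0 : r0 \in P -> b r0 = b0 -> symQ b = 0 ->
  symQ (upd b r0 b1) = 0.
Proof.
move=> r0P br0 S0; have := D_symQ b; rewrite S0 linear0 => /esym/eqP.
rewrite scaler_eq0 (negPf e_neq0) /=.
rewrite (eq_bigr (fun=> symQ (upd b r0 b1))) => [|r /andP[rP /eqP br]].
  have c0 : (0 < #|[pred r | (r \in P) && (b r == b0)]|)%N.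
    by apply/card_gt0P; exists r0; rewrite inE r0P br0 eqxx.
  rewrite sumr_const -scaler_nat scaler_eq0 pnatr_eq0 => /orP[|/eqP //].
  by rewrite eqn0Ngt => /negP[]; exact: c0.
have Pt : perm_on P (tperm r0 r).
  by apply/subsetP => x; rewrite unfold_in; case: tpermP => [->|->|_ _]; rewrite ?eqxx.
rewrite -(symQ_perm (upd b r0 b1) Pt); apply: eq_bigr => w _; apply: Q_ext => x _.
rewrite /upd /=; case: tpermP => [->|->|/eqP xr0 /eqP xr].
- by rewrite br0 br eq_sym.
- by rewrite !eqxx.
by rewrite (negPf xr0) (negPf xr).
Qed.

End Polarisation.

Section PolarisationInd.
Variables (K : numFieldType) (V : lmodType K) (l : nat) (P : {set 'I_l}).
Variable Q : ('I_l -> 'I_l) -> V.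
Hypothesis Q_ext : forall b b', {in P, b =1 b'} -> Q b = Q b'.
Variables (D : nat -> {linear V -> V}) (e : K).
Hypothesis e_neq0 : e != 0.
Hypothesis DQ : forall b (b0 b1 : 'I_l), b1 = b0.+1 :> nat ->
  D b1 (Q b) = e *: \sum_(r in P | b r == b0) Q (upd b r b1).

(** Induction on the sum of the values on [P]: one value is lowered by [1] and restored by
    [symQ_step]. *)
Lemma symQ_eq0 : (forall b : 'I_l -> 'I_l, (forall r, r \in P -> b r = 0%N :> nat) -> symQ P Q b = 0) ->
  forall b, symQ P Q b = 0.
Proof.
move=> S0 b; have [m] := ubnP (\sum_(r in P) b r)%N; elim: m b => // m IHm b.
rewrite ltnS => bm.
have [/forall_inP b0|] := boolP [forall r in P, b r == 0%N :> nat].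
  by apply: S0 => r /b0 /eqP.
rewrite negb_forall => /existsP[r]; rewrite negb_imply => /andP[rP br].
have lt0 : ((b r).-1 < l)%N by have := ltn_ord (b r); lia.
pose b0 := Ordinal lt0; have e01 : b r = b0.+1 :> nat by rewrite /= prednK // lt0n.
have step := @symQ_step K V l P Q Q_ext (D (b r)) e b0 (b r) e_neq0 (fun c => DQ c e01) (upd b r b0) r rP.
have e1 : symQ P Q b = symQ P Q (upd (upd b r b0) r (b r)).
  apply: eq_bigr => w _; apply: Q_ext => x _; rewrite /upd /=.
  by case: eqP => [->|].
rewrite e1; apply: step; first by rewrite /upd eqxx.
apply: IHm; apply: leq_trans bm.
rewrite (bigD1 r) //= [X in (_ < X)%N](bigD1 r) //= /upd eqxx e01 /=.
rewrite addSn ltnS leq_add2l; apply: leq_sum => x /andP[_ /negPf ->].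
exact: leqnn.
Qed.

End PolarisationInd.

(** * Spanning by permutations without long increasing subsequences *)

Section AvSpan.
Variables (K : numFieldType) (n l k : nat).
Hypotheses (n_gt1 : (1 < n)%N) (l_gt0 : (0 < l)%N) (l_le : (l.*2 <= n)%N).
Variables (g : affineSl K n) (V : lieModule g) (v0 : V).
Hypothesis ff_v : forall i : 'I_n, (i != 0%N :> nat) -> act (ff g i) v0 = 0.
Hypothesis f0_v : iter k.+1 (act (ff g (node n_gt1 l_gt0 l_le l.-1))) v0 = 0.
Local Notation F := (Fab n_gt1 l_gt0 l_le g).
Local Notation fc := (fch n_gt1 l_gt0 l_le g).
Local Notation Mn := (Mon n_gt1 l_gt0 l_le v0).
Local Notation Fp := (Fperm n_gt1 l_gt0 l_le v0).

(** Leibniz rule on a commuting product; [uniq s] lets an index single out the factor that is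
    changed. *)
Lemma Mon_deriv (f : g) (e : K) (cond : 'I_l * 'I_l -> bool)
    (mv : 'I_l * 'I_l -> 'I_l * 'I_l) (z : 'I_l -> 'I_l * 'I_l) s :
    (forall ab, lie_br f (F ab.1 ab.2) =
       if cond ab then e *: F (mv ab).1 (mv ab).2 else 0) ->
    act f v0 = 0 -> uniq s ->
  act f (Mn [seq z x | x <- s]) =
  e *: \sum_(r <- s | cond (z r)) Mn [seq (if x == r then mv (z r) else z x) | x <- s].
Proof.
move=> fF fv; elim: s => [_|r s IHs /= /andP[rs us]].
  by rewrite big_nil scaler0.
rewrite act_comm fF IHs // big_cons eqxx.
have eS : act (F (z r).1 (z r).2) (e *: \sum_(x <- s | cond (z x))
      Mn [seq (if y == x then mv (z x) else z y) | y <- s]) =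
   e *: \sum_(x <- s | cond (z x)) act
    (F (if r == x then mv (z x) else z r).1 (if r == x then mv (z x) else z r).2)
    (Mn [seq (if y == x then mv (z x) else z y) | y <- s]).
  rewrite linearZ linear_sum; congr (_ *: _); rewrite big_seq_cond [RHS]big_seq_cond.
  apply: eq_bigr => x /andP[xs _]; have /negPf -> // : r != x.
  by apply: contraNneq rs => ->.
rewrite {}eS; case: ifP => _; last by rewrite act0l addr0.
rewrite actZl addrC scalerDr; congr (_ + _); congr (_ *: act _ (Mn _)).
apply/eq_in_map => x xs; case: eqP => // e1.
by rewrite -e1 xs in rs.
Qed.

Section Relation.
Variable (P : {set 'I_l}).
Hypothesis cP : #|P| = k.+1.

Definition MonP (a b : 'I_l -> 'I_l) : V := Mn [seq (a r, b r) | r <- enum P].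

Lemma MonP_ext a a' b b' : {in P, a =1 a'} -> {in P, b =1 b'} ->
  MonP a b = MonP a' b'.
Proof.
move=> aa bb; congr Mon; apply/eq_in_map => x; rewrite mem_enum => xP.
by rewrite aa // bb.
Qed.

Lemma MonP_reindex a b (w : {perm 'I_l}) : perm_on P w ->
  MonP (a \o w) (b \o w) = MonP a b.
Proof.
move=> Pw; apply: Mon_perm.
rewrite (map_comp (fun r => (a r, b r)) w); apply: perm_map.
apply: uniq_perm; rewrite ?(map_inj_uniq perm_inj) ?enum_uniq // => x.
rewrite mem_enum; apply/mapP/idP => [[y]|xP].
  by rewrite mem_enum => yP ->; rewrite perm_closed.
exists (w^-1 x)%g; last by rewrite permKV.
by rewrite mem_enum -(perm_closed _ Pw) permKV.
Qed.

Lemma MonP_col a b (b0 b1 : 'I_l) : b1 = b0.+1 :> nat ->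
  act (fc (l.-1 + b1)) (MonP a b) =
  1 *: \sum_(r in P | b r == b0) MonP a (upd b r b1).
Proof.
move=> e; rewrite /MonP (@Mon_deriv _ 1 (fun ab => ab.2 == b0) (fun ab => (ab.1, b1))).
- rewrite -big_enum_cond; congr (_ *: _); apply: eq_bigr => r _; congr Mon.
  by apply: eq_map => x; rewrite /upd /=; case: eqP => [->|].
- by move=> ab; rewrite (fch_col _ _ _ _ _ _ e); case: ifP; rewrite ?scale1r.
- by apply: fch_v => //; have := ltn_ord b1; lia.
exact: enum_uniq.
Qed.

Lemma MonP_row a b (a0 a1 : 'I_l) : a1 = a0.+1 :> nat ->
  act (fc (l.-1 - a1)) (MonP a b) =
  (-1) *: \sum_(r in P | a r == a0) MonP (upd a r a1) b.
Proof.
move=> e; rewrite /MonP (@Mon_deriv _ (-1) (fun ab => ab.1 == a0) (fun ab => (a1, ab.2))).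
- rewrite -big_enum_cond; congr (_ *: _); apply: eq_bigr => r _; congr Mon.
  by apply: eq_map => x; rewrite /upd /=; case: eqP => [->|].
- by move=> ab; rewrite (fch_row _ _ _ _ _ _ e); case: ifP; rewrite ?scaleN1r.
- by apply: fch_v => //; have := ltn_ord a1; lia.
exact: enum_uniq.
Qed.

Lemma MonP0 (a b : 'I_l -> 'I_l) : (forall r, r \in P -> a r = 0%N :> nat) ->
  (forall r, r \in P -> b r = 0%N :> nat) -> MonP a b = 0.
Proof.
move=> a0 b0; rewrite -[RHS]f0_v -cP cardE /MonP.
have : {subset enum P <= P} by move=> x; rewrite mem_enum.
elim: (enum P) => //= x s IHs sP; rewrite IHs => [|y ys]; last first.
  by apply: sP; rewrite inE ys orbT.
have xP : x \in P by apply: sP; rewrite mem_head.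
by rewrite Fab00 ?a0 ?b0.
Qed.

(** Columns are reduced to [0] first. Then [b] is constant on [P], so symmetrising over columns is
    the same as symmetrising over rows, and the rows are reduced in turn, down to the power [k + 1]
    of the affine generator. *)
Lemma symMonP_eq0 a b : symQ P (MonP a) b = 0.
Proof.
have extb a' b' b'' : {in P, b' =1 b''} -> MonP a' b' = MonP a' b''.
  exact: MonP_ext.
have exta b' a' a'' : {in P, a' =1 a''} -> MonP a' b' = MonP a'' b'.
  by move=> e; apply: MonP_ext.
move: b; apply: (symQ_eq0 (extb a) (D := fun b1 => act (fc (l.-1 + b1)) : {linear V -> V})
  (oner_neq0 K)) => [b b0 b1|b b0]; first exact: MonP_col.
have <- : symQ P (MonP^~ b) a = symQ P (MonP a) b.
  apply: eq_bigr => w Pw; have bw : {in P, b =1 b \o w}.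
    by move=> x xP; apply/val_inj; rewrite /= !b0 ?perm_closed.
  by rewrite (extb _ _ _ bw) MonP_reindex // (extb _ _ _ bw).
have N1 : (-1 : K) != 0 by rewrite oppr_eq0 oner_neq0.
move: a; apply: (symQ_eq0 (exta b) (D := fun a1 => act (fc (l.-1 - a1)) : {linear V -> V}) N1).
  by move=> a a0 a1; apply: MonP_row.
by move=> a a0; apply: big1 => w Pw; apply: MonP0 => // r rP; rewrite /= a0 ?perm_closed.
Qed.

Lemma Fperm_relation (s : {perm 'I_l}) :
  \sum_(w | perm_on P w) Fp (w * s)%g = 0.
Proof.
(* The factors in rows outside [P] are common to all terms and are pulled out. *)
have Fsplit w : perm_on P w -> Fp (w * s)%g =
    foldr (fun ab x => act (F ab.1 ab.2) x) (MonP id (s \o w))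
      [seq (a, s a) | a <- enum (~: P)].
  move=> Pw; rewrite /Fperm.
  have pe : perm_eq (enum 'I_l) (enum (~: P) ++ enum P).
    apply: uniq_perm; rewrite ?cat_uniq ?enum_uniq //= ?andbT.
      by apply/hasPn => x; rewrite !mem_enum inE negbK.
    by move=> x; rewrite mem_cat !mem_enum !inE orNb.
  rewrite (Mon_perm _ _ _ _ (perm_map (fun a => (a, (w * s)%g a)) pe)) map_cat.
  rewrite /Mon foldr_cat; congr (foldr _ _ _).
    by congr Mon; apply: eq_map => x; rewrite permM.
  apply/eq_in_map => x; rewrite mem_enum inE => xP.
  by rewrite permM (out_perm Pw).
rewrite (eq_bigr _ Fsplit).
have lin (r : seq ('I_l * 'I_l)) (x : {perm 'I_l} -> V) :
   \sum_(w | perm_on P w) foldr (fun ab y => act (F ab.1 ab.2) y) (x w) r =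
   foldr (fun ab y => act (F ab.1 ab.2) y) (\sum_(w | perm_on P w) x w) r.
  elim: r => //= ab r IHr; rewrite -IHr linear_sum; exact: eq_bigr.
rewrite lin (_ : \sum_(w | _) _ = symQ P (MonP id) s) // symMonP_eq0.
by elim: [seq _ | _ <- _] => //= ab r ->; rewrite linear0.
Qed.

End Relation.

Lemma card_subset_exists (T : finType) (A : {set T}) m : (m <= #|A|)%N ->
  exists2 B : {set T}, B \subset A & #|B| = m.
Proof.
elim: m => [_|m IHm mA]; first by exists set0; rewrite ?sub0set ?cards0.
have [B BA cB] := IHm (ltnW mA).
have /set0Pn [x] : A :\: B != set0.
  by rewrite -card_gt0 cardsD (setIidPr BA) cB subn_gt0.
rewrite inE => /andP[xB xA]; exists (x |: B); last by rewrite cardsU1 xB cB.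
by rewrite subUset sub1set xA.
Qed.

(** Induction on the number of lexicographically larger permutations. At the first row [a] moved by
    [w], the value [s a] becomes [s (w a)], which is larger because [a < w a] lie in an increasing
    subsequence. *)
Lemma spans_Av (s : {perm 'I_l}) :
  spans (fun i : 'I_#|Av l k| => Fp (enum_val i)) (Fp s).
Proof.
set b := fun i => _; have sS := spans_subspace b.
have [m] := ubnP #|[set t | (permlex s < permlex t)%O]|.
elim: m s => // m IHm s; rewrite ltnS => sm.
have [sA|] := boolP (s \in Av l k).
  by have := spans_gen b (enum_rank_in sA s); rewrite /b enum_rankK_in.
rewrite inE -ltnNge => lt_k.
have [Q [cQ bQ iQ]] := lis_chain s l l; rewrite -cQ in lt_k.
have [P PQ cP] := card_subset_exists lt_k.
have := Fperm_relation cP s.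
rewrite (bigD1 1%g) /= ?perm_on1 // mul1g => /eqP; rewrite addr_eq0 => /eqP ->.
apply: (subspaceN sS); apply: (subspace_sum _ sS) => w /andP[Pw w1].
have [a wa fixw] := permlex_first w1.
have aP : a \in P by apply: contraTT wa => aP; rewrite (out_perm Pw aP) ltnn.
have lt_sw : (permlex s < permlex (w * s)%g)%O.
  apply: (@permlex_lt _ _ _ a) => [c ca|]; first by rewrite permM fixw.
  by rewrite permM; apply: iQ => //; apply: (subsetP PQ); rewrite ?perm_closed.
apply: IHm; apply: leq_trans sm; apply: proper_card; apply/properP; split.
  by apply/subsetP => t; rewrite !inE; apply: lt_trans.
by exists (w * s)%g; rewrite !inE ?ltxx.
Qed.

End AvSpan.

(** * A fermionic model *)

Section SlotOperators.
Variables (K : numClosedFieldType) (k : nat) (S : finType).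
Local Notation Y := {ffun 'I_k -> S}.
Implicit Types (y : Y) (w : {ffun Y -> K^o}).

Definition set_slot y (r : 'I_k) (s : S) : Y := [ffun x => if x == r then s else y x].

(* Sum over the [k] tensor slots of the operator whose matrix entry from
   [t s] to [s] is [c s]. *)
Definition slot_op (c : S -> K) (t : S -> S) w : {ffun Y -> K^o} :=
  [ffun y : Y => \sum_r c (y r) * w (set_slot y r (t (y r)))].

Lemma slot_op_linear c t : linear (slot_op c t).
Proof.
move=> a w w'; apply/ffunP => y; rewrite !ffunE scaler_sumr -big_split.
by apply: eq_bigr => r _; rewrite !ffunE mulrDr mulrCA.
Qed.

HB.instance Definition _ c t :=
  GRing.isLinear.Build K {ffun Y -> K^o} {ffun Y -> K^o} _ (slot_op c t)
    (slot_op_linear c t).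

Lemma eq_slot_op c c' t w : c =1 c' -> slot_op c t w = slot_op c' t w.
Proof. by move=> e; apply/ffunP => y; rewrite !ffunE; apply: eq_bigr => r _; rewrite e. Qed.

(** Contributions of two different slots commute, so the identity has to be checked within one slot;
    [phi] is the vector seen as a function of that slot. *)
Lemma slot_op_comm c1 t1 c2 t2 c3 t3 w :
  (forall s (phi : S -> K), c1 s * c2 (t1 s) * phi (t2 (t1 s)) =
     c2 s * c1 (t2 s) * phi (t1 (t2 s)) + c3 s * phi (t3 s)) ->
  slot_op c1 t1 (slot_op c2 t2 w) =
  slot_op c2 t2 (slot_op c1 t1 w) + slot_op c3 t3 w.
Proof.
move=> E; apply/ffunP => y.
pose off d1 u1 d2 u2 := \sum_r \sum_(r' | r' != r) d1 (y r) * d2 (y r') *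
   w (set_slot (set_slot y r (u1 (y r))) r' (u2 (y r'))).
have split d1 u1 d2 u2 : slot_op d1 u1 (slot_op d2 u2 w) y =
    \sum_r d1 (y r) * d2 (u1 (y r)) * w (set_slot y r (u2 (u1 (y r)))) +
    off d1 u1 d2 u2.
  rewrite ffunE -big_split; apply: eq_bigr => r _ /=.
  rewrite ffunE (bigD1 r) //= mulrDr mulr_sumr !ffunE eqxx mulrA; congr (_ + _).
    congr (_ * w _); apply/ffunP => x; rewrite !ffunE; by case: eqP.
  by apply: eq_bigr => r' /negPf ne; rewrite !ffunE ne mulrA.
rewrite [RHS]ffunE !split.
have -> : off c1 t1 c2 t2 = off c2 t2 c1 t1.
  rewrite /off (exchange_big_dep predT) //=; apply: eq_bigr => r _.
  under eq_bigl do rewrite eq_sym.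
  apply: eq_bigr => r' ne; rewrite [c1 _ * _]mulrC; congr (_ * w _).
  apply/ffunP => x; rewrite !ffunE; case: eqP => [->|//].
  by rewrite eq_sym (negPf ne).
rewrite addrAC; congr (_ + _); rewrite [slot_op _ _ _ _]ffunE -big_split /=.
by apply: eq_bigr => r _; rewrite (E _ (fun s => w (set_slot y r s))).
Qed.

Definition hform (w w' : {ffun Y -> K^o}) : K := \sum_(y : Y) w y * (w' y)^*.

Lemma hform_sum (I : Type) (s : seq I) (F : I -> {ffun Y -> K^o}) (c : I -> K) w :
  hform (\sum_(i <- s) c i *: F i) w = \sum_(i <- s) c i * hform (F i) w.
Proof.
rewrite /hform; under [RHS]eq_bigr do rewrite mulr_sumr.
rewrite exchange_big; apply: eq_bigr => y _; rewrite sum_ffunE mulr_suml.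
by apply: eq_bigr => i _; rewrite ffunE mulrA.
Qed.

Lemma hform_eq0 w : hform w w = 0 -> w = 0.
Proof.
move/eqP; rewrite psumr_eq0 => [/allP e|y _]; last exact: mul_conjC_ge0.
apply/ffunP => y; rewrite ffunE; apply/eqP; rewrite -mul_conjC_eq0.
by apply: e; rewrite mem_index_enum.
Qed.

Lemma hform_adjoint c c' t w w' : involutive t ->
  (forall s, (c (t s) )^* = c' s) -> hform (slot_op c t w) w' = hform w (slot_op c' t w').
Proof.
move=> tK cc; rewrite /hform.
under eq_bigr do rewrite ffunE mulr_suml.
under [RHS]eq_bigr do rewrite ffunE rmorph_sum mulr_sumr.
rewrite exchange_big [RHS]exchange_big; apply: eq_bigr => r _ /=.
pose h y := set_slot y r (t (y r)).
have hK : involutive h.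
  by move=> y; apply/ffunP => x; rewrite !ffunE eqxx tK; case: eqP => [->|].
rewrite (reindex_inj (inv_inj hK)); apply: eq_bigr => y _ /=.
rewrite -[set_slot (h y) r _]/(h (h y)) hK rmorphM /= -cc conjCK.
by rewrite [h y r]ffunE eqxx mulrCA mulrA.
Qed.

End SlotOperators.

(** * Occupation states and hopping operators within one slot *)

Section Fermions.
Variables (K : numClosedFieldType) (N : nat).
Local Notation S := {ffun 'I_N -> bool}.
Implicit Type s : S.

(** Sites are natural numbers, so that [i.+1] needs no bound; sites out of range are empty. *)
Definition occ s (p : nat) : bool := if insub p is Some i then s i else false.

Definition swp (p q : nat) s : S :=
  [ffun x : 'I_N => occ s (if x == p :> nat then q else if x == q :> nat then p else x)].

Lemma occE s (i : 'I_N) : occ s i = s i. Proof. by rewrite /occ valK. Qed.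

Lemma occ_swp p q s x : (p < N)%N -> (q < N)%N ->
  occ (swp p q s) x = occ s (if x == p then q else if x == q then p else x).
Proof.
move=> pN qN; have [xN|Nx] := ltnP x N; first by rewrite -[x]/(val (Ordinal xN)) occE ffunE.
have -> : (x == p) = false by lia.
have -> : (x == q) = false by lia.
by rewrite /occ insubF // ltnNge Nx.
Qed.

Lemma occ_inj s s' : (forall x, (x < N)%N -> occ s x = occ s' x) -> s = s'.
Proof. by move=> e; apply/ffunP => i; rewrite -!occE e. Qed.

Lemma swpK p q : (p < N)%N -> (q < N)%N -> involutive (swp p q).
Proof.
move=> pN qN s; apply: occ_inj => x _; rewrite !occ_swp //; congr occ.
case: (eqVneq x p) => [->|xp]; first by rewrite eqxx; case: eqP.
by case: (eqVneq x q) => [->|xq]; rewrite ?eqxx // (negPf xp) (negPf xq).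
Qed.

(* Jordan-Wigner sign of a fermion hopping between [p] and [q]. *)
Definition sgn_between p q s : K := (-1) ^+ \sum_(p.+1 <= x < q) occ s x.

(** Entries are indexed by the target state: a particle that hopped from [p] to [q] is seen at [q],
    with a hole at [p]. *)
Definition cX p q s : K :=
  if occ s q && ~~ occ s p then sgn_between p q s else 0.

Definition cE i s : K := if occ s i && ~~ occ s i.+1 then 1 else 0.

Definition cH i s : K := (occ s i)%:R - (occ s i.+1)%:R.

Lemma cXS i s : cX i i.+1 s = if occ s i.+1 && ~~ occ s i then 1 else 0.
Proof. by rewrite /cX /sgn_between big_geq. Qed.

Lemma cE_cX i s : (i.+1 < N)%N -> (cX i i.+1 (swp i i.+1 s))^* = cE i s.
Proof.
move=> iN; rewrite cXS !occ_swp ?eqxx ?(ltnW iN) //.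
have -> : (i.+1 == i) = false by lia.
by rewrite /cE; case: ifP => _; rewrite ?rmorph1 ?rmorph0.
Qed.

Lemma comm_EF i j s (phi : S -> K) : (i.+1 < N)%N -> (j.+1 < N)%N ->
  cE i s * cX j j.+1 (swp i i.+1 s) * phi (swp j j.+1 (swp i i.+1 s)) =
  cX j j.+1 s * cE i (swp j j.+1 s) * phi (swp i i.+1 (swp j j.+1 s)) +
  ((i == j)%:R * cH i s) * phi s.
Proof.
move=> iN jN; have [<-|ij] := eqVneq i j.
  rewrite !swpK ?(ltnW iN) // cXS cXS /cE /cH !occ_swp ?(ltnW iN) //.
  rewrite !eqxx; have -> : (i.+1 == i) = false by lia.
  by case: (occ s i); case: (occ s i.+1); rewrite /=; ring.
rewrite mul0r mul0r addr0.
have [e|ne] := eqVneq j i.+1.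
  rewrite e in jN *; rewrite !cXS /cE !occ_swp //; try lia.
  rewrite !eqxx; have -> : (i.+2 == i) = false by lia.
  have -> : (i.+2 == i.+1) = false by lia.
  have -> : (i.+1 == i) = false by lia.
  have -> : (i == i.+1) = false by lia.
  have -> : (i == i.+2) = false by lia.
  by case: (occ s i); case: (occ s i.+1); case: (occ s i.+2); rewrite /= ?(mul0r, mulr0).
have [e|ne'] := eqVneq i j.+1.
  rewrite e in iN *; rewrite !cXS /cE !occ_swp //; try lia.
  rewrite !eqxx; have -> : (j.+2 == j) = false by lia.
  have -> : (j.+2 == j.+1) = false by lia.
  have -> : (j.+1 == j) = false by lia.
  have -> : (j == j.+1) = false by lia.
  have -> : (j == j.+2) = false by lia.
  by case: (occ s j); case: (occ s j.+1); case: (occ s j.+2); rewrite /= ?(mul0r, mulr0).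
have -> : swp j j.+1 (swp i i.+1 s) = swp i i.+1 (swp j j.+1 s).
  apply: occ_inj => x _; rewrite !occ_swp //; try lia; congr occ.
  by case: (eqVneq x i); case: (eqVneq x i.+1); case: (eqVneq x j);
     case: (eqVneq x j.+1) => *; repeat case: eqP => ?; lia.
congr (_ * _); rewrite mulrC !cXS /cE !occ_swp //; try lia.
have -> : (j.+1 == i) = false by lia.
have -> : (j.+1 == i.+1) = false by lia.
have -> : (j == i) = false by lia.
have -> : (j == i.+1) = false by lia.
have -> : (i == j) = false by lia.
have -> : (i == j.+1) = false by lia.
have -> : (i.+1 == j) = false by lia.
by have -> : (i.+1 == j.+1) = false by lia.
Qed.

Lemma comm_HF i j s (phi : S -> K) : (i.+1 < N)%N -> (j.+1 < N)%N ->
  cH i s * cX j j.+1 s * phi (swp j j.+1 s) =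
  cX j j.+1 s * cH i (swp j j.+1 s) * phi (swp j j.+1 s) +
  ((- (((i == j) * 2)%N%:Z - (i.+1 == j)%N%:Z - (j.+1 == i)%N%:Z))%:~R * cX j j.+1 s)
    * phi (swp j j.+1 s).
Proof.
move=> iN jN; rewrite -mulrDl; congr (_ * _).
rewrite [X in _ = X + _]mulrC -mulrDl !cXS.
case: ifP => [/andP[s1 s0]|_]; last by rewrite !mulr0.
congr (_ * _); rewrite /cH !occ_swp //; try lia.
move/negbTE: s0 => s0.
have [e|ij] := eqVneq i j.
  rewrite e !eqxx s1 (_ : (j.+1 == j) = false); last by lia.
  by rewrite !s0 mul1n /=; ring.
rewrite mul0n; have [e|ne] := eqVneq i.+1 j.
  have ij1 : (i == j.+1) = false by clear -e; lia.
  have ji : (j.+1 == i) = false by clear -e; lia.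
  by rewrite ij1 ji -e in s0 s1 *; rewrite s0 s1 /=; ring.
have [e|ne'] := eqVneq j.+1 i.
  have j21 : (j.+2 == j.+1) = false by clear; lia.
  by rewrite -e j21 s0 s1 /=; ring.
rewrite ?[i == j.+1]eq_sym ?(negPf ne') eqSS (negPf ij).
by rewrite /= !subr0 oppr0 addr0.
Qed.

(** For a target with [p] empty and [q.+1] occupied: if [q] is occupied, the two terms on the right
    cancel by the additional sign at [q]; if [q] is empty, the left side equals the last term. *)
Lemma comm_FX p q s (phi : S -> K) : (p < q)%N -> (q.+1 < N)%N ->
  cX q q.+1 s * cX p q (swp q q.+1 s) * phi (swp p q (swp q q.+1 s)) =
  cX p q s * cX q q.+1 (swp p q s) * phi (swp q q.+1 (swp p q s)) +
  cX p q.+1 s * phi (swp p q.+1 s).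
Proof.
move=> pq qN; have qN' : (q < N)%N by lia.
have pN : (p < N)%N by lia.
have npq : (p == q) = false by lia.
have npq1 : (p == q.+1) = false by lia.
have nq1q : (q.+1 == q) = false by lia.
have nqq1 : (q == q.+1) = false by lia.
have nq1p : (q.+1 == p) = false by lia.
have nqp : (q == p) = false by lia.
rewrite !cXS /cX !occ_swp // !eqxx npq npq1 nq1q nq1p nqp.
have sgS : sgn_between p q.+1 s = sgn_between p q s * (if occ s q then -1 else 1).
  rewrite /sgn_between big_nat_recr //= exprD; congr (_ * _).
  by case: (occ s q); rewrite ?expr1 ?expr0.
have sgw : sgn_between p q (swp q q.+1 s) = sgn_between p q s.
  rewrite /sgn_between; congr (_ ^+ _); apply: eq_big_nat => x xq.
  have xq0 : (x == q) = false by lia.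
  have xq1 : (x == q.+1) = false by lia.
  by rewrite occ_swp // xq0 xq1.
rewrite sgS sgw.
have swpE b : occ s p = false -> occ s q = b -> occ s q.+1 = true ->
    (if b then swp q q.+1 (swp p q s) else swp p q (swp q q.+1 s)) = swp p q.+1 s.
  move=> op oq oq1; case: b oq => oq; apply: occ_inj => x _; rewrite !occ_swp //.
    have [e|xp] := eqVneq x p; first by rewrite ?e ?(npq, npq1, nqp, nq1q, nqq1, nq1p, eqxx) ?(oq, op, oq1).
    have [e|xq1] := eqVneq x q.+1; first by rewrite ?e ?(npq, npq1, nqp, nq1q, nqq1, nq1p, eqxx) ?(oq, op, oq1).
    have [e|xq] := eqVneq x q; first by rewrite ?e ?(npq, npq1, nqp, nq1q, nqq1, nq1p, eqxx) ?(oq, op, oq1).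
    by rewrite (negPf xp) (negPf xq).
  have [e|xp] := eqVneq x p; first by rewrite ?e ?(npq, npq1, nqp, nq1q, nqq1, nq1p, eqxx) ?(oq, op, oq1).
  have [e|xq] := eqVneq x q; first by rewrite ?e ?(npq, npq1, nqp, nq1q, nqq1, nq1p, eqxx) ?(oq, op, oq1).
  have [e|xq1] := eqVneq x q.+1; first by rewrite ?e ?(npq, npq1, nqp, nq1q, nqq1, nq1p, eqxx) ?(oq, op, oq1).
  by rewrite ?(negPf xp) ?(negPf xq) ?(negPf xq1).
case op: (occ s p); rewrite /= ?andbF ?(mul0r, mulr0, addr0) //.
case oq: (occ s q); case oq1: (occ s q.+1);
  rewrite /= ?(mul0r, mulr0, mul1r, mulr1, addr0, add0r) //.
  by rewrite (swpE true) // mulrN1 mulNr addrN.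
by rewrite (swpE false).
Qed.
End Fermions.

(** * Comparison of the module with the model *)

Section Model.
Variables (K : numClosedFieldType) (n l k : nat).
Hypotheses (n_gt1 : (1 < n)%N) (l_gt0 : (0 < l)%N) (l_le : (l.*2 <= n)%N).
Variables (g : affineSl K n) (V : lieModule g) (v0 : V).
Hypothesis v_la : weight_space (Lambda K n 0 *+ k) v0.
Hypothesis ee_v : forall i, act (ee g i) v0 = 0.
Local Notation nd := (node n_gt1 l_gt0 l_le).
Local Notation fc := (fch n_gt1 l_gt0 l_le g).
Local Notation Fp := (Fperm n_gt1 l_gt0 l_le v0).
Local Notation S := {ffun 'I_(l.*2) -> bool}.
Local Notation Y := {ffun 'I_k -> S}.
Local Notation W := {ffun Y -> K^o}.
Local Notation letter := 'I_(l.*2.-1).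
Implicit Types (w : W) (v : V) (u : seq letter).

Definition XW p q : W -> W := slot_op (cX K p q) (swp p q).
Definition eW i : W -> W := slot_op (cE K i) (swp i i.+1).
Definition hW i : W -> W := slot_op (cH K i) id.

(** In every slot this is the highest weight vector of the [l]-th exterior power, so the total
    weight is [k] at chain position [l - 1], as for [k Lambda_0]. *)
Definition top_state : Y := [ffun _ => [ffun p : 'I_(l.*2) => (p < l)%N]].
Definition top_vec : W := [ffun y : Y => (y == top_state)%:R].

Definition fwW u : W := foldr (fun (i : letter) w => XW i i.+1 w) top_vec u.
Definition nds u : seq 'I_n := map (fun i : letter => nd i) u.
Definition fwV u : V := fword v0 (nds u).

(* The graph of a correspondence between the model and [V]: the same
   combination of [f]-words applied to both highest weight vectors. *)
Definition Rel w v := exists s : seq (K * seq letter),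
  w = \sum_(x <- s) x.1 *: fwW x.2 /\ v = \sum_(x <- s) x.1 *: fwV x.2.

Lemma Rel_gen u : Rel (fwW u) (fwV u).
Proof. by exists [:: (1, u)]; rewrite !big_seq1 !scale1r. Qed.

Lemma Rel0 : Rel 0 0. Proof. by exists [::]; rewrite !big_nil. Qed.

Lemma RelP a w v w' v' : Rel w v -> Rel w' v' -> Rel (a *: w + w') (a *: v + v').
Proof.
move=> [s [-> ->]] [s' [-> ->]].
exists ([seq (a * x.1, x.2) | x <- s] ++ s').
by split; rewrite big_cat big_map scaler_sumr; congr (_ + _); apply: eq_bigr => x _;
  rewrite scalerA.
Qed.

Lemma RelD w v w' v' : Rel w v -> Rel w' v' -> Rel (w + w') (v + v').
Proof. by move=> r r'; have := RelP 1 r r'; rewrite !scale1r. Qed.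

Lemma RelZ a w v : Rel w v -> Rel (a *: w) (a *: v).
Proof. by move=> r; have := RelP a r Rel0; rewrite !addr0. Qed.

Lemma RelB w v w' v' : Rel w v -> Rel w' v' -> Rel (w - w') (v - v').
Proof. by move=> r /(RelZ (-1)) r'; rewrite -!scaleN1r; apply: RelD. Qed.

Lemma Rel_sum (I : Type) (s : seq I) (P : pred I) F G :
  (forall i, P i -> Rel (F i) (G i)) ->
  Rel (\sum_(i <- s | P i) F i) (\sum_(i <- s | P i) G i).
Proof.
move=> r; elim/big_ind2: _ => //; first exact: Rel0.
by move=> ? ? ? ?; apply: RelD.
Qed.

Lemma Rel_map (f : {linear W -> W}) (f' : {linear V -> V}) w v :
  (forall u, Rel (f (fwW u)) (f' (fwV u))) -> Rel w v -> Rel (f w) (f' v).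
Proof.
move=> r [s [-> ->]]; rewrite !linear_sum; apply: Rel_sum => x _.
by rewrite !linearZ; apply: RelZ.
Qed.

Lemma Rel_F i w v : (i <= l.*2.-2)%N -> Rel w v ->
  Rel (XW i i.+1 w) (act (fc i) v).
Proof.
move=> iN; have iN' : (i < l.*2.-1)%N by lia.
by apply: Rel_map => u; apply: (Rel_gen (Ordinal iN' :: u)).
Qed.

(** Both sides obey the recursion [E_(q+1, p) = [f_q, E_(q, p)]]. *)
Lemma Rel_X p d w v : (p + d <= l.*2.-2)%N -> Rel w v ->
  Rel (XW p (p + d.+1) w) (act (rootv fc p d) v).
Proof.
elim: d w v => [|d IHd] w v dN r.
  by rewrite addn1; apply: Rel_F => //; lia.
rewrite [rootv _ _ _]/= act_br.
have -> : XW p (p + d.+2) w = XW (p + d.+1) (p + d.+1).+1 (XW p (p + d.+1) w)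
    - XW p (p + d.+1) (XW (p + d.+1) (p + d.+1).+1 w).
  apply/eqP; rewrite eq_sym subr_eq addrC; apply/eqP.
  rewrite !addnS; by apply: slot_op_comm => s phi; apply: comm_FX; lia.
apply: RelB; first by apply: Rel_F => //; apply: IHd => //; lia.
by apply: IHd; [lia|apply: Rel_F].
Qed.

Definition hval i u : K := (k * (i == l.-1))%N%:R -
  \sum_(j <- u) (((i == j) * 2)%N%:Z - (i.+1 == j)%N%:Z - (j.+1 == i)%N%:Z)%:~R.

Lemma hval_cons i j u : hval i (j :: u) =
  hval i u - (((i == j) * 2)%N%:Z - (i.+1 == j)%N%:Z - (j.+1 == i)%N%:Z)%:~R.
Proof. by rewrite /hval big_cons opprD addrCA addrC. Qed.

Lemma occ_top r x : occ (top_state r) x = (x < l)%N.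
Proof.
rewrite /occ; case: insubP => [i _ <-|]; first by rewrite !ffunE.
by rewrite -leqNgt => xl; symmetry; apply/negbTE; rewrite -leqNgt; lia.
Qed.

Lemma hW_top i : hW i top_vec = (k * (i == l.-1))%N%:R *: top_vec.
Proof.
apply/ffunP => y; rewrite !ffunE.
have e r : set_slot y r (y r) = y.
  by apply/ffunP => x; rewrite !ffunE; case: eqP => [->|].
under eq_bigr do rewrite e; rewrite -mulr_suml ffunE.
case: eqP => [->|_]; last by rewrite mulr0 [RHS]mulr0.
congr (_ * _); rewrite (eq_bigr (fun=> (i == l.-1)%:R)).
  by rewrite sumr_const card_ord -mulrnA mulnC.
move=> r _; rewrite /cH !occ_top.
case: (ltngtP i l.-1) => il.
- have -> : (i < l)%N by lia. have -> : (i.+1 < l)%N by lia. by rewrite subrr.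
- have -> : (i < l)%N = false by lia. have -> : (i.+1 < l)%N = false by lia. by rewrite subrr.
by rewrite il prednK // leqnn ltnn subr0.
Qed.

Lemma hW_fwW i u : (i <= l.*2.-2)%N -> hW i (fwW u) = hval i u *: fwW u.
Proof.
move=> iN; elim: u => [|j u IHu].
  by rewrite /hval big_nil subr0; exact: hW_top.
have jN := ltn_ord j.
have -> : hW i (fwW (j :: u)) = XW j j.+1 (hW i (fwW u)) +
   slot_op (fun s => (- (((i == j) * 2)%N%:Z - (i.+1 == j)%N%:Z - (j.+1 == i)%N%:Z))%:~R
      * cX K j j.+1 s) (swp j j.+1) (fwW u).
  by apply: slot_op_comm => s phi; apply: comm_HF; lia.
rewrite IHu /XW linearZ /= hval_cons [RHS]scalerBl; congr (_ + _).
rewrite -scaleNr -mulrNz; apply/ffunP => y; rewrite !ffunE scaler_sumr.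
by apply: eq_bigr => r _; rewrite -mulrA.
Qed.

Lemma hh_fwV i u : (i <= l.*2.-2)%N ->
  act (hh g (Some (nd i))) (fwV u) = hval i u *: fwV u.
Proof.
move=> iN; elim: u => [|j u IHu].
  rewrite v_la /hval big_nil subr0 ffunMnE ffunE nodeE //; congr (_ *: _).
  rewrite -[LHS]mulr_natl natrM; congr (_ * (nat_of_bool _)%:R).
  case: ltnP => il; last by apply/eqP/eqP; lia.
  by rewrite (_ : (i == l.-1) = false); [apply/eqP|]; lia.
have jN := ltn_ord j.
rewrite /= act_comm IHu linearZ /= br_hf actNl actZl -scalerBl hval_cons.
by rewrite alphaS cartan_node //; lia.
Qed.

Lemma eW_top i : (i <= l.*2.-2)%N -> eW i top_vec = 0.
Proof.
move=> iN; apply/ffunP => y; rewrite !ffunE big1 // => r _; rewrite ffunE.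
case: eqP => [e|_]; last by rewrite mulr0.
have {}e : swp i i.+1 (y r) = top_state r by rewrite -e ffunE eqxx.
have {}e : y r = swp i i.+1 (top_state r) by rewrite -e swpK //; lia.
rewrite /cE e !occ_swp ?occ_top; [|lia..].
rewrite !eqxx (_ : (i.+1 == i) = false); last by lia.
by case: ifP => [|_]; [lia|rewrite mul0r].
Qed.

(** Moving [e_i] through a word leaves [h_i] applied to shorter words, and its eigenvalue [hval] is
    the same on both sides. *)
Lemma Rel_E i w v : (i <= l.*2.-2)%N -> Rel w v ->
  Rel (eW i w) (act (ee g (nd i)) v).
Proof.
move=> iN; apply: Rel_map => u; elim: u => [|j u IHu].
  by rewrite /= ee_v [slot_op _ _ _]eW_top //; apply: Rel0.
have jN := ltn_ord j.
change (Rel (eW i (fwW (j :: u))) (act (ee g (nd i)) (fwV (j :: u)))).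
have -> : eW i (fwW (j :: u)) =
   XW j j.+1 (eW i (fwW u)) + slot_op (fun s => (i == j)%:R * cH K i s) id (fwW u).
  by apply: slot_op_comm => s phi; apply: comm_EF; lia.
rewrite /= act_comm br_ef; apply: RelD; first by apply: Rel_F => //; lia.
have -> : (nd i == nd j) = (i == j).
  by apply/eqP/eqP => [/node_inj ->|->] //; lia.
case: eqP => [e|_]; last first.
  rewrite act0l (_ : slot_op _ _ _ = 0); first exact: Rel0.
  by apply/ffunP => y; rewrite !ffunE big1 // => r _; rewrite !mul0r.
rewrite hh_fwV // (@eq_slot_op _ _ _ _ (cH K i)) => [|s]; last by rewrite mul1r.
by rewrite [slot_op _ _ _]hW_fwW //; apply: RelZ; apply: Rel_gen.
Qed.

Lemma fwW_top u : fwW u top_state = (u == [::])%:R.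
Proof.
case: u => [|i u] /=; first by rewrite ffunE eqxx.
rewrite ffunE big1 // => r _; rewrite cXS !occ_top.
by case: ifP; [lia|rewrite mul0r].
Qed.

Hypothesis v0_neq0 : v0 != 0.

(** In [V] only the empty words have the weight of [v0], so their coefficients sum to [0]; that sum
    is also the top coefficient in the model. *)
Lemma Rel_top w : Rel w 0 -> w top_state = 0.
Proof.
move=> [s [-> e]]; rewrite sum_ffunE.
have w0V : weight_space (Lambda K n 0 *+ k) (\sum_(x <- s) x.1 *: fwV x.2).
  by rewrite -e; apply: (subspace0 (weight_space_subspace _ _)).
have nuV u : weight_space (Lambda K n 0 *+ k - wdeg K (nds u)) (fwV u).
  exact: fword_weight.
move: e; rewrite (weight_proj nuV w0V) => /esym.
rewrite (eq_bigl (fun x => x.2 == [::])) => [|x]; last first.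
  rewrite -[X in _ == X]subr0 (inj_eq (addrI _)) eqr_opp; apply/eqP/eqP => [e0|->]; last first.
    by rewrite /wdeg big1 // => i _; rewrite mulr0n.
  have := @alpha_indep K n n_gt1 (fun i => count_mem i (nds x.2)) (fun=> 0%N).
  rewrite -/(wdeg _ _) e0 [RHS]big1 // => /(_ erefl).
  by case: (x.2) => // i r /(_ (nd i)); rewrite /= eqxx.
rewrite (eq_bigr (fun x => x.1 *: v0)) => [|x /eqP ->] //.
rewrite -scaler_suml => /eqP; rewrite scaler_eq0 (negPf v0_neq0) orbF => /eqP e.
rewrite -[RHS]e [RHS]big_mkcond; apply: eq_bigr => x _.
rewrite ffunE fwW_top; case: eqP => _; first by rewrite -[LHS]/(x.1 * 1) mulr1.
by rewrite -[LHS]/(x.1 * 0) mulr0.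
Qed.

(** Paired with a word, [w] receives the letters as operators [e_i], which keep it related to [0];
    what remains is a top coefficient, so [w] is orthogonal to every word. Being a combination of
    words, [w] is orthogonal to itself. *)
Lemma Rel_inj w : Rel w 0 -> w = 0.
Proof.
move=> rw; apply: hform_eq0; have [s [we _]] := rw.
rewrite {1}we hform_sum big1 // => x _; move: (x.2) => u.
suff -> : hform (fwW u) w = 0 by rewrite mulr0.
elim: u w rw {we x s} => [|i u IHu] w rw /=.
  rewrite /hform (bigD1 top_state) //= (Rel_top rw) rmorph0 mulr0 add0r big1 // => y ny.
  by rewrite ffunE (negPf ny) mul0r.
have iN := ltn_ord i.
rewrite (@hform_adjoint _ _ _ _ (cE K i)); last 2 first.
- by apply: swpK; lia.
- by move=> s; apply: cE_cX; lia.
apply: IHu; have iN' : (i <= l.*2.-2)%N by lia.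
by have := Rel_E iN' rw; rewrite linear0.
Qed.

End Model.

(** * Triangular matrix coefficients *)

Section Independence.
Variables (K : numClosedFieldType) (n l k : nat).
Hypotheses (n_gt1 : (1 < n)%N) (l_gt0 : (0 < l)%N) (l_le : (l.*2 <= n)%N).
Variables (g : affineSl K n) (V : lieModule g) (v0 : V).
Local Notation Fp := (Fperm n_gt1 l_gt0 l_le v0).
Local Notation Mn := (Mon n_gt1 l_gt0 l_le v0).
Local Notation Rl := (@Rel K n l k n_gt1 l_gt0 l_le g V v0).
Local Notation S := {ffun 'I_(l.*2) -> bool}.
Local Notation Y := {ffun 'I_k -> S}.
Local Notation W := {ffun Y -> K^o}.

Definition MonW (s : seq ('I_l * 'I_l)) : W :=
  foldr (fun (ab : 'I_l * 'I_l) w => XW (l.-1 - ab.1) (l + ab.2) w) (top_vec K l k) s.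

Lemma Rel_Mon s : Rl (MonW s) (Mn s).
Proof.
elim: s => [|[a b] s IHs] /=; first exact: (Rel_gen _ _ _ _ _ [::]).
have := (ltn_ord a, ltn_ord b) => -[? ?].
have -> : (l + b = l.-1 - a + (a + b).+1)%N by lia.
by apply: Rel_X => //; lia.
Qed.

(* The state in which the hole of row [a] sits in slot [i a] and the particle
   of column [b] in slot [j b], for the pairs [(a, b)] of [s]. *)
Definition state (i j : 'I_l -> 'I_k) (s : seq ('I_l * 'I_l)) : Y :=
  [ffun r => [ffun p : 'I_(l.*2) => if (p < l)%N
     then ~~ has (fun ab : 'I_l * 'I_l => (l.-1 - ab.1 == p)%N && (i ab.1 == r)) s
     else has (fun ab : 'I_l * 'I_l => (l + ab.2 == p)%N && (j ab.2 == r)) s]].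

Lemma occ_state i j s r (p : nat) : (p < l.*2)%N -> occ (state i j s r) p =
  if (p < l)%N
     then ~~ has (fun ab : 'I_l * 'I_l => (l.-1 - ab.1 == p)%N && (i ab.1 == r)) s
     else has (fun ab : 'I_l * 'I_l => (l + ab.2 == p)%N && (j ab.2 == r)) s.
Proof. by move=> pN; rewrite -[p]/(val (Ordinal pN)) occE !ffunE. Qed.

(** A factor [(a, b)] moves a particle from [l - 1 - a] to [l + b] inside one slot, so the hole and
    the particle must sit in the same slot. As sites are distinct, a single term survives, with a
    sign. *)
Lemma MonW_coef (i j : 'I_l -> 'I_k) s : uniq (map fst s) -> uniq (map snd s) ->
  (MonW s (state i j s) != 0) = all (fun ab => i ab.1 == j ab.2) s.
Proof.
elim: s => [_ _|[a b] s IHs /=].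
  rewrite /= ffunE; have -> : state i j [::] = top_state l k.
    by apply/ffunP => r; apply/ffunP => p; rewrite !ffunE /=; case: ifP.
  by rewrite eqxx oner_eq0.
move=> /andP[as_ us] /andP[bs us'].
have [al bl] := (ltn_ord a, ltn_ord b).
set p := (l.-1 - a)%N; set q := (l + b)%N.
have pl : (p < l)%N by rewrite /p; lia.
have pN : (p < l.*2)%N by lia.
have qN : (q < l.*2)%N by rewrite /q; lia.
have ql : (q < l)%N = false by rewrite /q; lia.
have nps r : has (fun ab : 'I_l * 'I_l => (l.-1 - ab.1 == p)%N && (i ab.1 == r)) s = false.
  apply/negbTE/hasPn => -[a' b'] abs /=; rewrite negb_and; apply/orP; left.
  apply: contraNneq as_ => e; apply/mapP; exists (a', b') => //=.
  by apply/val_inj => /=; have := ltn_ord a'; rewrite /p in e; lia.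
have nqs r : has (fun ab : 'I_l * 'I_l => (l + ab.2 == q)%N && (j ab.2 == r)) s = false.
  apply/negbTE/hasPn => -[a' b'] abs /=; rewrite negb_and; apply/orP; left.
  apply: contraNneq bs => e; apply/mapP; exists (a', b') => //=.
  by apply/val_inj => /=; rewrite /q in e; lia.
rewrite ffunE; set y := state i j _.
have op r : occ (y r) p = (i a != r).
  by rewrite occ_state // pl /= eqxx nps orbF.
have oq r : occ (y r) q = (j b == r).
  by rewrite occ_state // ql /= eqxx nqs orbF.
have [ij|ij] := eqVneq (i a) (j b); last first.
  rewrite /= big1 ?eqxx // => r _; rewrite /cX op oq negbK.
  by case: ifP => [/andP[/eqP e1 /eqP e2]|_]; rewrite ?mul0r //= e1 e2 eqxx in ij *.
rewrite (bigD1 (i a)) //= [X in _ + X]big1 ?addr0 => [|r ne]; last first.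
  by rewrite /cX op oq negbK -ij andbb eq_sym (negPf ne) mul0r.
rewrite /cX op oq ij !eqxx /= mulf_eq0 signr_eq0 /= -(IHs us us'); congr (_ != 0).
congr (MonW s _); apply/ffunP => r; apply: occ_inj => z zN.
rewrite [RHS]occ_state // ffunE; case: eqP => [->|/eqP ne].
  rewrite occ_swp //; case: (eqVneq z p) => [->|zp].
    by rewrite oq eqxx pl nps.
  case: (eqVneq z q) => [->|zq]; first by rewrite op ij eqxx ql nqs.
  rewrite occ_state //= eq_sym -/p (negPf zp) /=.
  by rewrite [_ == z]eq_sym -/q (negPf zq).
rewrite occ_state //= ij [_ == r]eq_sym (negPf ne) !andbF /=.
by [].
Qed.

Definition graph (s : {perm 'I_l}) := [seq (a, s a) | a <- enum 'I_l].

(** All permutations can thus be tested against one and the same state. *)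
Lemma state_graph i j s : state i j (graph s) = state i j (graph 1%g).
Proof.
apply/ffunP => r; apply/ffunP => p; rewrite !ffunE; case: ifP => _.
  by congr (~~ _); rewrite !has_map; apply: eq_has => a.
rewrite !has_map; apply/hasP/hasP => -[a _ /= e].
  by exists (s a); rewrite ?perm1 // -enumT mem_enum.
by exists (s^-1 a)%g; rewrite ?permKV -?enumT ?mem_enum //; rewrite perm1 in e.
Qed.

Lemma graph_coef i j s : (MonW (graph s) (state i j (graph 1%g)) != 0) =
  [forall a, i a == j (s a)].
Proof.
have f1 : map fst (graph s) = enum 'I_l.
  by rewrite /graph -(map_comp fst (fun a => (a, s a))) map_id.
have f2 : map snd (graph s) = map s (enum 'I_l).
  by rewrite /graph -(map_comp snd (fun a => (a, s a))).
rewrite -(state_graph i j s) MonW_coef ?f1 ?f2 ?(map_inj_uniq (@perm_inj _ s)) ?enum_uniq //.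
rewrite all_map; apply/allP/forallP => [e a|e a _]; last exact: e.
by apply: e; rewrite -?enumT mem_enum.
Qed.

(** Makes the color of a row a valid slot index: appending the cell itself gives a chain one
    longer. *)
Lemma Av_color (s : {perm 'I_l}) (a : 'I_l) : s \in Av l k ->
  (lis (pcell s) a (s a) < k)%N.
Proof.
rewrite inE; apply: leq_trans; apply: (@leq_trans (lis (pcell s) a.+1 (s a).+1)).
  by apply: lis_step; apply/pcellP; exists a.
by apply: lis_mono.
Qed.

(* Elements of the same color form a decreasing sequence, so [s] is the
   lexicographically largest permutation compatible with its coloring. *)
Lemma Av_triangular (s t : {perm 'I_l}) : s \in Av l k ->
  (forall a : 'I_l, lis (pcell s) a (s a) =
     lis (pcell s) ((s^-1)%g (t a)) (t a)) ->
  t = s \/ (permlex t < permlex s)%O.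
Proof.
move=> sA e; have [w1|w1] := eqVneq (t * s^-1)%g 1%g.
  by left; rewrite -[t](mulgKV s) w1 mul1g.
right; have [a wa fixw] := permlex_first w1.
have st b : s ((t * s^-1)%g b) = t b by rewrite permM permKV.
apply: (@permlex_lt _ _ _ a) => [b ba|]; first by rewrite -st fixw.
rewrite -st; set b := (t * s^-1)%g a in wa *; rewrite ltnNge leq_eqVlt negb_or.
apply/andP; split.
  apply: contraTneq wa => /ord_inj /perm_inj eab.
  by rewrite -/b -eab ltnn.
apply/negP => lt; have := e a.
rewrite -(st a) permK -/b => eq_col.
have lt1 : (lis (pcell s) a (s a) < lis (pcell s) a.+1 (s a).+1)%N.
  by apply: lis_step; apply/pcellP; exists a.
have := leq_trans lt1 (lis_mono _ wa lt).
by rewrite {1}eq_col ltnn.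
Qed.

Hypothesis v0_neq0 : v0 != 0.
Hypothesis v_la : weight_space (Lambda K n 0 *+ k) v0.
Hypothesis ee_v : forall i, act (ee g i) v0 = 0.

(** Lexicographic induction from the smallest permutation up. In the state colored by [s], where
    column [b] takes the color of the row mapped to it, only [s] and smaller permutations have a
    nonzero coefficient. *)
Lemma Fperm_indep :
  lin_indep (fun i : 'I_#|Av l k| => Fp (enum_val i)).
Proof.
move=> c c0.
have sumW : \sum_i c i *: MonW (graph (enum_val i)) = 0 :> W.
  apply: (Rel_inj v_la ee_v v0_neq0).
  rewrite -c0; apply: Rel_sum => i _; apply: RelZ; exact: Rel_Mon.
move=> i; have [m] := ubnP #|[set t | (permlex t < permlex (enum_val i))%O]|.
elim: m i => // m IHm i; rewrite ltnS => im.
set s := enum_val i; have sA : s \in Av l k by apply: enum_valP.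
pose col a : 'I_k := Ordinal (Av_color a sA).
have /ffunP/(_ (state col (fun b => col ((s^-1)%g b)) (graph 1%g))) := sumW.
rewrite sum_ffunE [RHS]ffunE (bigD1 i) //= [X in _ + X]big1 => [|i' ne].
  rewrite addr0 ffunE -/s => /eqP; rewrite -[_ *: _]/(_ * _) mulf_eq0 => /orP[/eqP //|].
  move/negPn; rewrite graph_coef => /negP[]; apply/forallP => a.
  by rewrite permK.
rewrite ffunE -[_ *: _]/(_ * _); apply/eqP; rewrite mulf_eq0.
apply/orP; have [_|ne0] := eqVneq (MonW _ _) 0; [by right|left].
move: ne0; rewrite graph_coef => /forallP col_eq; apply/eqP; rewrite IHm //; apply: leq_trans im.
have [|e|lt] := @Av_triangular s (enum_val i') sA.
- by move=> a; have /eqP/(congr1 val) /= := col_eq a; rewrite permKV.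
- by rewrite (enum_val_inj e) eqxx in ne.
apply: proper_card; apply/properP; split.
  by apply/subsetP => t; rewrite !inE => lt'; apply: lt_trans lt.
by exists (enum_val i'); rewrite !inE ?ltxx.
Qed.

End Independence.

(** * Growth diagrams *)

Section Growth.
Local Open Scope nat_scope.

Definition isS (o : option nat) (i : nat) : bool := if o is Some c then c == i else false.

(* Fomin's local rule on edge labels: [Some i] means that a box is added to
   row [i] along the edge, [None] that nothing is added. *)
Definition rule (x y : option nat) (X : bool) : option nat * option nat :=
  if x == y then
    match x with
    | None => if X then (Some 0, Some 0) else (None, None)
    | Some i => (Some i.+1, Some i.+1)
    end
  else (x, y).

Definition rule_inv (x y : option nat) : option nat * option nat :=
  if x == y then
    match x with Some i.+1 => (Some i, Some i) | _ => (None, None) end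
  else (x, y).

(** Outgoing labels both equal to row [0] arise only from a marked cell; every other common row
    comes from bumping. *)
Definition cellX (x y : option nat) : bool := (x == Some 0) && (y == Some 0).

Lemma rule_eq x X : rule x x X = if x is Some i then (Some i.+1, Some i.+1)
  else if X then (Some 0, Some 0) else (None, None).
Proof. by rewrite /rule eqxx; case: x. Qed.

Lemma rule_ne x y X : x != y -> rule x y X = (x, y).
Proof. by rewrite /rule => /negPf ->. Qed.

Lemma ruleK x y (X : bool) : (X -> x = None /\ y = None) ->
  rule_inv (rule x y X).1 (rule x y X).2 = (x, y) /\
  cellX (rule x y X).1 (rule x y X).2 = X.
Proof.
have [->|ne] := eqVneq x y => H.
  rewrite rule_eq; case: y H => [i|] H; last by case: X {H}.
  by rewrite /rule_inv /= eqxx; case: X H => // /(_ isT) [].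
rewrite rule_ne //= /rule_inv (negPf ne); split=> //.
have -> : X = false by apply/negP => /H [e1 e2]; rewrite e1 e2 eqxx in ne.
by apply/negP => /andP[/eqP e1 /eqP e2]; rewrite e1 e2 eqxx in ne.
Qed.

Lemma rule_invK x y : rule (rule_inv x y).1 (rule_inv x y).2 (cellX x y) = (x, y) /\
  (cellX x y -> rule_inv x y = (None, None)).
Proof.
have [->|ne] := eqVneq x y.
  rewrite /rule_inv eqxx; case: y => [[|i]|] //=; split=> //.
  by rewrite rule_eq.
rewrite /rule_inv (negPf ne) rule_ne //; split=> // /andP[/eqP e1 /eqP e2].
by rewrite e1 e2 eqxx in ne.
Qed.

(** Makes the shape at the upper right corner independent of the way around the cell. *)
Lemma rule_weight x y (X : bool) i : (X -> x = None /\ y = None) ->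
  isS (rule x y X).1 i + isS y i = isS x i + isS (rule x y X).2 i.
Proof.
have [->|ne] := eqVneq x y => H; last by rewrite rule_ne //= addnC.
by rewrite rule_eq; case: y H => [c|] H; [|case: X {H}]; rewrite addnC.
Qed.

Definition antitone (f : nat -> nat) := forall i, f i.+1 <= f i.

(** For different labels [la] is the union of [mu] and [nu]. For a common row [c] the box added to
    row [c + 1] lies below the row just lengthened. *)
Lemma rule_antitone x y (X : bool) (rho mu nu la : nat -> nat) :
  (X -> x = None /\ y = None) ->
  antitone rho -> antitone mu -> antitone nu ->
  (forall i, mu i = rho i + isS y i) -> (forall i, nu i = rho i + isS x i) ->
  (forall i, la i = nu i + isS (rule x y X).2 i) -> antitone la.
Proof.
move=> H ar am an em en el i; have := (ar i, am i, an i) => -[[]].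
rewrite !el !em !en {ar am an em en el}.
have [e|ne] := eqVneq x y; last first.
  rewrite rule_ne //=; case: x ne H => [c|]; case: y => [d|] //= ne _.
  - have cd : c <> d by [move=> cd; rewrite cd eqxx in ne].
    by case: (eqVneq c i); case: (eqVneq c i.+1); case: (eqVneq d i); case: (eqVneq d i.+1); lia.
  - by case: (eqVneq c i); case: (eqVneq c i.+1); lia.
  - by case: (eqVneq d i); case: (eqVneq d i.+1); lia.
rewrite {}e in H *; rewrite rule_eq; case: y H => [c|] H /=.
  by case: (eqVneq c i); case: (eqVneq c i.+1); case: (eqVneq c.+1 i); case: (eqVneq c.+1 i.+1); lia.
by case: X {H} => /=; case: i => [|i] /=; lia.
Qed.

(** [x a b] and [y a b] label the lower and left edges of cell [(a, b)]. The last clause encodes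
    that a marked cell has no mark before it in its row or column. *)
Definition grid (l : nat) (X : nat -> nat -> bool) (x y : nat -> nat -> option nat) :=
  [/\ forall a, a < l -> x a 0 = None, forall b, b < l -> y 0 b = None,
      forall a b, a < l -> b < l -> (x a b.+1, y a.+1 b) = rule (x a b) (y a b) (X a b)
    & forall a b, a < l -> b < l -> X a b -> x a b = None /\ y a b = None].

(** The length of row [i] of the partition at the grid point [(a, b)]. *)
Definition Gx (x : nat -> nat -> option nat) a b i := \sum_(0 <= a' < a) isS (x a' b) i.

Lemma GxS x a b i : Gx x a.+1 b i = Gx x a b i + isS (x a b) i.
Proof. by rewrite /Gx big_nat_recr. Qed.

Lemma Gx0 x b i : Gx x 0 b i = 0. Proof. by rewrite /Gx big_geq. Qed.

Section Grid.
Variables (l : nat) (X : nat -> nat -> bool) (x y : nat -> nat -> option nat).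
Hypothesis gr : grid l X x y.

Lemma gridE a b : a < l -> b < l ->
  x a b.+1 = (rule (x a b) (y a b) (X a b)).1 /\
  y a.+1 b = (rule (x a b) (y a b) (X a b)).2.
Proof. by case: gr => _ _ E _ al bl; rewrite -E. Qed.

Lemma gridX a b : a < l -> b < l -> X a b -> x a b = None /\ y a b = None.
Proof. by case: gr => _ _ _; apply. Qed.

Lemma Gx_up a b i : a <= l -> b < l -> Gx x a b.+1 i = Gx x a b i + isS (y a b) i.
Proof.
move=> al bl; elim: a al => [_|a IHa al].
  by rewrite !Gx0; case: gr => _ -> //.
rewrite !GxS IHa ?(ltnW al) //; have [-> ->] := gridE al bl.
by have := rule_weight i (gridX al bl); lia.
Qed.

Lemma Gx_x0 a i : a <= l -> Gx x a 0 i = 0.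
Proof.
move=> al; rewrite /Gx big_nat_cond big1 // => a' /andP[/andP[_ a'a] _].
by case: gr => -> // ; apply: leq_trans a'a al.
Qed.

Lemma Gx_antitone a b : a <= l -> b <= l -> antitone (Gx x a b).
Proof.
elim: b a => [|b IHb] a al bl; first by move=> i; rewrite !Gx_x0.
elim: a al => [_ i|a IHa al]; first by rewrite !Gx0.
apply: (rule_antitone (gridX al bl) (IHb a _ _) (IHa _) (IHb a.+1 _ _)) => //.
- exact: ltnW.
- exact: ltnW.
- exact: ltnW.
- exact: ltnW.
- by move=> i; apply: Gx_up => //; apply: ltnW.
- by move=> i; rewrite GxS.
by move=> i; rewrite Gx_up //; have [_ ->] := gridE al bl.
Qed.

(** Restricted to row [0], the local rule is the recursion defining [lis]. *)
Lemma Gx_lis a b : a <= l -> b <= l -> Gx x a b 0 = lis X a b.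
Proof.
elim: a b => [|a IHa] b al bl; first by rewrite Gx0.
elim: b bl => [_|b IHb bl]; first by rewrite Gx_x0 // lis0r.
rewrite lisSS -IHa ?(ltnW al) // -IHb ?(ltnW bl) // -IHa ?(ltnW al) ?(ltnW bl) //.
rewrite (GxS x a b.+1) (@Gx_up a b _ (ltnW al) bl) (GxS x a b).
have [-> _] := gridE al bl; have := gridX al bl.
have [e|ne] := eqVneq (x a b) (y a b).
  rewrite e rule_eq; case: (y a b) => [c|] /=; last by case: (X a b) => /=; lia.
  by case: (X a b) => [/(_ isT) []//|_] /=; lia.
rewrite rule_ne //=; case: (X a b) => [/(_ isT) [e1 e2]|_]; first by rewrite e1 e2 in ne.
case: (x a b) ne => [c|]; case: (y a b) => [d|] //= ne; try lia.
have cd : c <> d by [move=> cd; rewrite cd eqxx in ne].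
by case: (eqVneq c 0); case: (eqVneq d 0); lia.
Qed.

Lemma grid_bound a b i : a < l -> b <= l -> x a b = Some i -> i < b.
Proof.
elim: b i => [|b IHb] i al bl; first by case: gr => ->.
have [-> _] := gridE al bl; have := IHb _ al (ltnW bl).
have [<-|ne] := eqVneq (x a b) (y a b).
  by rewrite rule_eq; case: (x a b) => [c|]; [move=> /(_ _ erefl) h [<-]|case: (X a b) => // _ [<-]].
by rewrite rule_ne //= => h e; apply: leqW; apply: h.
Qed.

End Grid.

(** [rule_inv] and [cellX] recover a cell from its upper and right edges; cells are treated from the
    top line down and from right to left. *)
Lemma grid_back_uniq l X x y X' x' y' : grid l X x y -> grid l X' x' y' ->
  (forall a, a < l -> x a l = x' a l) -> (forall b, b < l -> y l b = y' l b) ->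
  forall a b, a < l -> b < l -> X a b = X' a b.
Proof.
move=> gr gr' ex ey.
have row b : b < l -> (forall a, a < l -> x a b.+1 = x' a b.+1) ->
    forall a, a < l -> x a b = x' a b /\ X a b = X' a b.
  move=> bl eb.
  have cell a : a < l -> y a.+1 b = y' a.+1 b ->
      (x a b, y a b) = (x' a b, y' a b) /\ X a b = X' a b.
    move=> al ea; have [x1 y1] := gridE gr al bl; have [x1' y1'] := gridE gr' al bl.
    have [e1 e2] := ruleK (gridX gr al bl); have [e1' e2'] := ruleK (gridX gr' al bl).
    rewrite -x1 -y1 in e1 e2; rewrite -x1' -y1' in e1' e2'.
    by rewrite -e1 -e2 -e1' -e2' eb // ea.
  have yy d : d <= l -> y (l - d) b = y' (l - d) b.
    elim: d => [_|d IHd dl]; first by rewrite subn0 ey.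
    have al : l - d.+1 < l by lia.
    have e : (l - d.+1).+1 = l - d by lia.
    by have [|[_ ->]] := cell _ al; first by rewrite e IHd // ltnW.
  move=> a al; have [|[-> _] ->//] := cell a al.
  by have -> : a.+1 = l - (l - a.+1) by [lia]; apply: yy; lia.
have xx d : d <= l -> forall a, a < l -> x a (l - d) = x' a (l - d).
  elim: d => [_ a al|d IHd dl a al]; first by rewrite subn0 ex.
  have bl : l - d.+1 < l by lia.
  have e : (l - d.+1).+1 = l - d by lia.
  by have [|-> _] := row _ bl _ a al; first by rewrite e; apply: IHd; apply: ltnW.
move=> a b al bl; have [|_ ->//] := row b bl _ a al.
by have -> : b.+1 = l - (l - b.+1) by [lia]; apply: xx; lia.
Qed.

Lemma grid_uniq l X x y x' y' : grid l X x y -> grid l X x' y' ->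
  forall a b, a < l -> b <= l -> x a b = x' a b.
Proof.
move=> gr gr' a b; elim: b a => [|b IHb] a al bl.
  by case: gr => -> //; case: gr' => ->.
have yy a' : a' <= l -> y a' b = y' a' b.
  elim: a' => [_|a' IHa al'].
    by case: gr => _ -> //; case: gr' => _ ->.
  have [_ ->] := gridE gr al' bl; have [_ ->] := gridE gr' al' bl.
  by rewrite IHb ?(ltnW bl) // IHa // ltnW.
have [-> _] := gridE gr al bl; have [-> _] := gridE gr' al bl.
by rewrite IHb ?(ltnW bl) // yy // ltnW.
Qed.

End Growth.

(** * Existence of growth diagrams from a permutation or from their borders *)

Section GridExistence.
Local Open Scope nat_scope.

Section Forward.
Variables (l : nat) (X : nat -> nat -> bool).
Hypothesis X_row : forall a b b', X a b -> X a b' -> b = b'.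
Hypothesis X_col : forall a a' b, X a b -> X a' b -> a = a'.

Fixpoint yrow (xb : nat -> option nat) (Xb : nat -> bool) a : option nat :=
  if a is a'.+1 then (rule (xb a') (yrow xb Xb a') (Xb a')).2 else None.

Fixpoint xgrid b : nat -> option nat :=
  if b is b'.+1 then
    fun a => (rule (xgrid b' a) (yrow (xgrid b') (X^~ b') a) (X a b')).1
  else fun=> None.

(** A nontrivial label requires an earlier mark in its line, so a marked cell has trivial incoming
    edges. *)
Lemma forward_grid :
  grid l X (fun a b => xgrid b a) (fun a b => yrow (xgrid b) (X^~ b) a).
Proof.
have xN a b : xgrid b a != None -> exists2 b', b' < b & X a b'.
  elim: b => //= b IHb; have [e|ne] := eqVneq (xgrid b a) (yrow (xgrid b) (X^~ b) a).
    rewrite -e rule_eq; case: (xgrid b a) IHb => [c /(_ isT) [b' bb' Xab'] _|_].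
      by exists b' => //; apply: leqW.
    by case Xab: (X a b) => // _; exists b.
  by rewrite rule_ne //= => /IHb [b' bb' Xab']; exists b' => //; apply: leqW.
have yN a b : yrow (xgrid b) (X^~ b) a != None -> exists2 a', a' < a & X a' b.
  elim: a => //= a IHa; have [e|ne] := eqVneq (xgrid b a) (yrow (xgrid b) (X^~ b) a).
    rewrite e rule_eq; case: (yrow _ _ a) IHa => [c /(_ isT) [a' aa' Xab'] _|_].
      by exists a' => //; apply: leqW.
    by case Xab: (X a b) => // _; exists a.
  by rewrite rule_ne //= => /IHa [a' aa' Xab']; exists a' => //; apply: leqW.
split=> // a b al bl; first by rewrite /= -surjective_pairing.
move=> Xab; split; apply/eqP/negPn/negP.
  by move=> /xN [b' bb' Xab']; rewrite (X_row Xab Xab') ltnn in bb'.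
by move=> /yN [a' aa' Xab']; rewrite (X_col Xab Xab') ltnn in aa'.
Qed.

End Forward.

Lemma grid_full l X x y : grid l X x y ->
  (forall a, a < l -> exists2 b, b < l & X a b) ->
  (forall b, b < l -> exists2 a, a < l & X a b) ->
  (forall a, a < l -> x a l != None) /\ (forall b, b < l -> y l b != None).
Proof.
move=> gr Xr Xc; split=> [a al|b bl].
  have [b bl Xab] := Xr a al.
  suff H d : b + d < l -> x a (b + d).+1 != None.
    by have -> : l = (b + (l - b.+1)).+1 by [lia]; apply: H; lia.
  elim: d => [|d IHd] dl; have [-> _] := gridE gr al dl.
    rewrite addn0; have [-> ->] := gridX gr al bl Xab.
    by rewrite Xab rule_eq.
  move: IHd; rewrite addnS => /(_ (ltnW _)); rewrite -addnS => /(_ dl) IH.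
  have [<-|ne] := eqVneq (x a (b + d.+1)) (y a (b + d.+1)); last by rewrite rule_ne.
  by rewrite rule_eq; case: (x a _) IH.
have [a al Xab] := Xc b bl.
suff H d : a + d < l -> y (a + d).+1 b != None.
  by have -> : l = (a + (l - a.+1)).+1 by [lia]; apply: H; lia.
elim: d => [|d IHd] dl; have [_ ->] := gridE gr dl bl.
  rewrite addn0; have [-> ->] := gridX gr al bl Xab.
  by rewrite Xab rule_eq.
move: IHd; rewrite addnS => /(_ (ltnW _)); rewrite -addnS => /(_ dl) IH.
have [->|ne] := eqVneq (x (a + d.+1) b) (y (a + d.+1) b); last by rewrite rule_ne.
by rewrite rule_eq; case: (y _ b) IH.
Qed.

(** Stated over integers: the inverse rule removes boxes, and nonnegativity is part of the
    conclusion. *)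
Lemma rule_inv_shape x y (rho mu nu la : nat -> int) :
  let x0 := (rule_inv x y).1 in let y0 := (rule_inv x y).2 in
  (forall i, mu i = rho i + (isS y0 i)%:Z)%R -> (forall i, nu i = rho i + (isS x0 i)%:Z)%R ->
  (forall i, la i = mu i + (isS x i)%:Z)%R -> (forall i, la i = nu i + (isS y i)%:Z)%R ->
  (forall i, 0 <= mu i /\ mu i.+1 <= mu i)%R ->
  (forall i, 0 <= nu i /\ nu i.+1 <= nu i)%R ->
  (forall i, 0 <= la i /\ la i.+1 <= la i)%R ->
  (forall i, 0 <= rho i /\ rho i.+1 <= rho i)%R.
Proof.
rewrite /= => em en el el' am an al i.
move: (am i) (an i) (al i) (em i) (en i) (el i) (el' i).
move: (em i.+1) (en i.+1) (el i.+1) (el' i.+1) (am i.+1) (an i.+1) (al i.+1).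
have [e|ne] := eqVneq x y.
  rewrite e /rule_inv eqxx; case: y {e em en el el' am an al} => [[|c]|] /=.
  - by case: i => [|i] /=; lia.
  - by case: (eqVneq c i); case: (eqVneq c i.+1); case: (eqVneq c.+1 i); case: (eqVneq c.+1 i.+1); lia.
  - by lia.
rewrite /rule_inv (negPf ne) /=; case: x ne {em en el el' am an al} => [c|]; case: y => [d|] //= ne.
- have cd : c <> d by [move=> cd; rewrite cd eqxx in ne].
  by case: (eqVneq c i); case: (eqVneq c i.+1); case: (eqVneq d i); case: (eqVneq d i.+1); lia.
- by case: (eqVneq c i); case: (eqVneq c i.+1); lia.
- by case: (eqVneq d i); case: (eqVneq d i.+1); lia.
Qed.

Section Backward.
Variables (l : nat) (r s : nat -> nat) (HA HB : nat -> nat -> nat).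
Hypotheses (HA0 : forall i, HA 0 i = 0) (HB0 : forall i, HB 0 i = 0).
Hypothesis HAS : forall m i, m < l -> HA m.+1 i = HA m i + (r m == i).
Hypothesis HBS : forall m i, m < l -> HB m.+1 i = HB m i + (s m == i).
Hypothesis HA_anti : forall m, m <= l -> antitone (HA m).
Hypothesis HB_anti : forall m, m <= l -> antitone (HB m).
Hypothesis HAB : forall i, HA l i = HB l i.

(** The recursion runs from the borders: [d] is the distance to the right border, and the argument
    [j] of [xback] the distance to the top border. *)
Fixpoint yback (xt : nat -> option nat) (y1 : option nat) d : option nat :=
  if d is d'.+1 then (rule_inv (xt (l - d)) (yback xt y1 d')).2 else y1.

Fixpoint xback j : nat -> option nat :=
  if j is j'.+1 then
    fun a => (rule_inv (xback j' a) (yback (xback j') (Some (s (l - j))) (l - a.+1))).1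
  else fun a => Some (r a).

Let x a b := xback (l - b) a.
Let y a b := yback (xback (l - b.+1)) (Some (s b)) (l - a).

Lemma back_cell a b : a < l -> b < l ->
  x a b = (rule_inv (x a b.+1) (y a.+1 b)).1 /\ y a b = (rule_inv (x a b.+1) (y a.+1 b)).2.
Proof.
move=> al bl; split.
  rewrite /x; have -> : l - b = (l - b.+1).+1 by lia.
  rewrite /= /y; have -> : l - (l - b.+1).+1 = b by lia.
  by [].
rewrite /y; have -> : l - a = (l - a.+1).+1 by lia.
rewrite /= /x; have -> : l - (l - a.+1).+1 = a by lia.
by [].
Qed.

Lemma back_top a : x a l = Some (r a). Proof. by rewrite /x subnn. Qed.
Lemma back_right b : y l b = Some (s b). Proof. by rewrite /y subnn. Qed.

(** The shape at [(a, b)] obtained by removing boxes from the right border; it is an integer because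
    its sign is controlled only in [Hz_shape]. *)
Definition Hz a b i : int := ((HB b i)%:Z - (\sum_(a <= a' < l) isS (x a' b) i)%:Z)%R.

Lemma Hz_right a b i : a < l -> (Hz a.+1 b i = Hz a b i + (isS (x a b) i)%:Z)%R.
Proof.
by move=> al; rewrite /Hz [in RHS]big_ltn // PoszD; lia.
Qed.

Lemma Hz_l b i : Hz l b i = (HB b i)%:Z.
Proof. by rewrite /Hz big_geq // subr0. Qed.

Lemma Hz_up a b i : a <= l -> b < l -> (Hz a b.+1 i = Hz a b i + (isS (y a b) i)%:Z)%R.
Proof.
move=> al bl; have [d -> dl] : exists2 d, a = l - d & d <= l by exists (l - a); lia.
elim: d dl {a al} => [|d IHd] dl.
  by rewrite subn0 !Hz_l HBS // back_right PoszD.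
have al : l - d.+1 < l by lia.
have e : (l - d.+1).+1 = l - d by lia.
have := IHd (ltnW dl); rewrite -e !Hz_right //.
have [ex ey] := back_cell al bl.
have [e1 e2] := rule_invK (x (l - d.+1) b.+1) (y (l - d.+1).+1 b).
have H : cellX (x (l - d.+1) b.+1) (y (l - d.+1).+1 b) ->
   (rule_inv (x (l - d.+1) b.+1) (y (l - d.+1).+1 b)).1 = None /\
   (rule_inv (x (l - d.+1) b.+1) (y (l - d.+1).+1 b)).2 = None by move=> /e2 ->.
have := rule_weight i H; rewrite e1 -ex -ey /=; lia.
Qed.

Lemma Hz_top a i : a <= l -> Hz a l i = (HA a i)%:Z.
Proof.
move=> al; have [d -> dl] : exists2 d, a = l - d & d <= l by exists (l - a); lia.
elim: d dl {a al} => [|d IHd] dl; first by rewrite subn0 Hz_l HAB.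
have al : l - d.+1 < l by lia.
have e : (l - d.+1).+1 = l - d by lia.
have := IHd (ltnW dl); rewrite -e Hz_right // HAS // back_top /=; lia.
Qed.

Lemma Hz_shape a b : a <= l -> b <= l -> forall i, (0 <= Hz a b i /\ Hz a b i.+1 <= Hz a b i)%R.
Proof.
move=> al bl.
have [d -> dl] : exists2 d, a = l - d & d <= l by exists (l - a); lia.
have [e -> el] : exists2 e, b = l - e & e <= l by exists (l - b); lia.
elim: e el d dl {a b al bl} => [|e IHe] el d dl.
  by move=> i; rewrite subn0 !Hz_top ?leq_subr //; have := HA_anti (leq_subr d l) i; lia.
elim: d dl => [|d IHd] dl.
  by move=> i; rewrite subn0 !Hz_l; have := HB_anti (leq_subr e.+1 l) i; lia.
have al : l - d.+1 < l by lia.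
have ea : l - d = (l - d.+1).+1 by lia.
have bl : l - e.+1 < l by lia.
have eb : l - e = (l - e.+1).+1 by lia.
have h1 := IHe (ltnW el) d.+1 dl.
have h2 := IHe (ltnW el) d (ltnW dl).
have h3 := IHd (ltnW dl).
rewrite ea in h2 h3; rewrite eb in h1 h2.
have [ex ey] := back_cell al bl.
apply: (rule_inv_shape (x := x (l - d.+1) (l - e.+1).+1) (y := y (l - d.+1).+1 (l - e.+1)) _ _ _ _ h1 h3 h2) => i.
- by rewrite -ey; apply: Hz_up => //; apply: ltnW.
- by rewrite -ex; apply: Hz_right.
- exact: Hz_right.
- exact: Hz_up.
Qed.

(** The shapes on the left border are nonnegative, grow upwards and end at the empty one, so they
    are all empty and the left edges are trivial; nonnegativity at the origin does the same for the
    bottom edges. *)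
Lemma backward_grid : exists X x y, [/\ grid l X x y,
  forall a, a < l -> x a l = Some (r a) & forall b, b < l -> y l b = Some (s b)].
Proof.
exists (fun a b => cellX (x a b.+1) (y a.+1 b)), x, y; split; last 2 first.
- by move=> a _; apply: back_top.
- by move=> b _; apply: back_right.
have Hz0 b i : b <= l -> Hz 0 b i = 0%R.
  move=> bl; have [e -> el] : exists2 e, b = l - e & e <= l by exists (l - b); lia.
  elim: e el {b bl} => [|e IHe] el; first by rewrite subn0 Hz_top // HA0.
  have bl : l - e.+1 < l by lia.
  have := Hz_up i (leq0n l) bl; have -> : (l - e.+1).+1 = l - e by lia.
  rewrite IHe ?(ltnW el) //; have [] := Hz_shape (leq0n l) (ltnW bl) i; lia.
split.
- move=> a al; have [h0 _] := Hz_shape (leq0n l) (leq0n l) 0.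
  case xa: (x a 0) => [c|//]; exfalso.
  have [h _] := Hz_shape (leq0n l) (leq0n l) c; move: h.
  rewrite /Hz HB0 (@big_cat_nat _ _ _ a) //= ?(ltnW al) // (@big_ltn _ _ _ a) //.
  by rewrite xa /= eqxx; lia.
- move=> b bl; case yb: (y 0 b) => [c|//]; exfalso.
  have := Hz_up c (leq0n l) bl; rewrite !Hz0 ?(ltnW bl) // yb /= eqxx; lia.
- move=> a b al bl; have [ex ey] := back_cell al bl.
  have [e1 _] := rule_invK (x a b.+1) (y a.+1 b).
  by rewrite ex ey e1.
- move=> a b al bl; have [ex ey] := back_cell al bl.
  have [_ e2] := rule_invK (x a b.+1) (y a.+1 b).
  by move=> /e2 e; rewrite ex ey e.
Qed.

End Backward.
End GridExistence.

(** * Walks in Young's lattice *)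

Section Conjugate.
Local Open Scope nat_scope.

(* Conjugate of a partition with [K] parts [f 0, ..., f (K - 1)]. *)
Definition conj_part (K : nat) (f : nat -> nat) (i : nat) : nat := \sum_(c < K) (i < f c).

Lemma conj_part_antitone K f : antitone (conj_part K f).
Proof. by move=> i; apply: leq_sum => c _; case: (ltnP i.+1 (f c)) => // /ltnW ->. Qed.

Lemma conj_part_le K f i : conj_part K f i <= K.
Proof.
rewrite -[X in _ <= X](card_ord K) -sum1_card; apply: leq_sum => c _.
exact: leq_b1.
Qed.

Lemma eq_conj_part K f f' i : (forall c, c < K -> f c = f' c) ->
  conj_part K f i = conj_part K f' i.
Proof. by move=> e; apply: eq_bigr => c _; rewrite e. Qed.

(** A box put on top of column [c0] lands in the row whose index is the old height of that
    column. *)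
Lemma conj_part_step K f f' c0 : c0 < K ->
  (forall c, c < K -> f' c = f c + (c == c0)) ->
  forall i, conj_part K f' i = conj_part K f i + (f c0 == i).
Proof.
move=> c0K e i; rewrite /conj_part (bigD1 (Ordinal c0K)) //= [in RHS](bigD1 (Ordinal c0K)) //=.
rewrite e // eqxx (eq_bigr (fun c : 'I_K => (i < f c) : nat)) => [|c].
  by rewrite addn1 ltnS; case: ltngtP => _; lia.
by rewrite -val_eqE /= => /negPf ne; rewrite e // ne addn0.
Qed.

Lemma conj_part_lt L h i c : (forall j, j.+1 < L -> h j.+1 <= h j) -> i < L ->
  (i < conj_part L h c) = (c < h i).
Proof.
move=> ha iL.
have mono j d : j + d < L -> h (j + d) <= h j.
  elim: d => [|d IHd] jd; first by rewrite addn0.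
  by rewrite addnS; apply: leq_trans (IHd _); [apply: ha|]; lia.
have sE : conj_part L h c = \sum_(0 <= j < L) (c < h j).
  by rewrite /conj_part big_mkord.
rewrite sE (@big_cat_nat _ _ _ i.+1) //=.
have [ch|hc] := ltnP c (h i).
  rewrite (eq_big_nat _ _ (F2 := fun=> 1)) => [|j ji]; last first.
    have := mono j (i - j); rewrite subnKC; [|lia] => /(_ iL) hj.
    by rewrite (leq_trans ch hj).
  by rewrite sum_nat_const_nat; lia.
rewrite big_nat_recr //= [c < h i]ltnNge hc /= [X in _ + X]big_nat_cond [X in _ + X]big1 => [|j].
  rewrite !addn0 ltnNge; apply/negbF.
  apply: leq_trans (_ : \sum_(0 <= j < i) 1 <= _).
    by apply: leq_sum => j _; apply: leq_b1.
  by rewrite sum_nat_const_nat; lia.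
move=> /andP[ij _]; have := mono i (j - i); rewrite subnKC; [|lia].
by move=> /(_ ltac:(lia)) hj; apply/eqP; rewrite eqb0 -leqNgt; apply: leq_trans hj hc.
Qed.

Lemma conj_partK K L h i : (forall j, j.+1 < L -> h j.+1 <= h j) ->
  i < L -> h i <= K -> conj_part K (conj_part L h) i = h i.
Proof.
move=> ha iL hK; rewrite /conj_part; under eq_bigr do rewrite conj_part_lt //.
rewrite -(big_mkord xpredT (fun c => (c < h i) : nat)) (@big_cat_nat _ _ _ (h i)) //=.
rewrite (eq_big_nat _ _ (F2 := fun=> 1)) => [|j /andP[_ ->]] //.
rewrite sum_nat_const_nat big_nat_cond big1 => [|j /andP[/andP[hj _] _]]; first by lia.
by rewrite ltnNge hj.
Qed.

End Conjugate.

Section Walks.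
Local Open Scope nat_scope.
Variables (l k : nat).
Hypotheses (l_gt0 : 0 < l).

(* Closed walks of length [2l] in Young's lattice, going up for [l] steps and
   down afterwards; [tt c m] is the length of column [c] after [m] steps. *)
Definition walk (tt : nat -> nat -> nat) : Prop :=
  [/\ forall c, c < k -> tt c 0 = 0 /\ tt c l.*2 = 0,
      forall c m, c.+1 < k -> m <= l.*2 -> tt c.+1 m <= tt c m,
      forall m, m < l -> exists2 c0, c0 < k & forall c, c < k -> tt c m.+1 = tt c m + (c == c0)
    & forall m, l <= m < l.*2 ->
        exists2 c0, c0 < k & forall c, c < k -> tt c m = tt c m.+1 + (c == c0)].

Definition rows (tt : nat -> nat -> nat) m i : nat := conj_part k (tt^~ m) i.

(** The ascent is read along the top border and the descent along the right border downwards, so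
    that height [b] is time [2l - b]. *)
Definition growth_walk (s : {perm 'I_l}) (tt : nat -> nat -> nat) : Prop :=
  exists x y, [/\ grid l (pcell s) x y,
    forall m i, m <= l -> i < l -> Gx x m l i = rows tt m i
  & forall b i, b <= l -> i < l -> Gx x l b i = rows tt (l.*2 - b) i].

Lemma walk_le tt c m : walk tt -> c < k -> m <= l.*2 -> tt c m <= l.
Proof.
move=> [t0 _ tup tdn] ck mL.
have up m' : m' <= l -> tt c m' <= m'.
  elim: m' => [|m' IHm] ml; first by have [-> _] := t0 c ck.
  by have [c0 _ ->] := tup _ ml; [have := IHm (ltnW ml); case: eqP|]; lia.
have [ml|/ltnW lm] := leqP m l; first by apply: leq_trans (up _ ml) ml.
have dn d : d <= l -> tt c (l.*2 - d) <= d.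
  elim: d => [|d IHd] dl; first by rewrite subn0; have [_ ->] := t0 c ck.
  have [|c0 _ ->] := tdn (l.*2 - d.+1); [lia| |by []].
  have -> : (l.*2 - d.+1).+1 = l.*2 - d by lia.
  by have := IHd (ltnW dl); case: eqP; lia.
have := dn (l.*2 - m); have -> : l.*2 - (l.*2 - m) = m by lia.
lia.
Qed.

Lemma grid_afterX X x y a b : grid l X x y -> a < l -> b < l -> X a b ->
  (forall b', b < b' <= l -> x a b' != None) /\ (forall a', a < a' <= l -> y a' b != None).
Proof.
move=> gr al bl Xab; have [xN yN] := gridX gr al bl Xab.
have [x1 y1] := gridE gr al bl; rewrite xN yN Xab rule_eq /= in x1 y1.
split.
  elim=> [//|b' IHb] /andP[bb' b'l].
  move: bb'; rewrite ltnS leq_eqVlt => /orP[/eqP <-|lt]; first by rewrite x1.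
  have [-> _] := gridE gr al b'l.
  have IH : x a b' != None by apply: IHb; rewrite lt ltnW.
  have [<-|ne] := eqVneq (x a b') (y a b'); last by rewrite rule_ne.
  by rewrite rule_eq; case: (x a b') IH.
elim=> [//|a' IHa] /andP[aa' a'l].
move: aa'; rewrite ltnS leq_eqVlt => /orP[/eqP <-|lt]; first by rewrite y1.
have [_ ->] := gridE gr a'l bl.
have IH : y a' b != None by apply: IHa; rewrite lt ltnW.
have [->|ne] := eqVneq (x a' b) (y a' b); last by rewrite rule_ne.
by rewrite rule_eq; case: (y a' b) IH.
Qed.

(** A row without mark would carry the trivial label up to the top border. After a mark the labels
    stay nontrivial, which excludes a second mark in its line. *)
Lemma grid_perm X x y : grid l X x y -> (forall a, a < l -> x a l != None) ->
  exists s : {perm 'I_l}, forall a b, a < l -> b < l -> X a b = pcell s a b.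
Proof.
move=> gr xl.
have ex (a : 'I_l) : exists b : 'I_l, X a b.
  have [/existsP //|] := boolP [exists b : 'I_l, X a b].
  rewrite negb_exists => /forallP nX.
  suff xN b : b <= l -> x a b = None by have := xl a (ltn_ord a); rewrite xN.
  elim: b => [_|b IHb bl]; first by case: gr => ->.
  have [-> _] := gridE gr (ltn_ord a) bl; have := nX (Ordinal bl) => /= /negPf ->.
  rewrite (IHb (ltnW bl)); have [<-|ne] := eqVneq None (y a b); last by rewrite rule_ne.
  by rewrite rule_eq.
have [s0 Xs0] := fin_all_exists ex.
have colu a a' (b : 'I_l) : a < a' -> a' < l -> X a b -> X a' b -> False.
  move=> aa' a'l Xab Xab'; have [_ yN] := gridX gr a'l (ltn_ord b) Xab'.
  have [_ /(_ a')] := grid_afterX gr (ltn_trans aa' a'l) (ltn_ord b) Xab.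
  by rewrite yN aa' (ltnW a'l) => /(_ isT).
have s0_inj : injective s0.
  move=> a a' e; apply/val_inj => /=; case: (ltngtP a a') => // lt; exfalso.
    by apply: (colu a a' (s0 a) lt (ltn_ord a') (Xs0 a)); rewrite e; apply: Xs0.
  by apply: (colu a' a (s0 a) lt (ltn_ord a) _ (Xs0 a)); rewrite e; apply: Xs0.
have rowu (a : 'I_l) b b' : b < b' -> b' < l -> X a b -> X a b' -> False.
  move=> bb' b'l Xab Xab'; have [xN _] := gridX gr (ltn_ord a) b'l Xab'.
  have [/(_ b')] := grid_afterX gr (ltn_ord a) (ltn_trans bb' b'l) Xab.
  by rewrite xN bb' (ltnW b'l) => /(_ isT).
exists (perm s0_inj) => a b al bl; apply/idP/pcellP => [Xab|[i [ia ib]]].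
  exists (Ordinal al); split=> //; rewrite permE; have := Xs0 (Ordinal al) => /= Xs.
  case: (ltngtP (s0 (Ordinal al)) b) => // lt; exfalso.
    exact: (rowu (Ordinal al) _ _ lt bl Xs Xab).
  exact: (rowu (Ordinal al) _ _ lt (ltn_ord _) Xab Xs).
by rewrite -ia -ib permE; apply: Xs0.
Qed.

Lemma eq_grid X X' x y : (forall a b, a < l -> b < l -> X a b = X' a b) ->
  grid l X x y -> grid l X' x y.
Proof.
move=> e [g1 g2 g3 g4]; split=> // a b al bl; first by rewrite g3 // e.
by rewrite -e //; apply: g4.
Qed.

(** With [k] columns the first row has at most [k] boxes, which bounds [lis] through [Gx_lis]. *)
Lemma walk_growth tt : walk tt -> exists2 s, s \in Av l k & growth_walk s tt.
Proof.
move=> [t0 tanti tup tdn].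
have hr (m : 'I_l) : exists u, forall i, rows tt m.+1 i = rows tt m i + (u == i).
  have [c0 c0k e] := tup m (ltn_ord m).
  by exists (tt c0 m); apply: conj_part_step.
have hs (b : 'I_l) : exists u,
    forall i, rows tt (l.*2 - b.+1) i = rows tt (l.*2 - b) i + (u == i).
  have bl := ltn_ord b.
  have [|c0 c0k] := tdn (l.*2 - b.+1); first by lia.
  have -> : (l.*2 - b.+1).+1 = l.*2 - b by lia.
  by move=> e; exists (tt c0 (l.*2 - b)); apply: conj_part_step.
have [r rE] := fin_all_exists hr; have [s sE] := fin_all_exists hs.
pose r' m := if insub m is Some i then r i else 0.
pose s' m := if insub m is Some i then s i else 0.
have r'E m i : m < l -> rows tt m.+1 i = rows tt m i + (r' m == i).
  by move=> ml; rewrite /r' insubT -(rE (Ordinal ml)).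
have s'E m i : m < l -> rows tt (l.*2 - m.+1) i = rows tt (l.*2 - m) i + (s' m == i).
  by move=> ml; rewrite /s' insubT -(sE (Ordinal ml)).
have [||||||| X [x [y [gr xt yr]]]] := @backward_grid l r' s' (rows tt) (fun b => rows tt (l.*2 - b)).
- by move=> i; apply: big1 => c _; have [-> _] := t0 c (ltn_ord c).
- by move=> i; rewrite subn0; apply: big1 => c _; have [_ ->] := t0 c (ltn_ord c).
- exact: r'E.
- exact: s'E.
- by move=> m _; apply: conj_part_antitone.
- by move=> m _; apply: conj_part_antitone.
- by move=> i; congr (rows tt _ i); lia.
have [|s0 s0E] := grid_perm gr; first by move=> a al; rewrite xt.
have gr' := eq_grid s0E gr.
have GA m i : m <= l -> Gx x m l i = rows tt m i.
  elim: m => [_|m IHm ml].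
    by rewrite Gx0; symmetry; apply: big1 => c _; have [-> _] := t0 c (ltn_ord c).
  by rewrite GxS (IHm (ltnW ml)) xt // r'E.
have GB b i : b <= l -> Gx x l b i = rows tt (l.*2 - b) i.
  elim: b => [_|b IHb bl].
    rewrite (Gx_x0 gr') // subn0; symmetry; apply: big1 => c _.
    by have [_ ->] := t0 c (ltn_ord c).
  by rewrite (Gx_up gr') // (IHb (ltnW bl)) yr // s'E.
exists s0; last by exists x, y; split=> // m i ml _; [apply: GA|apply: GB].
by rewrite inE -(Gx_lis gr') // GA //; apply: conj_part_le.
Qed.

Lemma pcell_row (s : {perm 'I_l}) a b b' : pcell s a b -> pcell s a b' -> b = b'.
Proof.
move=> /pcellP[i [ia <-]] /pcellP[j [ja <-]].
by have -> : i = j by apply/val_inj; rewrite /= ia ja.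
Qed.

Lemma pcell_col (s : {perm 'I_l}) a a' b : pcell s a b -> pcell s a' b -> a = a'.
Proof.
move=> /pcellP[i [<- ib]] /pcellP[j [<- jb]].
by have -> : i = j by apply: (@perm_inj _ s); apply/val_inj; rewrite /= ib jb.
Qed.

Lemma grid_bound_y X x y a b i : grid l X x y -> a <= l -> b < l -> y a b = Some i -> i < a.
Proof.
move=> gr; elim: a i => [|a IHa] i al bl; first by case: gr => _ ->.
have [_ ->] := gridE gr al bl; have := IHa _ (ltnW al) bl.
have [->|ne] := eqVneq (x a b) (y a b).
  by rewrite rule_eq; case: (y a b) => [c|]; [move=> /(_ _ erefl) h [<-]|case: (X a b) => // _ [<-]].
by rewrite rule_ne //= => h e; apply: leqW; apply: h.
Qed.

Lemma growth_exists s : s \in Av l k -> exists2 tt, walk tt & growth_walk s tt.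
Proof.
rewrite inE => lisk; have gr := forward_grid l (@pcell_row s) (@pcell_col s).
move: (fun a b => _) (fun a b => _) gr => y x gr.
have [||xS yS] := grid_full gr.
- by move=> a al; exists (s (Ordinal al)) => //; apply/pcellP; exists (Ordinal al).
- move=> b bl; exists (s^-1 (Ordinal bl))%g => //; apply/pcellP.
  by exists (s^-1 (Ordinal bl))%g; rewrite permKV.
(* The index [l] bounds the number of rows, by [grid_bound] and [grid_bound_y]. *)
pose tt c m := if m <= l then conj_part l (Gx x m l) c else conj_part l (Gx x l (l.*2 - m)) c.
have ttA c m : m <= l -> tt c m = conj_part l (Gx x m l) c by rewrite /tt => ->.
have ttB c m : l <= m -> tt c m = conj_part l (Gx x l (l.*2 - m)) c.
  rewrite leq_eqVlt /tt => /orP[/eqP <-|lm]; last by rewrite leqNgt lm.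
  by rewrite leqnn; congr (conj_part l (Gx x l _) c); lia.
have leA m i : m <= l -> Gx x m l i <= k.
  move=> ml; have h : Gx x m l i <= Gx x m l 0.
    elim: i => // i IHi; exact: leq_trans (Gx_antitone gr ml (leqnn l) i) IHi.
  apply: leq_trans h _; rewrite (Gx_lis gr) //; apply: leq_trans lisk.
  exact: lis_mono.
have leB m i : m <= l -> Gx x l m i <= k.
  move=> ml; have h : Gx x l m i <= Gx x l m 0.
    elim: i => // i IHi; exact: leq_trans (Gx_antitone gr (leqnn l) ml i) IHi.
  apply: leq_trans h _; rewrite (Gx_lis gr) //; apply: leq_trans lisk.
  exact: lis_mono.
exists tt.
  split.
  - move=> c ck; rewrite ttA // ttB; last by lia.
    by rewrite subnn; split; apply: big1 => i _; rewrite ?Gx0 ?(Gx_x0 gr).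
  - by move=> c m _ _; rewrite /tt; case: ifP => _; apply: conj_part_antitone.
  - move=> m ml; case xm: (x m l) (xS m ml) => [r|] // _.
    have rl := grid_bound gr ml (leqnn l) xm.
    (* The new box ends row [r], so its column is the old length of that row. *)
    exists (Gx x m l r); first by have := leA m.+1 r ml; rewrite GxS xm /= eqxx; lia.
    move=> c _; rewrite !ttA ?(ltnW ml) // [_ == Gx _ _ _ _]eq_sym.
    by apply: conj_part_step => // i _; rewrite GxS xm /= eq_sym.
  - move=> m /andP[lm ml]; have bl : l.*2 - m.+1 < l by lia.
    case yb: (y l (l.*2 - m.+1)) (yS _ bl) => [r|] // _.
    have rl := grid_bound_y gr (leqnn l) bl yb.
    have e : l.*2 - m = (l.*2 - m.+1).+1 by lia.
    exists (Gx x l (l.*2 - m.+1) r).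
      by have := leB _ r bl; rewrite (Gx_up gr) // yb /= eqxx; lia.
    move=> c _; rewrite !ttB ?e; [|lia..]; rewrite [_ == Gx _ _ _ _]eq_sym.
    by apply: conj_part_step => // i _; rewrite (Gx_up gr) // yb /= eq_sym.
exists x, y; split=> // m i ml il.
  rewrite /rows (@eq_conj_part _ _ (conj_part l (Gx x m l))) => [|c _]; last exact: ttA.
  by rewrite conj_partK ?leA // => j _; exact: (Gx_antitone gr ml (leqnn l) j).
rewrite /rows (@eq_conj_part _ _ (conj_part l (Gx x l m))) => [|c _].
  by rewrite conj_partK ?leB // => j _; exact: (Gx_antitone gr (leqnn l) ml j).
by rewrite ttB; [congr (conj_part l (Gx x l _) c)|]; lia.
Qed.

Lemma growth_perm_uniq s s' tt : growth_walk s tt -> growth_walk s' tt -> s = s'.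
Proof.
move=> [x [y [gr gA gB]]] [x' [y' [gr' gA' gB']]].
have isS_inj o o' : (forall i, o = Some i -> i < l) -> (forall i, o' = Some i -> i < l) ->
    (forall i, i < l -> isS o i = isS o' i :> nat) -> o = o'.
  case: o => [c|]; case: o' => [d|] //= h h' e.
  - by have := e c (h _ erefl); rewrite eqxx; case: eqP => // ->.
  - by have := e c (h _ erefl); rewrite eqxx.
  - by have := e d (h' _ erefl); rewrite eqxx.
have ex a : a < l -> x a l = x' a l.
  move=> al; apply: isS_inj => [i|i|i il]; [exact: (grid_bound gr)|exact: (grid_bound gr')|].
  have := gA a.+1 i al il; rewrite -(gA' a.+1) // !GxS (gA a) ?(ltnW al) // (gA' a) ?(ltnW al) //.
  by lia.
have ey b : b < l -> y l b = y' l b.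
  move=> bl; apply: isS_inj => [i|i|i il]; [exact: (grid_bound_y gr)|exact: (grid_bound_y gr')|].
  have := gB b.+1 i bl il; rewrite -(gB' b.+1) // (Gx_up gr) // (Gx_up gr') //.
  by rewrite (gB b) ?(ltnW bl) // (gB' b) ?(ltnW bl) //; lia.
have X_eq := grid_back_uniq gr gr' ex ey.
apply/permP => i; apply/val_inj => /=.
have p1 : pcell s i (s i) by apply/pcellP; exists i.
rewrite X_eq ?ltn_ord // in p1.
have p2 : pcell s' i (s' i) by apply/pcellP; exists i.
exact: pcell_row p1 p2.
Qed.

Lemma growth_walk_uniq s tt tt' : walk tt -> walk tt' ->
  growth_walk s tt -> growth_walk s tt' ->
  forall c m, c < k -> m <= l.*2 -> tt c m = tt' c m.
Proof.
move=> w w' [x [y [gr gA gB]]] [x' [y' [gr' gA' gB']]] c m ck mL.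
have exx := grid_uniq gr gr'.
have Gxx a b i : a <= l -> b <= l -> Gx x a b i = Gx x' a b i.
  move=> al bl; rewrite /Gx; apply: eq_big_nat => a' /andP[_ a'a].
  by rewrite exx //; apply: leq_trans a'a al.
have re i : i < l -> rows tt m i = rows tt' m i.
  move=> il; have [ml|lm] := leqP m l; first by rewrite -gA // -gA' // Gxx.
  have e : m = l.*2 - (l.*2 - m) by lia.
  have bl : l.*2 - m <= l by lia.
  by rewrite e -gB // -gB' // Gxx.
have [_ ta _ _] := w; have [_ ta' _ _] := w'.
rewrite -(@conj_partK l k (tt^~ m)) ?walk_le //; last by move=> j jk; apply: ta.
rewrite -(@conj_partK l k (tt'^~ m)) ?walk_le //; last by move=> j jk; apply: ta'.
exact: eq_conj_part.
Qed.

End Walks.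

(** * Lattice paths and admissible sequences *)

Section Paths.
Variable l : nat.
Hypothesis l_gt0 : (0 < l)%N.
Implicit Type p : word l.

Lemma xposS p m : (m < l.*2)%N -> xpos p m.+1 = (xpos p m + nth false p m)%N.
Proof.
by move=> ml; rewrite /xpos (take_nth false) ?size_tuple // -cats1 count_cat /= addn0.
Qed.

Lemma xpos0 p : xpos p 0 = 0%N. Proof. by rewrite /xpos take0. Qed.

Lemma xypos p m : (m <= l.*2)%N -> (xpos p m + ypos p m = m)%N.
Proof.
move=> ml; rewrite /xpos /ypos (count_predC id).
by rewrite size_takel ?size_tuple.
Qed.

Lemma xpos_mono p m m' : (m <= m')%N -> (m' <= l.*2)%N -> (xpos p m <= xpos p m')%N.
Proof.
move=> /subnK <-; elim: (m' - m)%N => //= d IHd dl.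
by rewrite addSn xposS //; apply: leq_trans (leq_addr _ _); apply: IHd; apply: ltnW.
Qed.

Lemma ypos_mono p m m' : (m <= m')%N -> (m' <= l.*2)%N -> (ypos p m <= ypos p m')%N.
Proof.
move=> /subnK <-; elim: (m' - m)%N => //= d IHd dl.
have dl' : (d + m < l.*2)%N by [].
have := xypos p dl'; have := xypos p (ltnW dl'); have := IHd (ltnW dl').
by rewrite addSn xposS //; case: (nth _ _ _) => /=; lia.
Qed.

Lemma xpos_end p : is_path p -> xpos p l.*2 = l.
Proof. by move/eqP; rewrite /xpos take_oversize // size_tuple. Qed.

Lemma xpos_bounds p m : is_path p -> (m <= l.*2)%N ->
  (m - l <= xpos p m <= minn m l)%N.
Proof.
move=> pp ml; have e := xpos_end pp; have := xypos p (leqnn l.*2).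
have := xypos p ml; have := xpos_mono p ml (leqnn _); have := ypos_mono p ml (leqnn _).
by lia.
Qed.

Lemma xpos_ivt p c : is_path p -> (c < l)%N ->
  exists m : 'I_(l.*2), tnth p m /\ xpos p m = c.
Proof.
move=> pp cl.
have ex : exists m, (c < xpos p m.+1)%N && (m < l.*2)%N.
  by exists l.*2.-1; rewrite prednK ?double_gt0 // xpos_end // cl /=; lia.
case: (ex_minnP ex) => m /andP[cm ml] mmin; exists (Ordinal ml).
have cm' : (xpos p m <= c)%N.
  case: m cm ml mmin => [|m] cm ml mmin; first by rewrite xpos0.
  by rewrite leqNgt; apply/negP => h; have := mmin m; rewrite h (ltnW ml) ltnn => /(_ isT).
rewrite (tnth_nth false) /=; move: cm; rewrite xposS //.
by case: (nth _ _ _) => /=; [split|]; lia.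
Qed.

(** After [c + h + 1] steps the path is on the antidiagonal through the upper left and lower right
    corners of the box, and the box is below it when the path is at or left of [c]. *)
Lemma belowE p (b : 'I_l * 'I_l) : is_path p ->
  below p b = (xpos p (b.1 + b.2).+1 <= b.1)%N.
Proof.
case: b => c h pp /=; have [cl hl] := (ltn_ord c, ltn_ord h).
have chl : ((c + h).+1 <= l.*2)%N by lia.
apply/existsP/idP => [[m /and3P[_ /eqP /= xm ym]]|xc].
  have := xypos p (ltnW (ltn_ord m)); rewrite xm => e.
  by rewrite -{2}xm; apply: xpos_mono; [lia|apply: ltnW].
have [m [pm xm]] := xpos_ivt pp cl; exists m; rewrite pm xm eqxx /=.
have e := xypos p (ltnW (ltn_ord m)).
have : (c + h < m)%N.
  rewrite ltnNge; apply/negP => mch.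
  have := xpos_mono p (_ : m < (c + h).+1)%N chl; rewrite xposS ?ltn_ord //.
  by rewrite (tnth_nth false) in pm; rewrite pm xm; lia.
by lia.
Qed.

(** The boxes of one color form the diagonal [c + h = s]; those below the path have [c] from
    [xpos p s.+1] up to [minn s.+1 l]. *)
Lemma nbelowE p s : is_path p -> (s < l.*2.-1)%N ->
  nbelow p (s%:Z - (l%:Z - 1)) = (minn s.+1 l - xpos p s.+1)%N.
Proof.
move=> pp sl; have sl' : (s.+1 <= l.*2)%N by lia.
have /andP[X1 X2] := xpos_bounds pp sl'.
rewrite /nbelow; set X := xpos p s.+1 in X1 X2 *.
transitivity (\sum_(c < l) \sum_(h < l) ((X <= c) && (c + h == s))%N)%N.
  rewrite pair_bigA /= -sum1_card big_mkcond /=; apply: eq_bigr => -[c h] _ /=.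
  rewrite inE belowE // /color /=.
  have -> : (c%:Z + h%:Z - (l%:Z - 1) == s%:Z - (l%:Z - 1)) = (c + h == s)%N.
    by apply/eqP/eqP; lia.
  by have [->|_] := eqVneq (c + h)%N s; rewrite ?andbF ?andbT //; by case: ifP.
transitivity (\sum_(c < l) ((X <= c) && (c <= s) && (s - c < l)))%N.
  apply: eq_bigr => c _; have [Xc|cX] := leqP X c; last by rewrite big1.
  rewrite /=; have [/andP[cs scl]|H] := boolP ((c <= s) && (s - c < l))%N; last first.
    rewrite big1 // => h _; apply/eqP; rewrite eqb0; apply: contra H => /eqP <-.
    by rewrite leq_addr addKn ltn_ord.
  rewrite (bigD1 (Ordinal scl)) //= subnKC // eqxx big1 ?addn0 // => h.
  by rewrite -val_eqE /= => ne; apply/eqP; rewrite eqb0; apply: contra ne => /eqP <-; rewrite addKn.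
rewrite -(big_mkord xpredT (fun c => ((X <= c) && (c <= s) && (s - c < l) : nat))%N).
have mX : (X <= minn s.+1 l)%N by [].
rewrite (@big_cat_nat _ _ _ X) //=; last by lia.
rewrite [X in (X + _)%N]big_nat_cond [X in (X + _)%N]big1 => [|c]; last first.
  by move=> /andP[/andP[_ cX] _]; rewrite [(X <= c)%N]leqNgt cX.
rewrite add0n (@big_cat_nat _ _ _ (minn s.+1 l)) //=; last by lia.
rewrite [X in (_ + X)%N]big_nat_cond [X in (_ + X)%N]big1 => [|c cl]; last first.
  by apply/eqP; rewrite eqb0; apply/negP => /andP[/andP[h1 h2] h3]; lia.
rewrite addn0 (eq_big_nat _ _ (F2 := fun=> 1%N)) ?sum_nat_const_nat ?muln1 // => c cl.
by apply/eqP; rewrite eqb1; lia.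
Qed.

End Paths.

(** * Admissibility in terms of path coordinates *)

Section Admissible.
Variables (l k : nat).
Hypotheses (l_gt0 : (0 < l)%N) (k_gt1 : (1 < k)%N).
Variable ps : (k.-1).-tuple (word l).

(* [x]-coordinate of the [i]-th path after [m] steps; path [0] is the boundary
   path below which there is no box. *)
Definition xp (i m : nat) : nat := if i is _.+1 then xpos (pth ps i) m else minn m l.

(** Step [m] stands for color [m - l], and index [c] for [t_(c+1)]; path [0] makes the case [c = 1]
    uniform. *)
Definition Tz (c m : nat) : int := (xp c.-1 m)%:Z - (xp c m)%:Z.

Hypothesis ps_path : all (@is_path l) ps.

Lemma pth_path i : (0 < i < k)%N -> is_path (pth ps i).
Proof.
by move=> ik; apply: (allP ps_path); apply: mem_nth; rewrite size_tuple; lia.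
Qed.

Lemma xp_bounds i m : (i < k)%N -> (m <= l.*2)%N -> (m - l <= xp i m <= minn m l)%N.
Proof.
case: i => [|i] ik ml; first by rewrite /=; lia.
by apply: xpos_bounds => //; apply: pth_path.
Qed.

Lemma nbelow_pth i s : (0 < i < k)%N -> (s < l.*2.-1)%N ->
  (nbelow (pth ps i) (s%:Z - (l%:Z - 1)))%:Z = (xp 0 s.+1)%:Z - (xp i s.+1)%:Z.
Proof.
case: i => // i ik sl; rewrite nbelowE //; last exact: pth_path.
have /andP[_] := @xp_bounds i.+1 s.+1 ik ltac:(lia).
by rewrite /=; lia.
Qed.

Lemma tcountE c s : (0 < c < k)%N -> (s < l.*2.-1)%N ->
  tcount ps c.+1 (s%:Z - (l%:Z - 1)) = Tz c s.+1.
Proof.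
move=> ck sl; rewrite /tcount; case: eqP => [[->]|ne].
  by rewrite nbelow_pth //; lia.
rewrite /Tz !nbelow_pth //=; lia.
Qed.

Lemma all_colors (P : pred int) : reflect
  (forall m, (0 < m < l.*2)%N -> P (m.-1%:Z - (l%:Z - 1))) (all P (colors l)).
Proof.
apply: (iffP allP) => [h m ml|h j].
  by apply: h; apply/mapP; exists m.-1 => //; rewrite mem_iota; lia.
case/mapP => s; rewrite mem_iota => sl ->; apply: (h s.+1); lia.
Qed.

Lemma nestedP : reflect
  (forall c m, (1 < c < k)%N -> (0 < m < l.*2)%N -> (xp c m <= xp c.-1 m)%N)
  (nested ps).
Proof.
apply: (iffP allP) => [h c m ck ml|h c].
  have /all_colors /(_ m ml) := h c ltac:(by rewrite mem_iota; lia).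
  rewrite -lez_nat !nbelow_pth; [|lia..].
  by rewrite prednK; lia.
rewrite mem_iota => ck; apply/all_colors => m ml.
rewrite -lez_nat !nbelow_pth; [|lia..]; rewrite prednK; last by lia.
have := h c m ltac:(lia) ml; lia.
Qed.

Lemma weakP : reflect (forall m, (m <= l.*2)%N -> (m <= (xp 1 m).*2)%N)
  (weakly_below_diagonal (pth ps 1)).
Proof.
apply: (iffP forallP) => [h m ml|h m].
  have ml' : (m < l.*2.+1)%N by [].
  by have := h (Ordinal ml'); have := xypos (pth ps 1) ml => /=; lia.
have ml : (m <= l.*2)%N by rewrite -ltnS.
by have := h m ml; have := xypos (pth ps 1) ml => /=; lia.
Qed.

Lemma Tz_telescope c m : (0 < c)%N ->
  \sum_(1 <= a < c) Tz a m = (xp 0 m)%:Z - (xp c.-1 m)%:Z.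
Proof.
case: c => // c _; elim: c => [|c IHc]; first by rewrite big_geq // subrr.
by rewrite big_nat_recr //= IHc /Tz /=; lia.
Qed.

(** As [l - |m - l|] is the distance between the two boundary paths, the sum of the [t_a] telescopes
    to the distance left above path [c - 1]. *)
Lemma cond2aP c : (1 < c < k)%N -> reflect
  (forall m, (0 < m < l.*2)%N -> Tz c m <= Tz c.-1 m /\
     Tz 1 m <= (xp c m)%:Z - (m - l)%N%:Z)
  (cond_2a ps c.+1).
Proof.
move=> ck.
have E m : (0 < m < l.*2)%N ->
    (l%:Z - `|m.-1%:Z - (l%:Z - 1)| - tcount ps 2 (m.-1%:Z - (l%:Z - 1))
      - \sum_(2 <= a < c.+1) tcount ps a (m.-1%:Z - (l%:Z - 1)))
    = (xp c.-1 m)%:Z - (m - l)%N%:Z - Tz 1 m.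
  move=> ml; rewrite tcountE; [|lia..].
  rewrite big_add1 /= (eq_big_nat _ _ (F2 := fun a => Tz a m)) => [|a ac]; last first.
    by rewrite tcountE; [rewrite prednK //; lia|lia..].
  rewrite Tz_telescope ?prednK; [|lia..].
  rewrite /xp; lia.
apply: (iffP (all_colors _)) => h m ml; have := h m ml.
  rewrite /= tcountE; [|lia..]; rewrite E // prednK; last by lia.
  have := @tcountE c.-1 m.-1 ltac:(lia) ltac:(lia).
  rewrite !prednK; [|lia..] => ->.
  rewrite le_min => /andP[-> h2]; split=> //; move: h2; rewrite {1}/Tz; lia.
move=> [h1 h2]; rewrite /= tcountE; [|lia..]; rewrite E // prednK; last by lia.
have := @tcountE c.-1 m.-1 ltac:(lia) ltac:(lia).
rewrite !prednK; [|lia..] => ->.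
rewrite le_min h1 /=; rewrite {1}/Tz; lia.
Qed.

Lemma cond2bP c : (1 < c < k)%N -> reflect
  (forall m, ((l < m < l.*2)%N -> Tz c m <= Tz c m.-1) /\
             ((0 < m < l)%N -> Tz c m <= Tz c m.+1))
  (cond_2b ps c.+1).
Proof.
move=> ck; apply: (iffP (all_colors _)) => [h m|h m ml].
  split=> ml.
    have := h m ltac:(lia); rewrite tcountE; [|lia..].
    have -> : m.-1%:Z - (l%:Z - 1) - 1 = m.-2%:Z - (l%:Z - 1) by lia.
    rewrite tcountE; [|lia..]; rewrite !prednK; [|lia..].
    by case/andP => /implyP h1 _; apply: h1; lia.
  have := h m ltac:(lia); rewrite [tcount _ _ _]tcountE; [|lia..].
  have -> : m.-1%:Z - (l%:Z - 1) + 1 = m%:Z - (l%:Z - 1) by lia.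
  rewrite [tcount _ _ (m%:Z - _)]tcountE; [|lia..]; rewrite !prednK; [|lia..].
  by case/andP => _ /implyP h1; apply: h1; lia.
have [h1 h2] := h m; apply/andP; split; apply/implyP => jm.
  rewrite tcountE; [|lia..].
  have -> : m.-1%:Z - (l%:Z - 1) - 1 = m.-2%:Z - (l%:Z - 1) by lia.
  rewrite tcountE; [|lia..]; rewrite !prednK; [|lia..].
  by apply: h1; lia.
rewrite tcountE; [|lia..].
have -> : m.-1%:Z - (l%:Z - 1) + 1 = m%:Z - (l%:Z - 1) by lia.
rewrite tcountE; [|lia..]; rewrite !prednK; [|lia..].
by apply: h2; lia.
Qed.

End Admissible.

(** A decreasing sequence of bits, read cyclically, has one drop: the column changed by one step of
    the walk. It is column [0] when all bits are true. *)
Lemma bool_threshold (f : nat -> bool) k : (0 < k)%N -> f 0%N ->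
  (forall c, (0 < c < k)%N -> f c -> f c.-1) ->
  exists2 c0, (c0 < k)%N & forall c, (c < k)%N ->
    (if c is c'.+1 then f c' && ~~ f c else f k.-1) = (c == c0).
Proof.
move=> k0 f0 anti.
have mono c d : (c + d < k)%N -> f (c + d)%N -> f c.
  elim: d => [|d IHd] cd fd; first by rewrite addn0 in fd.
  by apply: IHd; [lia|have := anti _ _ fd; rewrite addnS /=; apply; lia].
have [fk|nfk] := boolP (f k.-1).
  exists 0%N => // -[|c] ck //; have := mono c.+1 (k.-1 - c.+1)%N.
  by rewrite subnKC; [move=> ->; rewrite ?andbF //|]; lia.
have ex : exists c, ~~ f c by exists k.-1.
case: (ex_minnP ex) => c0 nf0 c0min; have c0k : (c0 < k)%N by have := c0min _ nfk; lia.
exists c0 => // -[|c] ck.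
  by case: c0 nf0 {c0min c0k} => // /negPf; rewrite f0.
apply/idP/eqP => [/andP[fc nfc]|e].
  apply/eqP; rewrite eqn_leq c0min // andbT leqNgt; apply/negP => lt.
  have := mono c0 (c - c0)%N; rewrite subnKC //; move/(_ (ltnW ck) fc).
  by rewrite (negPf nf0).
rewrite e nf0 andbT; apply/negPn/negP => nfc.
by have := c0min _ nfc; rewrite -e ltnn.
Qed.

(** * From admissible sequences to walks *)

Section AdmWalk.
Variables (l k : nat).
Hypotheses (l_gt0 : (0 < l)%N) (k_gt1 : (1 < k)%N).
Local Notation seqs := ((k.-1).-tuple (word l)).

(** Column [0] is the unrecorded [t_1], the gap between the last path and the boundary path going up
    first, whose abscissa is the truncated [m - l]. *)
Definition ttp (ps : seqs) (c m : nat) : nat :=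
  if c is c'.+1 then (xp ps c' m - xp ps c m)%N else (xp ps k.-1 m - (m - l))%N.

Definition db (ps : seqs) (i m : nat) : bool :=
  if i is _.+1 then nth false (pth ps i) m else (m < l)%N.

Lemma xpS (ps : seqs) i m : (m < l.*2)%N -> xp ps i m.+1 = (xp ps i m + db ps i m)%N.
Proof.
case: i => [|i] ml; last exact: xposS.
by rewrite /=; case: ltnP => /=; lia.
Qed.

Lemma xp_init (ps : seqs) i : xp ps i 0 = 0%N.
Proof. by case: i => [|i] /=; [rewrite min0n|rewrite xpos0]. Qed.

Section FromAdmissible.
Variable ps : seqs.
Hypothesis adm : admissible ps.

Lemma adm_path : all (@is_path l) ps. Proof. by case/and4P: adm. Qed.

Lemma xp_end i : (i < k)%N -> xp ps i l.*2 = l.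
Proof.
move=> ik; have := @xp_bounds l k l_gt0 k_gt1 ps adm_path i l.*2 ik (leqnn _); lia.
Qed.

Lemma xp_anti c m : (0 < c < k)%N -> (m <= l.*2)%N -> (xp ps c m <= xp ps c.-1 m)%N.
Proof.
move=> ck ml; have [e|m0] := posnP m; first by rewrite e !xp_init.
move: ml; rewrite leq_eqVlt => /orP[/eqP ->|ml]; first by rewrite !xp_end //; lia.
have [c1|c1] := leqP c 1.
  have -> : c = 1%N by lia.
  by have := @xp_bounds l k l_gt0 k_gt1 ps adm_path 1 m ltac:(lia) (ltnW ml) => /=; lia.
have /and4P[_ /(nestedP l_gt0 k_gt1 adm_path) h _ _] := adm.
by apply: h; lia.
Qed.

Lemma TzE c m : (0 < c < k)%N -> (m <= l.*2)%N -> Tz ps c m = (ttp ps c m)%:Z.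
Proof.
move=> ck ml; have := xp_anti ck ml; case: c ck => // c ck /=.
by rewrite /Tz /= -/(xp ps c.+1 m); lia.
Qed.

Lemma cond2a_adm c m : (1 < c < k)%N -> (0 < m < l.*2)%N ->
  Tz ps c m <= Tz ps c.-1 m /\ Tz ps 1 m <= (xp ps c m)%:Z - (m - l)%N%:Z.
Proof.
move=> ck; have /and4P[_ _ _ /allP /(_ c.+1)] := adm.
rewrite mem_iota => /(_ ltac:(lia)) /andP[/(cond2aP l_gt0 k_gt1 adm_path ck) h _].
exact: h.
Qed.

Lemma cond2b_adm c m : (1 < c < k)%N ->
  ((l < m < l.*2)%N -> Tz ps c m <= Tz ps c m.-1) /\
  ((0 < m < l)%N -> Tz ps c m <= Tz ps c m.+1).
Proof.
move=> ck; have /and4P[_ _ _ /allP /(_ c.+1)] := adm.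
rewrite mem_iota => /(_ ltac:(lia)) /andP[_ /(cond2bP l_gt0 k_gt1 adm_path ck) h].
exact: h.
Qed.

(** By condition 2(b) the gap between the two paths does not shrink before color [0], so the lower
    step of path [c - 1] cannot be vertical when that of path [c] is horizontal. *)
Lemma db_up c m : (0 < c < k)%N -> (m < l)%N -> db ps c m -> db ps c.-1 m.
Proof.
move=> ck ml; have [c1|c1] := leqP c 1; first by have -> : c = 1%N by lia.
have ck' : (1 < c < k)%N by lia.
have ml2 : (m < l.*2)%N by lia.
have : Tz ps c m <= Tz ps c m.+1.
  have [e|m0] := posnP m; last by have [_] := cond2b_adm m ck'; apply; lia.
  rewrite e [X in X <= _](_ : _ = 0); last by rewrite /Tz !xp_init subrr.
  by rewrite TzE //; lia.
by rewrite /Tz !xpS //; case: (db ps c m); case: (db ps c.-1 m) => //=; lia.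
Qed.

Lemma db_dn c m : (0 < c < k)%N -> (l <= m < l.*2)%N -> db ps c.-1 m -> db ps c m.
Proof.
move=> ck /andP[lm ml2]; have [c1|c1] := leqP c 1.
  by have -> : c = 1%N by [lia]; rewrite /db /= ltnNge lm.
have ck' : (1 < c < k)%N by lia.
have : Tz ps c m.+1 <= Tz ps c m.
  have [e|ne] := eqVneq m.+1 l.*2; last first.
    by have [h _] := cond2b_adm m.+1 ck'; apply: h; lia.
  rewrite e [X in X <= _](_ : _ = 0); last by rewrite /Tz !xp_end ?subrr //; lia.
  by rewrite TzE //; lia.
by rewrite /Tz !xpS //; case: (db ps c m); case: (db ps c.-1 m) => //=; lia.
Qed.

Lemma adm_walk : walk l k (ttp ps).
Proof.
split.
- move=> [|c] ck /=.
    by rewrite xp_init xp_end; lia.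
  rewrite -/(xp ps c.+1 0) -/(xp ps c.+1 l.*2) !xp_init !xp_end ?subnn //; exact: ltnW.
- move=> c m ck ml; have [e|m0] := posnP m.
    by rewrite e /ttp; case: (c) => [|c']; rewrite !xp_init.
  move: ml; rewrite leq_eqVlt => /orP[/eqP ->|ml].
    case: c ck => [|c] ck /=; rewrite -?/(xp ps _.+1 _) ?xp_end; lia.
  have mm : (0 < m < l.*2)%N by rewrite m0.
  rewrite -lez_nat -TzE; [|lia..]; case: c ck => [|c] ck; last first.
    have [h _] := @cond2a_adm c.+2 m ck mm.
    by apply: le_trans h _; rewrite TzE //; lia.
  have b := @xp_bounds l k l_gt0 k_gt1 ps adm_path k.-1 m ltac:(lia) (ltnW ml).
  have e : (ttp ps 0 m)%:Z = (xp ps k.-1 m)%:Z - (m - l)%N%:Z by rewrite /ttp; lia.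
  (* Columns [0] and [1] are compared by condition 2(a) at its last index; for [k = 2] there is
     none, and the diagonal condition is used. *)
  rewrite e; have [k2|k2] := leqP k 2; last first.
    by have [_] := @cond2a_adm k.-1 m ltac:(lia) mm.
  have -> : xp ps k.-1 m = xp ps 1 m by congr (xp ps _ m); lia.
  have /and4P[_ _ /(weakP l_gt0 k_gt1 adm_path) h _] := adm.
  by have := h m (ltnW ml); rewrite /Tz /=; lia.
- move=> m ml; have ml2 : (m < l.*2)%N by lia.
  have [|||c0 c0k h] := @bool_threshold (fun c => db ps c m) k; [lia|by []| |].
    by move=> c ck; apply: db_up.
  exists c0 => // c ck; rewrite -h // /ttp.
  case: c ck {h} => [|c] ck; rewrite !xpS //.
    have := @xp_bounds l k l_gt0 k_gt1 ps adm_path k.-1 m ltac:(lia) (ltnW ml2).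
    by case: (db ps k.-1 m) => /=; lia.
  have := @xp_anti c.+1 m ltac:(lia) (ltnW ml2).
  have := @db_up c.+1 m ltac:(lia) ml; rewrite [c.+1.-1]/=.
  by case: (db ps c m); case: (db ps c.+1 m) => //= h; rewrite ?(h isT) //; try lia; have := h isT.
- move=> m /andP[lm ml2].
  have [|||c0 c0k h] := @bool_threshold (fun c => ~~ db ps c m) k; [lia|by rewrite /= -leqNgt| |].
    by move=> c ck; apply: contra; apply: db_dn => //; rewrite lm.
  exists c0 => // c ck; rewrite -h // /ttp.
  case: c ck {h} => [|c] ck; rewrite !xpS //.
    have := @xp_bounds l k l_gt0 k_gt1 ps adm_path k.-1 m.+1 ltac:(lia) ml2.
    by rewrite xpS //; case: (db ps k.-1 m) => /=; lia.
  have := @xp_anti c.+1 m ltac:(lia) (ltnW ml2).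
  have := @xp_anti c.+1 m.+1 ltac:(lia) ml2; rewrite !xpS // [c.+1.-1]/=.
  have := @db_dn c.+1 m ltac:(lia) ltac:(lia); rewrite [c.+1.-1]/=.
  by case: (db ps c m); case: (db ps c.+1 m) => //= h; try lia; have := h isT.
Qed.

End FromAdmissible.

Lemma ttp_inj (ps ps' : seqs) : admissible ps -> admissible ps' ->
  (forall c m, (c < k)%N -> (m <= l.*2)%N -> ttp ps c m = ttp ps' c m) -> ps = ps'.
Proof.
move=> a a' e.
have exp i m : (i < k)%N -> (m <= l.*2)%N -> xp ps i m = xp ps' i m.
  elim: i m => [//|i IHi] m ik ml.
  have := e i.+1 m ik ml; rewrite /ttp IHi // ?(ltnW ik) //.
  have := @xp_anti ps a i.+1 m ltac:(lia) ml; have := @xp_anti ps' a' i.+1 m ltac:(lia) ml.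
  by rewrite [_.-1]/= IHi // ?(ltnW ik) //; lia.
apply: eq_from_tnth => i; have il := ltn_ord i.
have ik : (i.+1 < k)%N by lia.
apply: eq_from_tnth => m; have ml := ltn_ord m.
rewrite !(tnth_nth false); have := exp i.+1 m.+1 ik ml; have := exp i.+1 m ik (ltnW ml).
rewrite !xpS // => ->; rewrite /db /pth /=.
rewrite (tnth_nth [tuple of nseq l.*2 true]) (tnth_nth [tuple of nseq l.*2 true]).
by case: (nth false _ _); case: (nth false _ _) => //; lia.
Qed.

End AdmWalk.

(** Used in both directions with [growth_walk], so that no inverse map has to be written down. *)
Lemma leq_card_rel (T1 T2 : finType) (A : {set T1}) (B : {set T2}) (E : T1 -> T2 -> Prop) :
  (forall a, a \in A -> exists2 b, b \in B & E a b) ->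
  (forall a a' b, a \in A -> a' \in A -> E a b -> E a' b -> a = a') ->
  (#|A| <= #|B|)%N.
Proof.
move=> ex inj.
have ex' (a : {x | x \in A}) : exists b, b \in B /\ E (val a) b.
  by have [b bB Eab] := ex _ (valP a); exists b.
have [f fE] := fin_all_exists ex'.
have f_inj : injective f.
  move=> a a' e; apply/val_inj; have [_ Ea] := fE a; have [_ Ea'] := fE a'.
  by apply: (inj _ _ (f a)); rewrite ?(valP a) ?(valP a') // e.
rewrite -card_sig -(card_codom f_inj); apply: subset_leq_card.
by apply/subsetP => b /codomP[a ->]; case: (fE a).
Qed.

(** * From walks to admissible sequences *)

Section WalkAdm.
Variables (l k : nat).
Hypotheses (l_gt0 : (0 < l)%N) (k_gt1 : (1 < k)%N).
Variable tt : nat -> nat -> nat.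
Hypothesis wtt : walk l k tt.

Lemma walk_letters : exists cc : 'I_(l.*2) -> nat, forall m : 'I_(l.*2),
  (cc m < k)%N /\ if (m < l)%N
    then forall c, (c < k)%N -> tt c m.+1 = (tt c m + (c == cc m))%N
    else forall c, (c < k)%N -> tt c m = (tt c m.+1 + (c == cc m))%N.
Proof.
have h (m : 'I_(l.*2)) : exists u, (u < k)%N /\ if (m < l)%N
    then forall c, (c < k)%N -> tt c m.+1 = (tt c m + (c == u))%N
    else forall c, (c < k)%N -> tt c m = (tt c m.+1 + (c == u))%N.
  have [_ _ up dn] := wtt; case: ltnP => ml.
    by have [c0 c0k e] := up m ml; exists c0.
  by have [|c0 c0k e] := dn m; [rewrite ml ltn_ord|exists c0].
exact: (fin_all_exists h).
Qed.

(* A path counts the columns of index [0] or larger than its own one. *)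
Let A (i c : nat) : bool := (c == 0)%N || (i < c)%N.
Let Xi (i m : nat) : nat := (\sum_(c < k) A i c * tt c m + (m - l))%N.

Lemma sum_A_step i m m' c0 : (c0 < k)%N ->
  (forall c, (c < k)%N -> tt c m' = tt c m + (c == c0))%N ->
  (\sum_(c < k) A i c * tt c m' = \sum_(c < k) A i c * tt c m + A i c0)%N.
Proof.
move=> c0k e; rewrite (bigD1 (Ordinal c0k)) //= [in RHS](bigD1 (Ordinal c0k)) //=.
rewrite e // eqxx mulnDr muln1 addnAC; congr (_ + _ + _)%N.
by apply: eq_bigr => c; rewrite -val_eqE /= => /negPf ne; rewrite e // ne addn0.
Qed.

Lemma XiD c m : (0 < c < k)%N -> Xi c.-1 m = (Xi c m + tt c m)%N.
Proof.
move=> /andP[c0 ck]; rewrite /Xi addnAC; congr (_ + _)%N.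
rewrite (bigD1 (Ordinal ck)) //= [in RHS](bigD1 (Ordinal ck)) //= addnC.
have -> : A c.-1 c by rewrite /A prednK // leqnn orbT.
have -> : A c c = false by rewrite /A ltnn orbF; lia.
rewrite mul0n mul1n add0n; congr (_ + _)%N; apply: eq_bigr => c'.
rewrite -val_eqE /= => ne; congr (_ * _)%N; rewrite /A; congr (nat_of_bool (_ || _)); lia.
Qed.

Lemma Xi_ge c m : (tt 0 m + (m - l) <= Xi c m)%N.
Proof.
have k0 : (0 < k)%N by lia.
by rewrite leq_add2r (bigD1 (Ordinal k0)) //= mul1n leq_addr.
Qed.

Lemma Xi_last m : Xi k.-1 m = (tt 0 m + (m - l))%N.
Proof.
have k0 : (0 < k)%N by lia.
rewrite /Xi; congr (_ + _)%N; rewrite (bigD1 (Ordinal k0)) //= mul1n big1 ?addn0 // => c.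
rewrite -val_eqE /= /A => /negPf ->; have ck := ltn_ord c.
by rewrite (_ : (k.-1 < c)%N = false) //; lia.
Qed.

Lemma walk_adm : exists2 ps : (k.-1).-tuple (word l), admissible ps &
  forall c m, (c < k)%N -> (m <= l.*2)%N -> ttp ps c m = tt c m.
Proof.
have [cc ccE] := walk_letters; have [t0 ta _ _] := wtt.
(* A step is horizontal when [Xi i] grows: during the ascent if the column that moves is counted,
   during the descent if it is not, since then [m - l] grows while the counted columns stay. *)
pose bit i (m : 'I_(l.*2)) := A i (cc m) (+) (l <= m)%N.
pose ps : (k.-1).-tuple (word l) := [tuple [tuple bit i.+1 m | m < l.*2] | i < k.-1].
have dbE i (m : 'I_(l.*2)) : (i < k)%N -> db ps i m = bit i m.
  case: i => [|i] ik; first by rewrite /= /bit /A lt0n orbN addTb ltnNge.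
  have ik' : (i < k.-1)%N by lia.
  by rewrite /= /pth /= -[i]/(val (Ordinal ik')) nth_mktuple nth_mktuple.
have xpE i m : (i < k)%N -> (m <= l.*2)%N -> xp ps i m = Xi i m.
  move=> ik; elim: m => [_|m IHm ml].
    rewrite xp_init /Xi sub0n addn0 big1 // => c _.
    by have [-> _] := t0 c (ltn_ord c); rewrite muln0.
  rewrite xpS // IHm ?(ltnW ml) // -[m]/(val (Ordinal ml)) dbE //= /bit.
  have [c0k] := ccE (Ordinal ml); rewrite [val _]/= /Xi; case: ltnP => lm e.
    rewrite (sum_A_step _ c0k e) addbF.
    by have -> : (m.+1 - l = m - l)%N by [lia]; rewrite addnAC.
  rewrite (sum_A_step i c0k e) addbT subSn // addnS.
  by case: (A i _) => /=; lia.
have pp : all (@is_path l) ps.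
  apply/(all_nthP [tuple of nseq l.*2 true]) => i ik0; have ik : (i < k.-1)%N by move: ik0; rewrite [X in (_ < X)%N]size_tuple.
  have : xp ps i.+1 l.*2 = l.
    rewrite xpE //; last by lia.
    rewrite /Xi big1 => [|c _]; last by have [_ ->] := t0 c (ltn_ord c); rewrite muln0.
    by lia.
  by rewrite /= /xpos take_oversize ?size_tuple // => e; apply/eqP.
have TzE c m : (0 < c < k)%N -> (m <= l.*2)%N -> Tz ps c m = (tt c m)%:Z.
  by move=> ck ml; rewrite /Tz !xpE ?XiD //; lia.
exists ps; last first.
  move=> [|c] m ck ml; rewrite /ttp !xpE //; try lia.
    by rewrite Xi_last addnK.
  by rewrite (@XiD c.+1) // addKn.
have t10 m : (m <= l.*2)%N -> (tt 1 m <= tt 0 m)%N by move=> ml; apply: ta.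
apply/and4P; split=> //.
- apply/(nestedP l_gt0 k_gt1 pp) => c m ck ml.
  by rewrite !xpE ?XiD ?leq_addr //; lia.
- apply/(weakP l_gt0 k_gt1 pp) => m ml.
  have := @XiD 1 m ltac:(lia); rewrite -!xpE //; last by lia.
  have := Xi_ge 1 m; rewrite -xpE //; have := t10 m ml.
  by rewrite [1.-1]/= [xp ps 0 m]/=; lia.
apply/allP => i; rewrite mem_iota => ik.
have [c -> ck] : exists2 c, i = c.+1 & (1 < c < k)%N by exists i.-1; lia.
apply/andP; split.
  apply/(cond2aP l_gt0 k_gt1 pp ck) => m ml; rewrite !TzE; [|lia..].
  split; first by have := ta c.-1 m; rewrite prednK; [move=> h; have := h ltac:(lia) ltac:(lia)|]; lia.
  by have := Xi_ge c m; rewrite -xpE; [|lia..]; have := t10 m ltac:(lia); lia.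
apply/(cond2bP l_gt0 k_gt1 pp ck) => m; split=> ml; rewrite !TzE; try lia.
  have ml' : (m.-1 < l.*2)%N by lia.
  have [_] := ccE (Ordinal ml'); rewrite /= ltnNge (_ : (l <= m.-1)%N) /=; last by lia.
  by move=> /(_ c ltac:(lia)); rewrite prednK; lia.
have ml' : (m < l.*2)%N by lia.
have [_] := ccE (Ordinal ml'); rewrite /= (_ : (m < l)%N) /=; last by lia.
by move=> /(_ c ltac:(lia)); lia.
Qed.

End WalkAdm.

Lemma growth_walk_ext l k (s : {perm 'I_l}) tt tt' :
  (forall c m, (c < k)%N -> (m <= l.*2)%N -> tt c m = tt' c m) ->
  growth_walk k s tt -> growth_walk k s tt'.
Proof.
move=> e [x [y [gr gA gB]]]; exists x, y; split=> // m i ml il.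
  by rewrite gA //; apply: eq_conj_part => c ck; apply: e => //; lia.
by rewrite gB //; apply: eq_conj_part => c ck; apply: e => //; lia.
Qed.

Lemma card_admissible l k : (0 < l)%N -> (1 < k)%N ->
  #|admissible_sequences l k| = #|Av l k|.
Proof.
move=> l_gt0 k_gt1; apply/eqP; rewrite eqn_leq; apply/andP; split.
  apply: (leq_card_rel (E := fun ps s => growth_walk k s (ttp ps))).
    move=> ps; rewrite inE => adm.
    exact: (walk_growth l_gt0 (adm_walk l_gt0 k_gt1 adm)).
  move=> ps ps' s; rewrite !inE => a a' g g'; apply: (ttp_inj l_gt0 k_gt1 a a').
  exact: (growth_walk_uniq l_gt0 (adm_walk l_gt0 k_gt1 a) (adm_walk l_gt0 k_gt1 a') g g').
apply: (leq_card_rel (E := fun s (ps : (k.-1).-tuple (word l)) => growth_walk k s (ttp ps))).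
  move=> s sA; have [tt w g] := growth_exists l_gt0 sA.
  have [ps adm e] := walk_adm l_gt0 k_gt1 w; exists ps; first by rewrite inE.
  by apply: growth_walk_ext g => c m ck ml; rewrite e.
by move=> s s' ps _ _; apply: (growth_perm_uniq l_gt0).
Qed.

(** * The multiplicity *)

Section Gamma.
Variables (K : numFieldType) (n l : nat).
Hypotheses (n_gt1 : (1 < n)%N) (l_gt0 : (0 < l)%N) (l_le : (l.*2 <= n)%N).
Local Notation nd := (node n_gt1 l_gt0 l_le).

Lemma chain_coef_out m (j : 'I_n) : (l <= j <= n - l)%N ->
  chain_coef n_gt1 l_gt0 l_le m j = 0%N.
Proof.
move=> jl; apply: big1 => i _; rewrite (_ : _ == _ = false) ?mul0n //.
apply/negbTE/eqP => /(congr1 (@nat_of_ord n)); have il := ltn_ord i.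
by rewrite nodeE; [case: ifP|]; lia.
Qed.

Lemma chain_gcoef (j : 'I_n) :
  chain_coef n_gt1 l_gt0 l_le (gcoef l) j = (l - minn j (n - j))%N.
Proof.
have jn := ltn_ord j.
have [jl|lj] := ltnP j l.
  have -> : j = nd (l.-1 + j)%N.
    by apply/ord_inj; rewrite nodeE; [case: ifP|]; lia.
  rewrite chain_coef_node /gcoef ?nodeE; try lia.
  by case: ifP; lia.
have [jl|jl] := leqP j (n - l); first by rewrite chain_coef_out; lia.
have -> : j = nd (j - (n - l).+1)%N.
  by apply/ord_inj; rewrite nodeE; [case: ifP|]; lia.
rewrite chain_coef_node /gcoef ?nodeE; try lia.
by case: ifP; lia.
Qed.

Lemma gamma_coef : gamma K n l = \sum_(j < n) alpha K n j *+ (l - minn j (n - j)).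
Proof.
rewrite (gammaE K n_gt1 l_gt0 l_le) chain_coefE.
by apply: eq_bigr => j _; rewrite chain_gcoef.
Qed.

(** The coefficients of [gamma] are convex along the cycle away from vertex [0], so the other
    coroots take nonnegative values; at [0] the pairing with [gamma] is [2], leaving [k - 2]. *)
Lemma dominant_gamma k : (1 < k)%N ->
  dominant_integral (Lambda K n 0 *+ k - gamma K n l).
Proof.
move=> k2 a; have an := ltn_ord a.
pose c (x : nat) := (l - minn x (n - x))%N.
have e : gamma K n l (Some a) =
    (c a)%:R *+ 2 - (c (a.+1 %% n)%N)%:R - (c ((a + n.-1) %% n)%N)%:R.
  rewrite -(cartan_sum n_gt1 (fun x => (c x)%:R) a) gamma_coef sum_ffunE.
  apply: eq_bigr => j _; rewrite ffunMnE -[LHS]mulr_natr; congr (_ * _).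
  by rewrite ffunE.
rewrite weightD weightN e ffunMnE ffunE.
have [a0|a0] := posnP (a : nat).
  exists (k - 2)%N; rewrite a0 modn_small // add0n modn_small; last by lia.
  have -> : c 0%N = l by rewrite /c; lia.
  have -> : c 1%N = l.-1 by rewrite /c; lia.
  have -> : c n.-1 = l.-1 by rewrite /c; lia.
  by rewrite natrB // -[in l%:R](prednK l_gt0) -natr1 /= mulr1n; ring.
rewrite mul0rn.
have -> : ((a + n.-1) %% n = a.-1)%N.
  have -> : (a + n.-1 = a.-1 + n)%N by lia.
  by rewrite modnDr modn_small //; lia.
have -> : c (a.+1 %% n)%N = c a.+1.
  by rewrite modnS_small //; case: eqP => // ->; rewrite /c; lia.
exists (c a.+1 + c a.-1 - (c a).*2)%N; rewrite [RHS]natrB; last by rewrite /c; lia.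
by rewrite natrD -muln2 natrM; ring.
Qed.

End Gamma.

Section InSpan.
Variables (K : fieldType) (V : lmodType K) (I : finType) (b : I -> V).

Lemma spans_in_span v : spans b v -> in_span b v.
Proof.
apply: spans_min => [|i].
  split; first by exists (fun=> 0); rewrite big1 // => i _; rewrite scale0r.
  move=> a _ _ [c ->] [c' ->]; exists (fun i => a * c i + c' i).
  rewrite scaler_sumr -big_split; apply: eq_bigr => i _.
  by rewrite scalerDl scalerA.
exists (fun j => (j == i)%:R); rewrite (bigD1 i) //= eqxx scale1r big1 ?addr0 //.
by move=> j /negPf ->; rewrite scale0r.
Qed.

End InSpan.

Section Main.
Variables (K : numClosedFieldType) (n l k : nat).
Hypotheses (n_gt1 : (1 < n)%N) (l_gt0 : (0 < l)%N) (l_le : (l.*2 <= n)%N).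
Hypothesis k_gt1 : (1 < k)%N.
Variables (g : affineSl K n) (V : lieModule g) (v0 : V).
Hypothesis v0_neq0 : v0 != 0.
Local Notation la := (Lambda K n 0 *+ k).
Hypothesis v_la : weight_space la v0.
Hypothesis ee_v : forall i, act (ee g i) v0 = 0.
Hypothesis gen_v : forall U : V -> Prop, is_submodule U -> U v0 -> forall w, U w.
Hypothesis nilp : forall i, locally_nilpotent V (ff g i).
Local Notation Fp := (Fperm n_gt1 l_gt0 l_le v0).

Lemma spans_words w : spans (fword v0) w.
Proof.
apply: (gen_v (spans_fword_submodule v_la ee_v)).
exact: (spans_gen (fword v0) [::]).
Qed.

Lemma ff_v0 (i : 'I_n) : i != 0%N :> nat -> act (ff g i) v0 = 0.
Proof.
move=> i0; have la_i : la (Some i) = 0%:R by rewrite ffunMnE ffunE (negPf i0) mul0rn.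
exact: (ff_pow_eq0 n_gt1 v_la ee_v la_i (nilp i)).
Qed.

Lemma f0_v0 : iter k.+1 (act (ff g (node n_gt1 l_gt0 l_le l.-1))) v0 = 0.
Proof.
apply: (ff_pow_eq0 n_gt1 v_la ee_v _ (nilp _)); rewrite ffunMnE ffunE nodeE; last by lia.
by rewrite ltnn subnn eqxx.
Qed.

Lemma count_geq_iota t m : count (leq t) (iota 0 m) = (m - t)%N.
Proof.
elim: m => // m IHm; rewrite -addn1 iotaD count_cat IHm /= addn0 add0n.
by case: leqP => /=; lia.
Qed.

Lemma count_geq_ord t : count (fun a : 'I_l => t <= a)%N (enum 'I_l) = (l - t)%N.
Proof. by rewrite -count_geq_iota -val_enum_ord count_map. Qed.

Lemma Fperm_weight s : weight_space (la - gamma K n l) (Fp s).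
Proof.
rewrite (_ : gamma K n l = cdeg K n_gt1 l_gt0 l_le (Mdeg (graph s))).
  exact: Mon_weight.
rewrite (gammaE K n_gt1 l_gt0 l_le); apply: eq_cdeg => i iN.
rewrite /Mdeg /graph count_map /gcoef.
have [il|li] := leqP i l.-1.
  transitivity (l - (l.-1 - i))%N; first by lia.
  rewrite -count_geq_ord; apply: eq_count => a /=; have := ltn_ord a; lia.
transitivity (l - (i - l.-1))%N; first by lia.
have ps : perm_eq (enum 'I_l) (map s (enum 'I_l)).
  apply: uniq_perm; rewrite ?(map_inj_uniq (@perm_inj _ s)) ?enum_uniq // => a.
  rewrite mem_enum; symmetry; apply/mapP; exists (s^-1 a)%g; rewrite ?permKV //.
  by rewrite mem_enum.
rewrite -count_geq_ord (seq.permP ps) count_map; apply: eq_count => a /=.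
by have := ltn_ord a; lia.
Qed.

(** Placing all holes and particles in slot [0] gives a nonzero matrix coefficient. *)
Lemma Fperm_neq0 s : Fp s != 0.
Proof.
apply/eqP => F0; have k0 : (0 < k)%N by lia.
have r := Rel_Mon k n_gt1 l_gt0 l_le v0 (graph s).
rewrite [Mon _ _ _ _ _]F0 in r.
have e := Rel_inj v_la ee_v v0_neq0 r.
have := graph_coef K n_gt1 l_gt0 l_le (fun=> Ordinal k0) (fun=> Ordinal k0) s.
by rewrite e ffunE eqxx; case: forallP => // [[]].
Qed.

Lemma main_weight :
  [/\ is_maximal_weight V (la - gamma K n l),
      dominant_integral (la - gamma K n l)
    & multiplicity_is V (la - gamma K n l) #|admissible_sequences l k|].
Proof.
split; last 2 first.
- exact: dominant_gamma.
- rewrite card_admissible //; exists (fun i => Fp (enum_val i)); split.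
  + by move=> i; apply: Fperm_weight.
  + exact: Fperm_indep.
  move=> v wv; apply: spans_in_span.
  have := weight_spans_Fperm n_gt1 l_gt0 l_le v_la ff_v0 (spans_words v) wv.
  apply: spans_min; first exact: spans_subspace.
  by move=> s; apply: (spans_Av ff_v0 f0_v0).
split; first by exists (Fp 1%g); [exact: Fperm_weight|exact: Fperm_neq0].
move=> [w ww /eqP]; apply; have [r e] := spans_words w; rewrite e in ww *.
rewrite (weight_proj (fword_weight v_la) ww) big_pred0 // => -[c u] /=.
apply/negbTE/eqP; rewrite -addrA => /addrI eu.
(* Vertex [l] is outside the support of [gamma] but [delta] has coefficient [1] there, so
   [gamma - delta] is not the degree of a word. *)
have ln : (l < n)%N by lia.
have : wdeg K u + delta K n = gamma K n l.
  by rewrite -[wdeg K u]opprK eu opprD opprK subrK.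
rewrite (gammaE K n_gt1 l_gt0 l_le) chain_coefE /wdeg /delta -big_split /=.
under eq_bigr do rewrite -mulrSr.
move/(alpha_indep n_gt1)/(_ (Ordinal ln)).
by rewrite chain_coef_out //=; lia.
Qed.

End Main.

From mathcomp Require Import reals complex.

Local Open Scope complex_scope.

Theorem theorem4p6 (R : realType) (n k l : nat)
  (n_ge2 : (2 <= n)%N) (k_ge2 : (2 <= k)%N)
  (l_ge1 : (1 <= l)%N) (l_le : (l <= n %/ 2)%N)
  (g : affineSl R[i] n) (V : lieModule g)
  (V_int : integrable V)
  (V_hw : highest_weight_module V (Lambda R[i] n 0 *+ k)) :
  [/\ is_maximal_weight V (Lambda R[i] n 0 *+ k - gamma R[i] n l),
      dominant_integral (Lambda R[i] n 0 *+ k - gamma R[i] n l)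
    & multiplicity_is V (Lambda R[i] n 0 *+ k - gamma R[i] n l)
        #|admissible_sequences l k|].
Proof.
have l_le2 : (l.*2 <= n)%N by lia.
have [_ _ nilp] := V_int; have [v0 [v0_neq0 v_la ee_v gen_v]] := V_hw.
exact: (main_weight n_ge2 l_ge1 l_le2 k_ge2 v0_neq0 v_la ee_v gen_v nilp).
Qed.
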